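(* For every integer $n\ge 13$ and every prime power $q\ge5$, there exists a non-standard primitive action of $\mathrm{PSL}_n(q)$ on a set $\Omega$ such that $\mathrm{B}(\mathrm{PSL}_n(q),\Omega)\ge n-1$.
   Context: Let $G$ act on a set $\Omega$. A finite sequence $\Lambda$ of points of $\Omega$ is a base if its pointwise stabilizer in $G$ is trivial, and is a minimal base if it is a base and no proper subsequence of it is a base. $\mathrm{B}(G,\Omega)$ is the maximum size of a minimal base. A standard action of an almost simple group $G$ with socle $S$ is a transitive action where either $S=A_n$ and the action is on subsets or uniform partitions of $\{1,\dots,n\}$, or $G$ is classical and the action is a subspace action. An action is non-standard if it is not standard. Here (following Burness) a subspace action of a classical group with socle $S$ and natural module $V$ is a primitive action with point stabilizer $H$ such that every maximal subgroup of $S$ containing $H\cap S$ either acts reducibly on $V$, or is an orthogonal group $O^{\pm}_{2m}(q)$ in $S=Sp_{2m}(q)'$ with $q$ even. *)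

(* Defs.v *)
From HB Require Import structures.
From mathcomp Require Import all_boot all_order all_algebra.
From mathcomp Require Import all_fingroup all_solvable all_character.

Set Implicit Arguments.
Unset Strict Implicit.
Unset Printing Implicit Defensive.

Import GroupScope GRing.Theory.

Section Bases.

Variables (gT : finGroupType) (T : finType).
Variables (G : {group gT}) (to : {action gT &-> T}).
Implicit Type s : seq T.

Definition is_base s : bool := 'C_G([set:: s] | to) == 1.

(* A proper subsequence is a subsequence of strictly smaller size. *)
Definition is_minimal_base s : bool :=
  is_base s
  && [forall k : 'I_(size s), forall t : k.-tuple T, subseq t s ==> ~~ is_base t].

(* A minimal base has no repeated point, so the bound #|T| on the sizes
   excludes nothing (base_number_max).  If there is no base, i.e., if the
   action is not faithful, the value is 0. *)
Definition base_number : nat :=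
  \max_(k < #|T|.+1 | [exists s : k.-tuple T, is_minimal_base s]) k.

Lemma minimal_base_uniq s : is_minimal_base s -> uniq s.
Proof.
case/andP=> base_s /forallP min_s; apply/negPn/negP=> nuniq_s.
have lt_s: size (undup s) < size s.
  by rewrite ltn_neqAle size_undup andbT; apply: contraNneq nuniq_s => eq_s;
     rewrite -[s]undup_id ?undup_uniq // -?(eq_uniq eq_s (mem_undup s)) undup_uniq.
have /forallP/(_ (in_tuple (undup s))) := min_s (Ordinal lt_s).
rewrite /= undup_subseq /= => /negP[]; move: base_s; rewrite /is_base.
by rewrite (_ : [set:: undup s] = [set:: s]) //;
   apply/setP=> x; rewrite !inE mem_undup.
Qed.

Lemma base_number_max s : is_minimal_base s -> size s <= base_number.
Proof.
move=> min_s; have le_s: size s < #|T|.+1.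
  by rewrite ltnS -(card_uniqP (minimal_base_uniq min_s)) max_card.
rewrite (bigmax_sup (Ordinal le_s)) //.
by apply/existsP; exists (in_tuple s).
Qed.

End Bases.

Section ProjectiveSpecialLinear.

Variables (n : nat) (F : finFieldType).

Definition SL_set : {set {'GL_n[F]}} := [set g | (\det (GLval g) == 1)%R].

Lemma SL_group_set : group_set SL_set.
Proof.
apply/group_setP; split=> [|g h]; rewrite !inE; first by rewrite GL_1E det1.
by rewrite GL_ME det_mulmx => /eqP-> /eqP->; rewrite mulr1.
Qed.

Definition SL : {group {'GL_n[F]}} := group SL_group_set.

(* PSL_n(F) as a group of its own, so that actions of it are total actions. *)
Definition PSL : finGroupType := subg_of (SL / 'Z(SL))%G.

Definition PSL_proj (g : {'GL_n[F]}) : PSL :=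
  subg (SL / 'Z(SL))%G (coset 'Z(SL) g).

Lemma PSL_projM : {in SL &, {morph PSL_proj : g h / g * h}}.
Proof.
have nZ := subsetP (gFnorm _ SL : SL \subset 'N('Z(SL))).
move=> g h Sg Sh; rewrite /PSL_proj morphM ?nZ //.
by rewrite morphM //; apply: mem_quotient.
Qed.

Canonical PSL_proj_morphism := Morphism PSL_projM.

Lemma ker_PSL_proj : 'ker PSL_proj = 'Z(SL).
Proof.
have nZ := subsetP (gFnorm _ SL : SL \subset 'N('Z(SL))).
apply/setP=> g; apply/idP/idP=> [Kg | Zg].
  have Sg := dom_ker Kg; have /(congr1 sgval) := mker Kg.
  rewrite /PSL_proj subgK ?mem_quotient //= => Cg1.
  by apply: coset_idr (nZ g Sg) Cg1.
have Sg : g \in SL := subsetP (center_sub SL) g Zg.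
apply/kerP => //=; apply: val_inj.
by rewrite /PSL_proj /= (coset_id Zg) subgK.
Qed.

Lemma im_PSL_proj : PSL_proj @* SL = [set: PSL].
Proof.
apply/setP=> u; rewrite inE; apply/morphimP.
have /morphimP[g _ Sg def_u] := subgP u.
by exists g => //; rewrite /= /PSL_proj -def_u sgvalK.
Qed.

End ProjectiveSpecialLinear.

Section StandardActions.

Variables (gT : finGroupType) (T : finType).
Variables (G S : {group gT}) (to : {action gT &-> T}).

(* An identification f of G with a subgroup of 'S_m that maps the socle S to
   the alternating group, and an identification h of the G-set T with the set
   of all k-subsets of 'I_m, or of all partitions of 'I_m into parts of size k. *)
Definition alternating_standard : Prop :=
  exists (m : nat) (f : {morphism G >-> 'S_m}),
    [/\ 'injm f, f @* S = 'Alt_('I_m)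
      & exists k : nat,
          (exists h : T -> {set 'I_m},
             [/\ injective h,
                 h @: [set: T] = [set A : {set 'I_m} | #|A| == k]
               & forall x g, g \in G -> h (to x g) = ('P^*)%act (h x) (f g)])
       \/ (exists h : T -> {set {set 'I_m}},
             [/\ injective h,
                 h @: [set: T] = [set P : {set {set 'I_m}}
                   | partition P [set: 'I_m] & [forall A in P, #|A| == k]]
               & forall x g, g \in G -> h (to x g) = ('P^*^*)%act (h x) (f g)])].

End StandardActions.

Section SubspaceActions.

(* X is a classical group of matrices, acting on its natural module of row
   vectors, and pi is the projection of X onto the socle pi @* X of G. *)
Variables (n : nat) (F : finFieldType) (X : {group {'GL_n[F]}}).
Variables (gT : finGroupType) (pi : {morphism X >-> gT}).

Definition acts_reducibly (M : {group gT}) : Prop :=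
  ~ mx_irreducible (subg_repr (GLrepr F n.-1) (subsetT (pi @*^-1 M))).

Definition isometries (J : 'M[F]_n.-1.+1) : {set {'GL_n[F]}} :=
  [set g | (GLval g *m J *m (GLval g)^T)%R == J].

Definition quad_form (A : 'M[F]_n.-1.+1) (v : 'rV[F]_n.-1.+1) : F :=
  ((v *m A *m v^T) 0 0)%R.

Definition quad_isometries (A : 'M[F]_n.-1.+1) : {set {'GL_n[F]}} :=
  [set g | [forall v, quad_form A (v *m GLval g)%R == quad_form A v]].

(* With q even: J is a nondegenerate alternating form whose isometry group has
   derived subgroup X, and M is the group of the elements of X that preserve a
   quadratic form A whose polarization is J (both signs are allowed). *)
Definition is_orthogonal_in_symplectic (M : {group gT}) : Prop :=
  2 \in [pchar F]%R /\
  exists J A : 'M[F]_n.-1.+1,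
    [/\ [/\ J \in unitmx, (forall v, quad_form J v = 0%R) & (A + A^T)%R = J],
        X :=: (isometries J)^`(1)
      & M :=: pi @* (X :&: quad_isometries A)].

Definition subspace_action (T : finType) (G : {group gT})
    (to : {action gT &-> T}) : Prop :=
  [primitive G, on [set: T] | to] /\
  exists x : T, forall M : {group gT},
    maximal M (pi @* X) -> 'C_G[x | to] :&: pi @* X \subset M ->
    acts_reducibly M \/ is_orthogonal_in_symplectic M.

End SubspaceActions.

(* PSL_n(F) is its own socle, and its natural module is F^n. *)
Definition PSL_standard (n : nat) (F : finFieldType) (T : finType)
    (to : {action PSL n F &-> T}) : Prop :=
  [transitive [set: PSL n F], on [set: T] | to] /\
  (alternating_standard [set: PSL n F] [set: PSL n F] to
   \/ subspace_action (PSL_proj_morphism n F) [set: PSL n F] to).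

(* Main.v *)
Require Import Defs.
From mathcomp Require Import all_boot all_order all_algebra.
From mathcomp Require Import all_fingroup all_solvable all_field all_character.
From mathcomp Require Import ring zify.

(* The group acts on the cosets of the image H of the monomial subgroup N of
   SL_n(q), i.e., on the frames of F^n: sets of n lines whose sum is direct.

   N is maximal in SL_n(q).  If a subgroup M > N contains a non-monomial matrix,
   then conjugates of diagonal and of scaled permutation matrices by it produce
   a non-monomial matrix in M with a row of weight 1.  Deleting that row and its
   column leads to a subgroup of GL_(n-1)(q) that contains all monomial matrices
   and more; iterating down to dimension 2, such a subgroup contains a
   transvection.  Hence so does M, which therefore contains all of them.

   A minimal base is a minimal subsequence of a given base, so that its size is
   at least the number of points which this base cannot spare.  Bases of frames
   with n - 1 such points are obtained from the frame E of the coordinate lines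
   <e_i> and its modifications K_i in which e_i is replaced with e_i + e_(i+1).
   - If w^n <> 1 for some nonzero w in F, then E, K_0, ..., K_(n-2) will do:
     K_i is needed because of a diagonal matrix with two distinct entries, which
     exists in determinant 1, and is constant on {0..i} and on {i+1..n-1}.
   - If w^n = 1 for all nonzero w and q is even, K_0 and K_1 are replaced with
     two frames in which <e_0>, <e_1> become <e_0 + e_1>, <e_0 + a e_1>.  A
     diagonal matrix with entries x, x, y, ..., y and determinant 1 is scalar,
     as x^2 = y^2.
   - If w^n = 1 for all nonzero w and q is odd, K_0, K_1, K_2 and K_(n-2) are
     replaced with four frames that modify the first four coordinates: a
     Hadamard frame, and three frames which contain <e_3> and lines of the form
     <e_i +- e_j>.  The last coordinate is controlled by the determinant.

   PSL_n(q) is not an alternating group A_m because its Sylow subgroup for the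
   characteristic p is too large: |A_m|_p < 2^m by Legendre's formula.  The
   action is not a subspace action because H is irreducible and SL_n(q) does not
   preserve a nondegenerate form. *)

Set Implicit Arguments.
Unset Strict Implicit.
Unset Printing Implicit Defensive.

Import GRing.Theory.
Local Open Scope ring_scope.

(** * Monomial matrices *)

(** Only the rows are restricted, to at most one nonzero entry each; for an invertible matrix this
    is the usual notion. *)
Definition monomial (F : fieldType) n (A : 'M[F]_n) : bool :=
  [forall i, exists j, forall k, (k != j) ==> (A i k == 0)].

Section Monomial.

Variable F : fieldType.

Lemma monomialP n (A : 'M[F]_n) :
  reflect (forall i, exists j, forall k, k != j -> A i k = 0) (monomial A).
Proof.
apply: (iffP forallP) => H i.
  by have /existsP[j /forallP Hj] := H i; exists j => k /(implyP (Hj k))/eqP.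
by have [j Hj] := H i; apply/existsP; exists j; apply/forallP=> k;
   apply/implyP=> /Hj->.
Qed.

Lemma nonmonomialP n (A : 'M[F]_n) :
  reflect (exists i j k, [/\ j != k, A i j != 0 & A i k != 0]) (~~ monomial A).
Proof.
apply: (iffP idP) => [|[i [j [k [njk Aij Aik]]]]]; last first.
  apply/monomialP=> /(_ i)[l Hl].
  have [ejl|/Hl] := eqVneq j l; last by apply/eqP.
  by have := Hl k; rewrite -ejl eq_sym => /(_ njk)/eqP; apply/negP.
rewrite negb_forall => /existsP[i]; rewrite negb_exists => /forallP H.
have sub l : exists2 k, k != l & A i k != 0.
  have := H l; rewrite negb_forall => /existsP[k].
  by rewrite negb_imply => /andP[]; exists k.
have [j _ Aij] := sub i; have [k nkj Aik] := sub j.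
by exists i, j, k; rewrite eq_sym.
Qed.

Lemma monomialM n (A B : 'M[F]_n) :
  monomial A -> monomial B -> monomial (A *m B).
Proof.
move=> /monomialP mA /monomialP mB; apply/monomialP=> i.
have [j Hj] := mA i; have [k Hk] := mB j; exists k => l nlk.
rewrite mxE (bigD1 j) //= Hk // mulr0 add0r big1 // => h nhj.
by rewrite Hj // mul0r.
Qed.

Lemma monomial_diag n (d : 'rV[F]_n) : monomial (diag_mx d).
Proof.
apply/monomialP=> i; exists i => k nki.
by rewrite mxE eq_sym (negPf nki).
Qed.

Lemma monomial_perm n (s : 'S_n) : monomial (perm_mx s : 'M[F]_n).
Proof.
apply/monomialP=> i; exists (s i) => k nki.
by rewrite !mxE eq_sym (negPf nki).
Qed.

Lemma monomial1 n : monomial (1%:M : 'M[F]_n).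
Proof. by rewrite -perm_mx1 monomial_perm. Qed.

Lemma monomial_block m1 m2 (A : 'M[F]_m1) (D : 'M_m2) :
  monomial A -> monomial D -> monomial (block_mx A 0 0 D).
Proof.
move=> /monomialP mA /monomialP mD; apply/monomialP=> i.
case: (split_ordP i) => i' ->.
  have [j Hj] := mA i'; exists (lshift _ j) => k.
  case: (split_ordP k) => k' -> nk.
    by rewrite block_mxEul Hj //; apply: contraNneq nk => ->.
  by rewrite block_mxEur mxE.
have [j Hj] := mD i'; exists (rshift _ j) => k.
case: (split_ordP k) => k' -> nk.
  by rewrite block_mxEdl mxE.
by rewrite block_mxEdr Hj //; apply: contraNneq nk => ->.
Qed.

Lemma det_diag_unit n (d : 'rV[F]_n) :
  (forall i, d 0 i != 0) -> diag_mx d \in unitmx.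
Proof.
move=> nzd; rewrite unitmxE det_diag unitfE.
by apply/prodf_neq0=> i _.
Qed.

Lemma unitmx_row n (A : 'M[F]_n) i : A \in unitmx -> exists j, A i j != 0.
Proof.
move=> uA; apply/existsP; rewrite -negb_forall; apply/negP=> /forallP A0.
have: row i 1%:M = 0 :> 'rV[F]_n.
  rewrite -(mulmxV uA) row_mul (_ : row i A = 0) ?mul0mx //.
  by apply/rowP=> j; rewrite !mxE; apply/eqP.
move/rowP/(_ i)/eqP; rewrite !mxE eqxx; exact/negP/oner_neq0.
Qed.

Lemma unitmx_col n (A : 'M[F]_n) j : A \in unitmx -> exists i, A i j != 0.
Proof.
rewrite -unitmx_tr => uA; have [i] := unitmx_row j uA.
by rewrite mxE; exists i.
Qed.

Lemma row_weight n (A : 'M[F]_n) i :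
  (exists j, forall k, k != j -> A i k = 0)
  \/ exists j k, [/\ j != k, A i j != 0 & A i k != 0].
Proof.
case: (boolP [exists j, forall k, (k != j) ==> (A i k == 0)]) => [|N1].
  by case/existsP=> j /forallP Hj; left; exists j => k /(implyP (Hj k))/eqP.
right; have sub l : exists2 k, k != l & A i k != 0.
  move: N1; rewrite negb_exists => /forallP/(_ l).
  rewrite negb_forall => /existsP[k].
  by rewrite negb_imply => /andP[]; exists k.
have [j _ Aij] := sub i; have [k nkj Aik] := sub j.
by exists j, k; rewrite eq_sym.
Qed.

(** Multiply e_i A = A_ir e_r on the right by B: then e_i = A_ir (e_r B), so row r of B is a
    multiple of e_i. *)
Lemma weight1_inv n (A B : 'M[F]_n) i r : A *m B = 1%:M ->
  (forall k, k != r -> A i k = 0) -> forall k, k != i -> B r k = 0.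
Proof.
move=> AB Ai k nki.
have ABi l : (A *m B) i l = A i r * B r l.
  by rewrite mxE (bigD1 r) //= big1 ?addr0 // => m nmr; rewrite Ai // mul0r.
have := ABi k; rewrite AB mxE eq_sym (negPf nki) => /esym/eqP.
rewrite mulf_eq0 => /orP[] /eqP // A0.
have := ABi i; rewrite AB mxE eqxx A0 mul0r => /eqP.
by rewrite (negPf (oner_neq0 F)).
Qed.

Lemma monomialV n (A : 'M[F]_n) : A \in unitmx -> monomial A ->
  monomial (invmx A).
Proof.
move=> uA /monomialP mA; apply/monomialP=> r.
have [i nzA] := unitmx_col r uA; have [j Aj] := mA i.
have er : r = j by apply: contraNeq nzA => /Aj->.
by exists i; apply: weight1_inv (mulmxV uA) _; rewrite er.
Qed.

Lemma invmx_uniq n (A B : 'M[F]_n) : A *m B = 1%:M -> invmx A = B.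
Proof.
move=> AB; have [uA _] := mulmx1_unit AB.
by rewrite -[RHS]mul1mx -(mulVmx uA) -mulmxA AB mulmx1.
Qed.

Lemma conj_diagE n (A B : 'M[F]_n) (d : 'rV_n) i k :
  (A *m diag_mx d *m B) i k = \sum_j d 0 j * A i j * B j k.
Proof.
rewrite mxE; apply: eq_bigr => j _; rewrite mul_mx_diag !mxE.
by rewrite (mulrC (A i j)).
Qed.

(** The equation g T = (g T g^-1) g says that T sends each row of g to a multiple of a row of g.
    Monomial conjugates are exploited in this form. *)
Lemma monomial_conj_rows n (g T : 'M[F]_n) : g \in unitmx ->
  monomial (g *m T *m invmx g) ->
  forall i, exists i' c, forall l, (g *m T) i l = c * g i' l.
Proof.
move=> ug /monomialP m i; have [i' Hi'] := m i.
exists i', ((g *m T *m invmx g) i i') => l.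
have -> : (g *m T) i l = (g *m T *m invmx g *m g) i l by rewrite mulmxKV.
rewrite mxE (bigD1 i') //= big1 ?addr0 // => k nk.
by rewrite Hi' // mul0r.
Qed.

End Monomial.

(** Groups of invertible matrices are predicates, so that blocks of their elements can form groups
    of smaller dimension without the type of GL_n. *)
Definition mxgroup (F : fieldType) n (P : pred 'M[F]_n) : Prop :=
  [/\ forall A, P A -> A \in unitmx,
      forall A B, P A -> P B -> P (A *m B)
    & forall A, P A -> P (invmx A)].

Definition has_transvection (F : fieldType) n (P : pred 'M[F]_n) : Prop :=
  exists i j c, [/\ i != j, c != 0 & P (1%:M + c *: delta_mx i j)].

Section LowerBlocks.

Variable F : fieldType.

Lemma lower_blockM n (c c' : 'cV[F]_n) :
  block_mx 1%:M 0 c 1%:M *m block_mx 1%:M 0 c' 1%:M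
    = block_mx 1%:M 0 (c + c') 1%:M :> 'M_(1 + n).
Proof.
by rewrite mulmx_block !mulmx0 !mul0mx !mulmx1 !mul1mx !addr0 add0r addrC.
Qed.

Lemma lower_blockV n (c : 'cV[F]_n) :
  invmx (block_mx 1%:M 0 c 1%:M : 'M_(1 + n)) = block_mx 1%:M 0 (- c) 1%:M.
Proof.
by apply: invmx_uniq; rewrite lower_blockM subrr -scalar_mx_block.
Qed.

Lemma diag_blockV n (a : F) (d : 'rV[F]_n) : a != 0 -> (forall i, d 0 i != 0) ->
  invmx (block_mx a%:M 0 0 (diag_mx d) : 'M_(1 + n))
    = block_mx (a^-1)%:M 0 0 (diag_mx (\row_i (d 0 i)^-1)).
Proof.
move=> nza nzd; apply: invmx_uniq.
rewrite mulmx_block !mulmx0 !mul0mx !addr0 !add0r -scalar_mxM divff //.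
rewrite mulmx_diag scalar_mx_block; congr block_mx.
by rewrite -diag_const_mx; congr diag_mx; apply/rowP=> i; rewrite !mxE divff.
Qed.

Lemma lower_block_conj n (a : F) (d : 'rV[F]_n) (c : 'cV_n) :
  a != 0 -> (forall i, d 0 i != 0) ->
  let D := block_mx a%:M 0 0 (diag_mx d) : 'M_(1 + n) in
  D *m block_mx 1%:M 0 c 1%:M *m invmx D
    = block_mx 1%:M 0 (\col_i (d 0 i / a * c i 0)) 1%:M.
Proof.
move=> nza nzd D; rewrite diag_blockV // !mulmx_block.
rewrite !(mulmx0, mul0mx, mulmx1, mul1mx, addr0, add0r) -scalar_mxM divff //.
rewrite mulmx_diag; congr block_mx.
  by apply/colP=> i; rewrite mul_mx_scalar mul_diag_mx !mxE mulrA (mulrC a^-1).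
by rewrite -diag_const_mx; congr diag_mx; apply/rowP=> i; rewrite !mxE divff.
Qed.

Lemma lower_block_delta n (i : 'I_n) (c : F) :
  block_mx 1%:M 0 (c *: delta_mx i 0) 1%:M
    = 1%:M + c *: delta_mx (rshift 1 i) (lshift n 0) :> 'M_(1 + n).
Proof.
apply/matrixP=> k l; rewrite !mxE.
case: splitP => k' ek; rewrite !mxE; case: splitP => l' el; rewrite !mxE /=.
- have -> : (k == rshift 1 i) = false.
    by apply/eqP=> /(congr1 val) /=; rewrite ek ord1.
  rewrite andFb mulr0 addr0; congr (_%:R).
  by congr (nat_of_bool _); rewrite -!val_eqE /= ek el.
- have -> : (k == rshift 1 i) = false.
    by apply/eqP=> /(congr1 val) /=; rewrite ek ord1.
  by rewrite andFb mulr0 addr0 -val_eqE /= ek el ord1.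
- rewrite ord1 andbT -!val_eqE /= ek el ord1 /= eqSS andbT add0r.
  by [].
rewrite -!val_eqE /= ek el /= !eqSS andbF mulr0 addr0 //.
Qed.

End LowerBlocks.

Section FullMonomial.

Variable F : finFieldType.
Hypothesis q5 : (5 <= #|F|)%N.

Lemma avoid (s : seq F) : (size s <= 4)%N -> exists x, x \notin s.
Proof.
move=> le_s4; apply/existsP; rewrite -negb_forall; apply/negP=> /forallP sall.
suff: (#|F| <= size s)%N by rewrite leqNgt (leq_trans _ q5).
apply: leq_trans (card_size s); apply: subset_leq_card; apply/subsetP=> x _.
exact: sall.
Qed.

Lemma avoid4 (a b c d : F) : exists x, [/\ x != a, x != b, x != c & x != d].
Proof.
have [|x] := @avoid [:: a; b; c; d]; first by [].
by rewrite !inE !negb_or => /and4P[]; exists x.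
Qed.

End FullMonomial.

(** * Overgroups of the monomial subgroup of GL_n *)

Section FullMonomial2.

Variable F : finFieldType.
Hypothesis q5 : (5 <= #|F|)%N.

Definition reflection n (j : 'I_n) (x : F) : 'M[F]_n :=
  diag_mx (\row_l if l == j then x else 1).

(** A pseudoreflection is 1 plus a matrix of rank at most one, hence so are its conjugates, and [x]
    controls their entries. *)
Lemma conj_reflectionE n (A B : 'M[F]_n) j x i k : A *m B = 1%:M ->
  (A *m reflection j x *m B) i k = (i == k)%:R + (x - 1) * (A i j * B j k).
Proof.
move=> AB; have <- : (A *m B) i k = (i == k)%:R by rewrite AB mxE.
rewrite /reflection conj_diagE [in RHS]mxE (bigD1 j) //= [in RHS](bigD1 j) //= mxE eqxx.
under eq_bigr => l /negPf nlj do rewrite mxE nlj mul1r.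
by ring.
Qed.

Lemma reflection_root (x y : F) : 1 + (x - 1) * y = 0 -> y != 0 -> x = 1 - y^-1.
Proof.
move=> E nzy; apply: (mulIf nzy); rewrite mulrBl mul1r mulVf //.
have -> : x * y = 1 + (x - 1) * y + y - 1 by ring.
by rewrite E add0r.
Qed.

Lemma monomial_swap n (h : 'M[F]_n) (i j k l : 'I_n) :
  monomial (perm_mx (tperm i j) *m h *m perm_mx (tperm k l)) = monomial h.
Proof.
apply/idP/idP=> mh; last first.
  by apply: monomialM (monomial_perm _ _); apply: monomialM mh; apply: monomial_perm.
have -> : h = perm_mx (tperm i j)
      *m (perm_mx (tperm i j) *m h *m perm_mx (tperm k l)) *m perm_mx (tperm k l).
  by rewrite !mulmxA -perm_mxM tperm2 perm_mx1 mul1mx -mulmxA -perm_mxM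
             tperm2 perm_mx1 mulmx1.
apply: monomialM (monomial_perm _ _); apply: monomialM mh.
exact: monomial_perm.
Qed.

Lemma swapE n (h : 'M[F]_n) (i j k l a b : 'I_n) :
  (perm_mx (tperm i j) *m h *m perm_mx (tperm k l)) a b
    = h (tperm i j a) (tperm k l b).
Proof.
have -> : tperm k l = (tperm k l)^-1%g by rewrite tpermV.
by rewrite -col_permE mxE tpermV -row_permE mxE.
Qed.

Lemma block_of_row0 n (h : 'M[F]_(1 + n)) :
  (forall k, k != 0 -> h 0 k = 0) ->
  exists a c h', h = block_mx a%:M 0 c h'.
Proof.
move=> h0; exists (h 0 0), (dlsubmx h), (drsubmx h).
rewrite -[LHS]submxK; congr block_mx.
  by rewrite [LHS]mx11_scalar !mxE !lshift0.
by apply/matrixP=> i j; rewrite !mxE !ord1 lshift0 h0.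
Qed.

Lemma mxgroup_conj n (P : pred 'M[F]_n) A B :
  mxgroup P -> P A -> P B -> P (A *m B *m invmx A).
Proof. by case=> _ MP VP PA PB; apply: (MP _ _ _ (VP _ PA)); apply: MP. Qed.

Section Group.

Variables (n : nat) (P : pred 'M[F]_n).
Hypotheses (gP : mxgroup P).
Hypothesis (fP : forall A, A \in unitmx -> monomial A -> P A).

Lemma full_perm (s : 'S_n) : P (perm_mx s).
Proof. by apply: fP; rewrite ?unitmx_perm ?monomial_perm. Qed.

Lemma full_diag (d : 'rV_n) : (forall i, d 0 i != 0) -> P (diag_mx d).
Proof.
by move=> nzd; apply: fP; [apply: det_diag_unit | apply: monomial_diag].
Qed.

Lemma full_reflection j x : x != 0 -> P (reflection j x).
Proof.
by move=> nzx; apply: full_diag => i; rewrite mxE; case: ifP => // _;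
   apply: oner_neq0.
Qed.

(** Suppose that no such h exists. Then nonmonomial elements have no zero entry. For conjugates of
    reflections this fixes the products h_ij (h^-1)_ji, and finally forces x^2 - x + 1 = 0 for all x
    other than 0 and 1. *)
Lemma full_weight1 g : (3 <= n)%N -> P g -> ~~ monomial g ->
  exists h i j, [/\ P h, ~~ monomial h & forall k, k != j -> h i k = 0].
Proof.
move=> n3; have [uP MP VP] := gP.
case: (boolP [exists h : 'M[F]_n, exists i, exists j,
   [&& P h, ~~ monomial h & [forall k, (k != j) ==> (h i k == 0)]]]) => [|Nh].
  case/existsP=> h /existsP[i /existsP[j /and3P[Ph mh /forallP hk]]] _ _.
  by exists h, i, j; split=> // k /(implyP (hk k))/eqP.
have W h i j : P h -> (forall k, k != j -> h i k = 0) -> monomial h.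
  move=> Ph hk; apply: contraNT Nh => mh; apply/existsP; exists h.
  apply/existsP; exists i; apply/existsP; exists j; rewrite Ph mh /=.
  by apply/forallP=> k; apply/implyP=> /hk->.
(* If h_rj = 0, the conjugate by h of a reflection at j has row r equal to e_r, so it is monomial by
   [W]; but for a good x its row i is nonzero at two places where row j of h^-1 is. *)
have full_entries h : P h -> ~~ monomial h -> forall i j, h i j != 0.
  move=> Ph mh r j; apply/negP=> /eqP hrj; have uh := uP _ Ph.
  have hK := mulmxV uh; have Kh := mulVmx uh.
  have [i nzhij] := unitmx_col j uh.
  have [[k Bk]|[k [l [nkl Bk Bl]]]] := row_weight (invmx h) j.
    by apply/(negP mh)/(W h k j Ph)/(weight1_inv Kh).
  have [x [nx0 nx1 nx2 _]] := avoid4 q5 0 1 (1 - (h i j * invmx h j i)^-1) 0.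
  have Pt : P (h *m reflection j x *m invmx h).
    exact: mxgroup_conj gP Ph (full_reflection _ nx0).
  have /negP[] : ~~ monomial (h *m reflection j x *m invmx h); last first.
    apply: (W _ r r Pt) => m nmr.
    by rewrite conj_reflectionE // hrj mul0r mulr0 addr0 eq_sym (negPf nmr).
  have nz m : invmx h j m != 0 -> (h *m reflection j x *m invmx h) i m != 0.
    move=> nzB; rewrite conj_reflectionE //.
    have nzm : (x - 1) * (h i j * invmx h j m) != 0.
      by rewrite !mulf_neq0 // subr_eq0.
    have [eim|_] := eqVneq i m; last by rewrite add0r.
    subst m; apply: contraNneq nx2 => /reflection_root->; first by [].
    by rewrite mulf_neq0.
  by apply/nonmonomialP; exists i, k, l; rewrite !nz.
move=> Pg mg; have ug := uP _ Pg.
have gK := mulmxV ug; have Kg := mulVmx ug.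
have [o [o' [o'' [no no2 no3]]]] :
    exists o o' o'' : 'I_n, [/\ o' != o, o'' != o & o' != o''].
  by exists (Ordinal (ltnW (ltnW n3))), (Ordinal (ltnW n3)), (Ordinal n3).
have nonmono_refl h j (x : F) : P h -> ~~ monomial h -> x != 0 -> x != 1 ->
   ~~ monomial (h *m reflection j x *m invmx h).
  move=> Ph mh nx0 nx1; have hB := mulmxV (uP _ Ph).
  have nz k : k != o -> (h *m reflection j x *m invmx h) o k != 0.
    move=> nko; rewrite conj_reflectionE // (eq_sym o k) (negPf nko) add0r.
    rewrite !mulf_neq0 ?subr_eq0 ?full_entries ?VP //.
    apply: contra mh => mB; rewrite -(invmxK h); apply: monomialV mB.
    by rewrite unitmx_inv uP.
  by apply/nonmonomialP; exists o, o', o''; rewrite !nz.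
(* If the product y is not 1, then x = 1 - 1/y is neither 0 nor 1 and makes the entry (i, i) of a
   nonmonomial conjugate vanish, against [full_entries]. *)
have entries1 h : P h -> ~~ monomial h -> forall i j, h i j * invmx h j i = 1.
  move=> Ph mh i j; have hB := mulmxV (uP _ Ph).
  have nz : h i j * invmx h j i != 0.
    rewrite mulf_neq0 ?full_entries ?VP //.
    apply: contra mh => mB; rewrite -(invmxK h); apply: monomialV mB.
    by rewrite unitmx_inv uP.
  pose x := 1 - (h i j * invmx h j i)^-1.
  have nx1 : x != 1.
    by rewrite /x subr_eq addrC -subr_eq subrr eq_sym invr_eq0.
  have [x0|nx0] := eqVneq x 0.
    by apply: invr_inj; apply/eqP; rewrite invr1 eq_sym -subr_eq0 -/x x0.
  have := full_entries _ _ (nonmono_refl h j x Ph mh nx0 nx1) i i.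
  rewrite conj_reflectionE // eqxx /x addrAC subrr sub0r mulNr mulVf // subrr.
  rewrite eqxx => /(_ _)/negP[] //.
  exact: mxgroup_conj gP Ph (full_reflection _ nx0).
(* Apply [entries1] to the conjugate of the reflection itself, whose inverse is the conjugate with
   x^-1: the product is (x - 1)(x^-1 - 1), which must be 1. *)
have cubic (x : F) : x != 0 -> x != 1 -> x ^+ 2 - x + 1 = 0.
  move=> nx0 nx1; have h1 := entries1 g Pg mg.
  have Pr := mxgroup_conj gP Pg (full_reflection o nx0).
  have mr := nonmono_refl g o x Pg mg nx0 nx1.
  have e1 := h1 o o; have e2 := h1 o' o.
  have := entries1 _ Pr mr o o'.
  have -> : invmx (g *m reflection o x *m invmx g)
          = g *m reflection o x^-1 *m invmx g.
    apply: invmx_uniq; rewrite -!mulmxA (mulmxA (invmx g)) Kg mul1mx.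
    rewrite [in X in g *m X]mulmxA mulmx_diag (_ : diag_mx _ = 1%:M).
      by rewrite mul1mx.
    rewrite -diag_const_mx; congr diag_mx; apply/rowP=> i; rewrite !mxE.
    by case: ifP => _; rewrite ?mulr1 ?divff.
  rewrite !conj_reflectionE // (eq_sym o o') (negPf no) !add0r.
  have -> : (x - 1) * (g o o * invmx g o o') * ((x^-1 - 1) * (g o' o * invmx g o o))
     = (x - 1) * (x^-1 - 1) * ((g o o * invmx g o o) * (g o' o * invmx g o o')) by ring.
  rewrite e1 e2 !mulr1 => E; apply: (mulfI (invr_neq0 nx0)).
  have -> : x^-1 * (x ^+ 2 - x + 1) = (x^-1 * x) * x - x^-1 * x + x^-1 by ring.
  rewrite mulVf // mul1r mulr0.
  have -> : x - 1 + x^-1 = 1 - (x - 1) * (x^-1 - 1) + (x^-1 * x - 1) by ring.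
  by rewrite E mulVf // !subrr addr0.
have [x [nx0 nx1 _ _]] := avoid4 q5 0 1 0 0.
(* The only roots of the quadratic polynomial are x and 1 - x, so a fifth field element contradicts
   [cubic]. *)
have [y [ny0 ny1 nyx nyx']] := avoid4 q5 0 1 x (1 - x).
have cx := cubic x nx0 nx1; have cy := cubic y ny0 ny1.
have : (y - x) * (y - (1 - x)) = 0.
  have -> : (y - x) * (y - (1 - x)) = (y ^+ 2 - y + 1) - (x ^+ 2 - x + 1) by ring.
  by rewrite cx cy subrr.
by move/eqP; rewrite mulf_eq0 !subr_eq0 (negPf nyx) (negPf nyx').
Qed.

End Group.

Section Blocks.

Variables (n : nat) (P : pred 'M[F]_(1 + n)).
Hypotheses (gP : mxgroup P).
Hypothesis (fP : forall A, A \in unitmx -> monomial A -> P A).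

Definition corner : pred 'M[F]_n := fun h => P (block_mx 1%:M 0 0 h).

Lemma unitmx_lblock a c (h : 'M[F]_n) :
  ((block_mx a%:M 0 c h : 'M_(1 + n)) \in unitmx) = (a != 0) && (h \in unitmx).
Proof. by rewrite !unitmxE det_lblock unitrM det_scalar1 unitfE. Qed.

Lemma unitmx_corner (h : 'M[F]_n) :
  ((block_mx 1%:M 0 0 h : 'M_(1 + n)) \in unitmx) = (h \in unitmx).
Proof. by rewrite unitmx_lblock oner_neq0. Qed.

Lemma mxgroup_corner : mxgroup corner.
Proof.
have [uP MP VP] := gP; split=> [h /uP|h k Ph Pk|h Ph].
- by rewrite unitmx_corner.
- have := MP _ _ Ph Pk; rewrite mulmx_block !mulmx0 !mul0mx mulmx1.
  by rewrite !addr0 !add0r.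
have uh := uP _ Ph; rewrite unitmx_corner in uh.
rewrite /corner -[block_mx _ _ _ _](@invmx_uniq _ _ (block_mx 1%:M 0 0 h)).
  exact: VP.
rewrite mulmx_block !mulmx0 !mul0mx mulmx1 !addr0 !add0r mulmxV //.
by rewrite -scalar_mx_block.
Qed.

Lemma full_corner (h : 'M[F]_n) : h \in unitmx -> monomial h -> corner h.
Proof.
move=> uh mh; apply: fP; first by rewrite unitmx_corner.
by apply: monomial_block => //; apply: monomial1.
Qed.

Lemma corner_transvection : has_transvection corner -> has_transvection P.
Proof.
case=> i [j [c [nij nzc Pc]]].
exists (rshift 1 i), (rshift 1 j), c; split=> //.
suff <- : block_mx 1%:M 0 0 (1%:M + c *: delta_mx i j)
   = 1%:M + c *: delta_mx (rshift 1 i) (rshift 1 j) :> 'M_(1 + n) by [].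
apply/matrixP=> k l; case: (split_ordP k) => k' ->; case: (split_ordP l) => l' ->.
- by rewrite block_mxEul !mxE !eq_lshift !eq_lrshift /= mulr0 addr0.
- by rewrite block_mxEur !mxE !eq_lrshift /= mulr0 addr0.
- by rewrite block_mxEdl !mxE eq_rlshift !eq_lrshift andbF mulr0 addr0.
by rewrite block_mxEdr !mxE !eq_rshift.
Qed.

(** The commutator with a diagonal matrix that differs from 1 only at k multiplies c_i by d_i - 1,
    so it keeps only the entry c_k. *)
Lemma full_lower1 (c : 'cV_n) : P (block_mx 1%:M 0 c 1%:M) -> c != 0 ->
  has_transvection P.
Proof.
have [uP MP VP] := gP => Pc /cV0Pn[k nzk].
have [x [nx0 nx1 _ _]] := avoid4 q5 0 1 0 0.
pose d : 'rV[F]_n := \row_i if i == k then x else 1.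
have nzd i : d 0 i != 0 by rewrite mxE; case: ifP => // _; apply: oner_neq0.
have Pd : P (block_mx 1%:M 0 0 (diag_mx d)).
  by apply: full_corner; [apply: det_diag_unit | apply: monomial_diag].
have := MP _ _ (mxgroup_conj gP Pd Pc) (VP _ Pc).
rewrite lower_block_conj ?oner_neq0 // lower_blockV lower_blockM => P1.
exists (rshift 1 k), (lshift n 0), ((x - 1) * c k 0); split.
- by rewrite eq_rlshift.
- by rewrite mulf_neq0 // subr_eq0.
rewrite -lower_block_delta; congr (is_true (P (block_mx _ _ _ _))): P1.
apply/colP=> i; rewrite !mxE divr1 andbT; case: eqP => [->|_].
  by rewrite mulr1; ring.
by rewrite mul1r subrr mulr0.
Qed.

(** The commutator with diag(x, 1, ..., 1) cancels h and leaves a lower unipotent matrix whose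
    column is a nonzero multiple of c. *)
Lemma full_lower a c (h : 'M[F]_n) : P (block_mx a%:M 0 c h) -> c != 0 ->
  has_transvection P.
Proof.
have [uP MP VP] := gP => Pc nzc; have := uP _ Pc.
rewrite unitmx_lblock => /andP[nza uh].
have [x [nx0 nx1 _ _]] := avoid4 q5 0 1 0 0.
pose D : 'M[F]_(1 + n) := block_mx x%:M 0 0 1%:M.
have PD : P D.
  apply: fP; first by rewrite unitmx_lblock nx0 unitmx1.
  apply: monomial_block; last exact: monomial1.
  by rewrite -diag_const_mx monomial_diag.
have PD' : P (block_mx (x^-1)%:M 0 0 1%:M).
  apply: fP; first by rewrite unitmx_lblock invr_eq0 nx0 unitmx1.
  apply: monomial_block; last exact: monomial1.
  by rewrite -diag_const_mx monomial_diag.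
have := MP _ _ (mxgroup_conj gP Pc PD) PD'.
have -> : invmx (block_mx a%:M 0 c h)
    = block_mx (a^-1)%:M 0 (- (invmx h *m c *m (a^-1)%:M)) (invmx h).
  apply: invmx_uniq; rewrite mulmx_block !mulmx0 !mul0mx !addr0 !add0r.
  rewrite -scalar_mxM divff // mulmxN !mulmxA mulmxV // mul1mx subrr.
  by rewrite -scalar_mx_block.
rewrite !mulmx_block !mulmx0 !mul0mx !addr0 !add0r !mulmx1 mulmxV //.
rewrite !mul0mx addr0 -!scalar_mxM mulmxN !mulmxA mulmxV // mul1mx => P1.
apply: (full_lower1 (c := ((x - 1) / (a * x)) *: c)); last first.
  by rewrite scaler_eq0 (negPf nzc) orbF !mulf_neq0 ?subr_eq0 ?invr_eq0 ?mulf_neq0.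
congr (is_true (P (block_mx _ _ _ _))): P1.
  by congr (_%:M); field; rewrite nza nx0.
apply/colP=> i; rewrite mulmxBl -!mulmxA -!scalar_mxM !mul_mx_scalar !mxE.
by field; rewrite nza nx0.
Qed.

(** Transpositions bring a row of weight 1 to the top and its nonzero entry to the corner. If the
    column below is nonzero, [full_lower] gives a transvection; otherwise the remaining block is
    nonmonomial, and the corner entry can be scaled to 1. *)
Lemma full_step : (2 <= n)%N -> (exists2 g, P g & ~~ monomial g) ->
  has_transvection P \/ (exists2 h, corner h & ~~ monomial h).
Proof.
move=> n2 [g Pg mg]; have [uP MP VP] := gP.
have [h [i [j [Ph mh hij]]]] := full_weight1 gP fP n2 Pg mg.
pose h1 := perm_mx (tperm 0 i) *m h *m perm_mx (tperm 0 j).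
have Ph1 : P h1 by apply: (MP); [apply: (MP)|]; rewrite ?(full_perm fP).
have mh1 : ~~ monomial h1 by rewrite monomial_swap.
have [|a [c [h' eh1]]] := @block_of_row0 _ h1.
  move=> k nk0; rewrite swapE tpermL hij //.
  by apply: contraNneq nk0 => /(canRL (tpermK _ _)); rewrite tpermR => ->.
rewrite eh1 in Ph1 mh1.
have [c0|nzc] := eqVneq c 0; last by left; apply: full_lower Ph1 nzc.
rewrite c0 in Ph1 mh1; have := uP _ Ph1.
rewrite unitmx_lblock => /andP[nza uh]; right; exists h'.
  have PD : P (block_mx (a^-1)%:M 0 0 1%:M).
    apply: fP; first by rewrite unitmx_lblock invr_eq0 nza unitmx1.
    apply: monomial_block; last exact: monomial1.
    by rewrite -diag_const_mx monomial_diag.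
  have := MP _ _ Ph1 PD; rewrite mulmx_block !mulmx0 !mul0mx !addr0 !add0r.
  by rewrite mulmx1 -scalar_mxM divff.
apply: contra mh1 => mh'; apply: (@monomial_block _ 1 n) => //.
by rewrite -diag_const_mx monomial_diag.
Qed.

End Blocks.
End FullMonomial2.

(** * Explicit matrices of dimensions 2 and 3 *)

Section SmallMatrices.

Variable R : comNzRingType.

Definition mx2 (a b c d : R) : 'M[R]_2 :=
  \matrix_(i, j) nth 0 (nth [::] [:: [:: a; b]; [:: c; d]] i) j.

Definition mx3 (a b c d e f g h i : R) : 'M[R]_3 :=
  \matrix_(r, s)
    nth 0 (nth [::] [:: [:: a; b; c]; [:: d; e; f]; [:: g; h; i]] r) s.

Lemma mx2E (A : 'M[R]_2) :
  A = mx2 (A 0 0) (A 0 ord_max) (A ord_max 0) (A ord_max ord_max).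
Proof.
apply/matrixP=> i j; rewrite mxE.
by case: i j => [[|[|[]]] // ?] [[|[|[]]] // ?] /=; congr (A _ _); apply: val_inj.
Qed.

Lemma mx2M a b c d a' b' c' d' : mx2 a b c d *m mx2 a' b' c' d'
  = mx2 (a * a' + b * c') (a * b' + b * d') (c * a' + d * c') (c * b' + d * d').
Proof.
apply/matrixP=> i j; rewrite !mxE !big_ord_recl big_ord0 !mxE /= addr0.
by case: i j => [[|[|[]]] // ?] [[|[|[]]] // ?].
Qed.

Lemma mx3M a b c d e f g h i a' b' c' d' e' f' g' h' i' :
  mx3 a b c d e f g h i *m mx3 a' b' c' d' e' f' g' h' i'
  = mx3 (a * a' + (b * d' + c * g')) (a * b' + (b * e' + c * h'))
        (a * c' + (b * f' + c * i'))
        (d * a' + (e * d' + f * g')) (d * b' + (e * e' + f * h'))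
        (d * c' + (e * f' + f * i'))
        (g * a' + (h * d' + i * g')) (g * b' + (h * e' + i * h'))
        (g * c' + (h * f' + i * i')).
Proof.
apply/matrixP=> r s; rewrite !mxE !big_ord_recl big_ord0 !mxE /= addr0.
by case: r s => [[|[|[|[]]]] // ?] [[|[|[|[]]]] // ?].
Qed.

Lemma block_mx2 a b c d :
  block_mx 1%:M 0 0 (mx2 a b c d) = mx3 1 0 0 0 a b 0 c d :> 'M_(1 + 2).
Proof.
apply/matrixP=> r s.
case: (split_ordP r) => r' ->; case: (split_ordP s) => s' ->.
- by rewrite block_mxEul !mxE !ord1.
- by rewrite block_mxEur !mxE !ord1; case: s' => [[|[|[]]]].
- by rewrite block_mxEdl !mxE !ord1; case: r' => [[|[|[]]]].
by rewrite block_mxEdr !mxE; case: r' s' => [[|[|[]]] // ?] [[|[|[]]] // ?].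
Qed.

End SmallMatrices.

(** * Overgroups of the monomial matrices in dimension 2 *)

Section TwoByTwo.

Variable F : finFieldType.
Hypothesis q5 : (5 <= #|F|)%N.
Variable P : pred 'M[F]_2.
Hypothesis gP : mxgroup P.
Hypothesis fP : forall A, A \in unitmx -> monomial A -> P A.

Lemma full_mx2_diag (a d : F) : a != 0 -> d != 0 -> P (mx2 a 0 0 d).
Proof.
move=> nza nzd.
have -> : mx2 a 0 0 d = diag_mx (\row_i nth 0 [:: a; d] i).
  apply/matrixP=> i j; rewrite !mxE.
  by case: i j => [[|[|[]]] // ?] [[|[|[]]] // ?].
by apply: full_diag fP _ _ => i; rewrite mxE; case: i => [[|[|[]]]].
Qed.

Lemma full_mx2_swap : P (mx2 0 1 1 0).
Proof.
have -> : mx2 0 1 1 0 = perm_mx (tperm 0 ord_max) :> 'M[F]_2.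
  apply/matrixP=> i j; rewrite !mxE permE /=.
  by case: i j => [[|[|[]]] // ?] [[|[|[]]] // ?].
exact: full_perm.
Qed.

Lemma full_mx2_upper (a b d : F) : a != 0 -> b != 0 -> d != 0 ->
  P (mx2 a b 0 d) -> has_transvection P.
Proof.
have [_ MP _] := gP => nza nzb nzd PA.
have := MP _ _ (full_mx2_diag (invr_neq0 nza) (invr_neq0 nzd)) PA.
rewrite mx2M !(mul0r, mulr0, addr0, add0r) !mulVf // => P1.
exists 0, ord_max, (a^-1 * b); split=> //; first by rewrite mulf_neq0 ?invr_eq0.
congr (is_true (P _)): P1; apply/matrixP=> i j; rewrite !mxE.
by case: i j => [[|[|[]]] // ?] [[|[|[]]] // ?]; rewrite /= ?mulr0 ?mulr1 ?addr0 ?add0r.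
Qed.

Lemma full_mx2_zero (a b c : F) : a != 0 -> b != 0 -> c != 0 ->
  P (mx2 a b c 0) -> has_transvection P.
Proof.
have [_ MP _] := gP => nza nzb nzc PA.
have := MP _ _ PA full_mx2_swap.
rewrite mx2M !(mul0r, mulr0, mulr1, addr0, add0r).
exact: full_mx2_upper.
Qed.

(** Row and column scalings normalize three entries to 1; the invariant ad/(bc) remains in the last
    one. *)
Lemma full_mx2_scale (a b c d : F) :
  a != 0 -> b != 0 -> c != 0 -> P (mx2 a b c d) ->
  P (mx2 1 1 1 ((a * d) / (b * c))).
Proof.
have [_ MP _] := gP => nza nzb nzc PA.
have := MP _ _ (full_mx2_diag (invr_neq0 nza) (invr_neq0 nzc)) PA.
rewrite mx2M !(mul0r, mulr0, addr0, add0r) !mulVf // => PB.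
have nzab : a / b != 0 by rewrite mulf_neq0 ?invr_eq0.
have := MP _ _ PB (full_mx2_diag (oner_neq0 _) nzab).
rewrite mx2M !(mul0r, mulr0, addr0, add0r, mulr1).
suff -> : a^-1 * b * (a / b) = 1.
  by suff -> : c^-1 * d * (a / b) = (a * d) / (b * c) by []; field; rewrite nzb nzc.
by field; rewrite nza nzb.
Qed.

Lemma mx2_unit (a b c d : F) : mx2 a b c d \in unitmx -> a * d != b * c.
Proof.
apply: contraTneq => e; rewrite unitmxE; apply/negP.
rewrite (expand_det_row _ 0) !big_ord_recl big_ord0 /cofactor !det_mx11 !mxE /=.
by rewrite expr0 expr1 mul1r addr0 mulN1r mulrN e subrr unitr0.
Qed.

Lemma full_mx2_generic (a b c d : F) :
  a != 0 -> b != 0 -> c != 0 -> d != 0 -> a * d + b * c != 0 ->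
  P (mx2 a b c d) -> has_transvection P.
Proof.
have [uP MP _] := gP => nza nzb nzc nzd nzs PA.
have := full_mx2_scale nza nzb nzc PA; have := mx2_unit (uP _ PA).
set k := _ / _ => nab PB.
have nzk : k != 0 by rewrite !mulf_neq0 ?invr_eq0 ?mulf_neq0.
have nzbc : b * c != 0 by rewrite mulf_neq0.
have nk1 : 1 - k != 0.
  rewrite subr_eq0 eq_sym; apply: contra nab => /eqP k1.
  by rewrite -[a * d](divfK nzbc) -/k k1 mul1r.
have nkN1 : 1 + k != 0.
  apply: contra nzs => /eqP k1.
  by rewrite -[a * d](divfK nzbc) -/k -[X in _ + X]mul1r -mulrDl (addrC k) k1 mul0r.
(* The multiplier -k^2 is chosen to kill the last entry of B diag(-k^2, 1) B, where B has the
   entries 1, 1, 1, k; the other entries are nonzero as k is not 0, 1 or -1. *)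
have nzk2 : - k ^+ 2 != 0 by rewrite oppr_eq0 expf_neq0.
have := MP _ _ (MP _ _ PB (full_mx2_diag nzk2 (oner_neq0 _))) PB.
rewrite !mx2M !(mul0r, mulr0, mul1r, addr0, add0r, mulr1).
have -> : - k ^+ 2 + k * k = 0 by ring.
have -> : - k ^+ 2 + 1 = (1 - k) * (1 + k) by ring.
have -> : - k ^+ 2 + k = k * (1 - k) by ring.
by apply: full_mx2_zero; rewrite mulf_neq0.
Qed.

(** Up to scaling, the matrix H with rows (1, 1), (1, -1) is the one without zeros which
    [full_mx2_generic] does not cover. The product H diag(r, 1) H is generic for some r, which is
    found outside characteristic 5. *)
Lemma full_mx2_hadamard : has_transvection P \/ (5%:R = 0 :> F) \/
  ~ (P (mx2 1 1 1 (- 1))).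
Proof.
have [uP MP _] := gP.
case: (boolP (P (mx2 1 1 1 (- 1)))) => PA; last by right; right.
have n1 : 1 != -1 :> F by have := mx2_unit (uP _ PA); rewrite !mul1r eq_sym.
(* The product has diagonal entries r + 1 and other entries r - 1, so the generic condition on it
   reads 2 (r^2 + 1) <> 0. *)
have good (r : F) : r != 0 -> r != 1 -> r != -1 -> r ^+ 2 != -1 ->
    has_transvection P.
  move=> nr0 nr1 nrN1 nr2.
  have := MP _ _ (MP _ _ PA (full_mx2_diag nr0 (oner_neq0 _))) PA.
  rewrite !mx2M !(mul0r, mulr0, mul1r, addr0, add0r, mulr1, mulrN1, mulN1r, opprK).
  have nr1' : r - 1 != 0 by rewrite subr_eq0.
  have nrN1' : r + 1 != 0 by rewrite addr_eq0.
  apply: full_mx2_generic => //.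
  have -> : (r + 1) * (r + 1) + (r - 1) * (r - 1) = (1 + 1) * (r ^+ 2 + 1) by ring.
  by rewrite mulf_neq0 // addr_eq0.
have [r [nr0 nr1 nrN1 _]] := avoid4 q5 0 1 (-1) 0.
have [r2|] := eqVneq (r ^+ 2) (-1); last by left; apply: good nrN1 _.
have n2 : (1 + 1 : F) != 0 by rewrite addr_eq0.
(* When r^2 = -1, replace r with r + 1 in characteristic 3, where (r + 1)^2 = -r; otherwise with 2,
   unless 4 = -1. *)
have [e2|n2N1] := eqVneq (1 + 1 : F) (-1).
  left; apply: (good (r + 1)).
  - by rewrite addr_eq0.
  - by rewrite -subr_eq0 addrK.
  - apply: contra nr1 => /eqP e; apply/eqP.
    by rewrite -[r](addrK 1) e -opprD e2 opprK.
  have -> : (r + 1) ^+ 2 = r ^+ 2 + 1 + (1 + 1) * r by ring.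
  rewrite r2 addNr add0r e2 mulN1r eqr_opp.
  by [].
have [e4|] := eqVneq ((1 + 1 : F) ^+ 2) (-1).
  right; left; have -> : 5%:R = (1 + 1) ^+ 2 + 1 :> F by ring.
  by rewrite e4 addNr.
by left; apply: good n2N1 _ => //; rewrite -subr_eq0 addrK oner_neq0.
Qed.

End TwoByTwo.

Section Overgroup.

Variable F : finFieldType.
Hypothesis q5 : (5 <= #|F|)%N.

(** If an entry is zero, the matrix is triangular up to an exchange of rows or columns. If none is,
    either it is generic or ad/(bc) = -1. *)
Lemma full_mx2_nonmonomial (P : pred 'M[F]_2) A :
  mxgroup P -> (forall A, A \in unitmx -> monomial A -> P A) ->
  P A -> ~~ monomial A -> has_transvection P \/ P (mx2 1 1 1 (- 1)).
Proof.
move=> gP fP; have [uP MP VP] := gP; rewrite (mx2E A).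
set a := A 0 0; set b := A 0 _; set c := A _ 0; set d := A _ _ => PA mA.
have swap := full_mx2_swap fP.
have := mx2_unit (uP _ PA).
have [a0|nza] := eqVneq a 0.
  rewrite a0 mul0r eq_sym mulf_eq0 negb_or => /andP[nzb nzc]; left.
  have [d0|nzd] := eqVneq d 0.
    case/negP: mA; rewrite a0 d0; apply/monomialP=> i; exists (1 - i).
    by move=> j; rewrite mxE; case: i j => [[|[|[]]] // ?] [[|[|[]]] // ?].
  apply: (full_mx2_upper gP fP nzc nzd nzb).
  have := MP _ _ swap PA.
  by rewrite mx2M !(mul0r, mul1r, addr0, add0r) a0.
have [d0|nzd] := eqVneq d 0.
  rewrite d0 mulr0 eq_sym mulf_eq0 negb_or => /andP[nzb nzc]; left.
  by apply: (full_mx2_zero gP fP nza nzb nzc); rewrite -d0.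
have [b0|nzb] := eqVneq b 0.
  move=> _; left; have [c0|nzc] := eqVneq c 0.
    case/negP: mA; rewrite b0 c0; apply/monomialP=> i; exists i.
    by move=> j; rewrite mxE; case: i j => [[|[|[]]] // ?] [[|[|[]]] // ?].
  apply: (full_mx2_zero gP fP nzc nzd nza).
  have := MP _ _ swap PA.
  by rewrite mx2M !(mul0r, mul1r, addr0, add0r) b0.
have [c0|nzc _] := eqVneq c 0.
  by move=> _; left; apply: (full_mx2_upper gP fP nza nzb nzd); rewrite -c0.
have [s0|nzs] := eqVneq (a * d + b * c) 0; last first.
  by left; apply: (full_mx2_generic gP fP _ _ _ _ nzs).
right; have := full_mx2_scale gP fP nza nzb nzc PA.
suff -> : a * d / (b * c) = -1 by [].
move/eqP: s0; rewrite addr_eq0 => /eqP->.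
by rewrite mulNr divff ?mulf_neq0.
Qed.

(* Over the field with 5 elements the monomial subgroup of GL_2 is not maximal
   (it lies in an extension of the center by S_4), hence the explicit product of
   3 x 3 matrices. *)
Lemma full_mx3_mod5 (P : pred 'M[F]_(1 + 2)) : (5%:R = 0 :> F) ->
  mxgroup P -> (forall A, A \in unitmx -> monomial A -> P A) ->
  corner P (mx2 1 1 1 (- 1)) -> has_transvection P.
Proof.
move=> F5 gP fP; rewrite /corner block_mx2 => Ph; have [uP MP VP] := gP.
have n2 : (2%:R : F) != 0.
  apply: contra (oner_neq0 F) => /eqP e2.
  have e1 : 5%:R - 2%:R * 2%:R = 1 :> F by ring.
  by rewrite -e1 F5 e2 mulr0 subrr.
have Pm (s : 'S_3) (d : 'rV_3) : (forall i, d 0 i != 0) ->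
    P (diag_mx d *m perm_mx s).
  by move=> nzd; apply: MP; [apply: full_diag fP _ nzd | apply: full_perm].
have Pm1 : P (mx3 0 0 1 0 1 0 1 0 0).
  have := full_perm fP (tperm 0 ord_max); congr (is_true (P _)).
  apply/matrixP=> i j; rewrite !mxE permE /=.
  by case: i j => [[|[|[|[]]]] // ?] [[|[|[|[]]]] // ?].
have Pm3 : P (mx3 0 0 2%:R 0 1 0 1 0 0).
  have := Pm (tperm 0 ord_max) (\row_i nth 0 [:: 2%:R; 1; 1] i).
  have -> : diag_mx (\row_i nth 0 [:: 2%:R; 1; 1] i) *m perm_mx (tperm 0 ord_max)
     = mx3 0 0 2%:R 0 1 0 1 0 0 :> 'M[F]_3.
    apply/matrixP=> i j; rewrite mul_diag_mx !mxE permE /=.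
    by case: i j => [[|[|[|[]]]] // ?] [[|[|[|[]]]] // ?]; rewrite /= ?mulr0 ?mulr1.
  apply=> i; rewrite mxE; case: i => [[|[|[|[]]]] // ?] /=; exact: oner_neq0.
have Ps : P (mx3 0 1 0 1 0 0 0 0 1).
  have := full_perm fP (tperm 0 (inord 1)); congr (is_true (P _)).
  apply/matrixP=> i j; rewrite !mxE permE /= -!val_eqE /= inordK //.
  by case: i j => [[|[|[|[]]]] // ?] [[|[|[|[]]]] // ?] /=; rewrite ?inordK.
have P1 : P (mx3 0 1 0 1 0 1 1 0 (- 1)).
  by have := MP _ _ Ph Ps; rewrite mx3M;
   congr (is_true (P (mx3 _ _ _ _ _ _ _ _ _))); ring.
have P2 : P (mx3 2%:R 0 (- 2%:R) 1 0 1 0 1 0).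
  by have := MP _ _ Pm3 P1; rewrite mx3M;
   congr (is_true (P (mx3 _ _ _ _ _ _ _ _ _))); ring.
have P3 : P (mx3 2%:R 0 (- 2%:R) 1 1 1 1 (- 1) 1).
  by have := MP _ _ Ph P2; rewrite mx3M;
   congr (is_true (P (mx3 _ _ _ _ _ _ _ _ _))); ring.
have P4 : P (mx3 1 (- 1) 1 1 1 1 2%:R 0 (- 2%:R)).
  by have := MP _ _ Pm1 P3; rewrite mx3M;
   congr (is_true (P (mx3 _ _ _ _ _ _ _ _ _))); ring.
have P5 : P (mx3 1 (- 1) 1 3%:R 1 (- 1) (- 1) 1 3%:R).
  by have := MP _ _ Ph P4; rewrite mx3M;
   congr (is_true (P (mx3 _ _ _ _ _ _ _ _ _))); ring.
have P6 : P (mx3 (- 1) 1 3%:R 3%:R 1 (- 1) 1 (- 1) 1).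
  by have := MP _ _ Pm1 P5; rewrite mx3M;
   congr (is_true (P (mx3 _ _ _ _ _ _ _ _ _))); ring.
have P7 : P (mx3 (- 1) 1 3%:R 4%:R 0 0 2%:R 2%:R (- 2%:R)).
  by have := MP _ _ Ph P6; rewrite mx3M;
   congr (is_true (P (mx3 _ _ _ _ _ _ _ _ _))); ring.
have P8 : P (mx3 4%:R 0 0 (- 1) 1 3%:R 2%:R 2%:R (- 2%:R)).
  by have := MP _ _ Ps P7; rewrite mx3M;
   congr (is_true (P (mx3 _ _ _ _ _ _ _ _ _))); ring.
(* Row 0 of this product has weight 1, while column 0 is not zero below it. *)
set A := mx3 _ _ _ _ _ _ _ _ _ in P8.
have A0 k : k != 0 -> A 0 k = 0.
  by rewrite mxE; case: k => [[|[|[|[]]]] // ?].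
have [a [c [h eA]]] := @block_of_row0 _ 2 A A0.
have eA' := congr1 (fun B : 'M_(1 + 2) => B (rshift 1 0) (lshift 2 0)) eA.
rewrite block_mxEdl mxE /= in eA'.
move: (P8); rewrite -/A eA => /(full_lower q5 gP fP); apply.
by apply/cV0Pn; exists 0; rewrite -eA' oppr_eq0 oner_neq0.
Qed.

(** Induction on the dimension by [full_step]. The base is dimension 3, as the Hadamard matrix in a
    corner of dimension 2 may need the third coordinate. *)
Theorem full_overgroup n (P : pred 'M[F]_n) :
  (3 <= n)%N -> mxgroup P -> (forall A, A \in unitmx -> monomial A -> P A) ->
  (exists2 A, P A & ~~ monomial A) -> has_transvection P.
Proof.
case: n P => [|[|[|n]]] // P _; elim: n P => [|n IHn] P gP fP nP.
  have [//|[h Ph mh]] := @full_step F q5 2 P gP fP isT nP.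
  have gC := @mxgroup_corner F 2 P gP.
  have fC := @full_corner F 2 P fP.
  have [|Phad] := full_mx2_nonmonomial gC fC Ph mh.
    exact: (@corner_transvection F 2).
  have [|[F5|]] := full_mx2_hadamard q5 gC fC; last by case.
    exact: (@corner_transvection F 2).
  exact: full_mx3_mod5 F5 gP fP Phad.
have [//|[h Ph mh]] := @full_step F q5 n.+3 P gP fP isT nP.
apply: (@corner_transvection F n.+3); apply: IHn.
- exact: mxgroup_corner gP.
- exact: full_corner fP.
by exists h.
Qed.

End Overgroup.

(** * Overgroups of the monomial subgroup of SL_n *)

Section Avoid.

Variable n : nat.

Lemma avoid_ord (s : seq 'I_n) : (size s < n)%N -> exists l, l \notin s.
Proof.
move=> lt_s; apply/existsP; rewrite -negb_forall; apply/negP=> /forallP sall.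
suff: (n <= size s)%N by rewrite leqNgt lt_s.
rewrite -[X in (X <= _)%N]card_ord; apply: leq_trans (card_size s).
by apply: subset_leq_card; apply/subsetP=> x _.
Qed.

(** A second transposition, of two spare points, corrects the sign; the permutation matrix then has
    determinant 1. *)
Lemma even_perm_move (z p : 'I_n) (s : seq 'I_n) :
  (size s + 3 < n)%N -> z \notin s -> p \notin s ->
  exists t : 'S_n, [/\ ~~ odd_perm t, t z = p & {in s, forall x, t x = x}].
Proof.
move=> lt_s nzs nps; have [<-|nzp] := eqVneq z p.
  by exists 1%g; split=> [|| x _]; rewrite ?odd_perm1 ?perm1.
have [|a] := @avoid_ord (z :: p :: s).
  by apply: leq_trans lt_s; rewrite /= addn3 !ltnS leqnSn.
rewrite !inE !negb_or => /and3P[naz nap nas].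
have [|b] := @avoid_ord (a :: z :: p :: s).
  by apply: leq_trans lt_s; rewrite /= addn3.
rewrite !inE !negb_or => /and4P[nba nbz nbp nbs].
exists (tperm z p * tperm a b)%g; split=> [||x xs].
- by rewrite odd_permM !odd_tperm nzp (eq_sym a b) nba.
- by rewrite permM tpermL tpermD.
have ne y : y \notin s -> y != x by apply: contraNneq => ->.
by rewrite permM !tpermD ?ne.
Qed.

End Avoid.

Section SpecialMonomial.

Variable F : finFieldType.
Hypothesis q5 : (5 <= #|F|)%N.

(** Distinct rows of an invertible matrix are independent, so at most b of them lie in the span of
    the b rows of V. *)
Lemma leq_rowsub n a b (g : 'M[F]_n) (f : 'I_a -> 'I_n) (C : 'M_(a, b)) V :
  g \in unitmx -> injective f -> rowsub f g = C *m V -> (a <= b)%N.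
Proof.
move=> ug injf eC.
have e1 : 1%:M = C *m (V *m invmx g *m (rowsub f 1%:M)^T).
  rewrite mulmxA mulmxA -eC mul_rowsub_mx mulmxV //.
  apply/matrixP=> i j; rewrite !mxE (bigD1 (f j)) //= big1 ?addr0.
    by rewrite !mxE eqxx mulr1 (inj_eq injf).
  by move=> k nk; rewrite !mxE (eq_sym (f j)) (negPf nk) mulr0.
rewrite -(mxrank1 F a) e1; apply: leq_trans (mxrankM_maxl _ _) _.
exact: rank_leq_col.
Qed.

Definition torus2 n (j k : 'I_n) (x : F) : 'M[F]_n :=
  diag_mx (\row_l if l == j then x else if l == k then x^-1 else 1).

Lemma det_torus2 n (j k : 'I_n) (x : F) : j != k -> x != 0 -> \det (torus2 j k x) = 1.
Proof.
move=> njk nzx; rewrite det_diag (bigD1 j) //= mxE eqxx (bigD1 k) 1?eq_sym //=.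
rewrite mxE eq_sym (negPf njk) eqxx big1 ?mulr1 ?divff // => l /andP[nlj nlk].
by rewrite mxE (negPf nlj) (negPf nlk).
Qed.

Lemma conj_torus2E n (A B : 'M[F]_n) j k x i l : j != k -> A *m B = 1%:M ->
  (A *m torus2 j k x *m B) i l = (i == l)%:R + (x - 1) * (A i j * B j l)
     + (x^-1 - 1) * (A i k * B k l).
Proof.
move=> njk AB; have <- : (A *m B) i l = (i == l)%:R by rewrite AB mxE.
rewrite /torus2 conj_diagE [in RHS]mxE.
rewrite (bigD1 j) //= [in RHS](bigD1 j) //= mxE eqxx.
rewrite (bigD1 k) 1?eq_sym //= [in RHS](bigD1 k) 1?eq_sym //= mxE.
rewrite (eq_sym k j) (negPf njk) eqxx.
under eq_bigr => m /andP[/negPf nmj /negPf nmk] do rewrite mxE nmj nmk mul1r.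
by ring.
Qed.

(** Conjugation by the diagonal matrix makes the permutation fix the row vector [d] and preserves
    the determinant. *)
Definition scaled_perm n (d : 'rV[F]_n) (s : 'S_n) : 'M[F]_n :=
  diag_mx (\row_i (d 0 i)^-1) *m perm_mx s *m diag_mx d.

Lemma det_scaled_perm n (d : 'rV[F]_n) (s : 'S_n) : (forall i, d 0 i != 0) ->
  \det (scaled_perm d s) = (-1) ^+ s.
Proof.
move=> nzd; rewrite !det_mulmx !det_diag det_perm mulrAC -big_split /=.
by rewrite big1 ?mul1r // => i _; rewrite mxE mulVf.
Qed.

Lemma monomial_scaled_perm n (d : 'rV[F]_n) (s : 'S_n) :
  monomial (scaled_perm d s).
Proof.
apply: monomialM (monomial_diag _).
exact: monomialM (monomial_diag _) (monomial_perm _ _).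
Qed.

Lemma mul_scaled_permE n m (A : 'M[F]_(m, n)) d s i l :
  (A *m scaled_perm d s) i (s l) = A i l / d 0 l * d 0 (s l).
Proof.
rewrite !mulmxA mul_mx_diag mxE -[s in perm_mx s]invgK -col_permE mxE permK.
by rewrite mul_mx_diag !mxE.
Qed.

Section Group.

Variables (n : nat) (P : pred 'M[F]_n).
Hypothesis n13 : (13 <= n)%N.
Hypothesis gP : mxgroup P.
Hypothesis fP : forall A, \det A = 1 -> monomial A -> P A.

Let uP A : P A -> A \in unitmx. Proof. by case: gP => H _ _; apply: H. Qed.
Let MP A B : P A -> P B -> P (A *m B). Proof. by case: gP => _ H _; apply: H. Qed.
Let VP A : P A -> P (invmx A). Proof. by case: gP => _ _ H; apply: H. Qed.

Let P_torus2 (j k : 'I_n) (x : F) : j != k -> x != 0 -> P (torus2 j k x).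
Proof. by move=> njk nzx; rewrite fP ?det_torus2 ?monomial_diag. Qed.

Let P_even (d : 'rV_n) s : (forall i, d 0 i != 0) -> ~~ odd_perm s -> P (scaled_perm d s).
Proof.
move=> nzd es; rewrite fP ?monomial_scaled_perm ?det_scaled_perm //.
by rewrite (negPf es).
Qed.

(** * Subgroups in which a row of weight one implies monomial *)

Section NoWeight1.

Hypothesis W : forall h i j, P h -> (forall k, k != j -> h i k = 0) -> monomial h.

Let row2 g i : P g -> ~~ monomial g ->
  exists j k, [/\ j != k, g i j != 0 & g i k != 0].
Proof.
move=> Pg mg; have [[j gj]|//] := row_weight g i.
by case/negP: mg; apply: W gj.
Qed.

(** The conjugate by g of [torus2 j k x] has row r equal to e_r, hence is monomial, so the torus
    maps row i to a multiple of a row of g. If row i were also nonzero at m, four values of x would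
    give four distinct rows of g in a space of dimension 3. *)
Let supp2 g r j k i m : P g -> ~~ monomial g -> j != k ->
  g r j = 0 -> g r k = 0 -> g i j != 0 -> m != j -> m != k -> g i m = 0.
Proof.
move=> Pg mg njk gj gk nzj nmj nmk; apply/eqP/negP=> /negP nzm.
have ug := uP Pg.
have [x1 [n10 n11 _ _]] := avoid4 q5 0 1 0 0.
have [x2 [n20 n21 n22 _]] := avoid4 q5 0 1 x1 0.
have [x3 [n30 n31 n32 n33]] := avoid4 q5 0 1 x1 x2.
pose xs := [:: 1; x1; x2; x3].
have uxs : uniq xs.
  by rewrite /= !inE !negb_or !(eq_sym 1) n11 n21 n31 !(eq_sym x1) n22 n32
             (eq_sym x2) n33.
pose x (s : 'I_4) := nth 0 xs s.
have nzx s : x s != 0.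
  by case: s => [[|[|[|[|[]]]]]] //= ?; rewrite /x /= ?oner_neq0.
have H s : exists i'c : 'I_n * F, forall l,
    (g *m torus2 j k (x s)) i l = i'c.2 * g i'c.1 l.
  have [|i' [c Hc]] := @monomial_conj_rows F n g (torus2 j k (x s)) ug _ i.
    apply: (W (i := r) (j := r)).
      exact: mxgroup_conj gP Pg (P_torus2 njk (nzx s)).
    move=> l nlr; rewrite conj_torus2E ?mulmxV // gj gk !mul0r !mulr0 !addr0.
    by rewrite eq_sym (negPf nlr).
  by exists (i', c).
have {H} [f Hf] := fin_all_exists H.
have E s l : g i l * (if l == j then x s else if l == k then (x s)^-1 else 1)
    = (f s).2 * g (f s).1 l.
  by rewrite -Hf mul_mx_diag !mxE.
have Em s : g i m = (f s).2 * g (f s).1 m.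
  by rewrite -E (negPf nmj) (negPf nmk) mulr1.
have Ej s : g i j * x s = (f s).2 * g (f s).1 j by rewrite -E eqxx.
have injf : injective (fun s => (f s).1).
  move=> s t /= est.
  have est2 : (f s).2 = (f t).2.
    have nz : g (f s).1 m != 0.
      by apply: contraNneq nzm => z; rewrite (Em s) z mulr0.
    by apply: (mulIf nz); rewrite -Em est -Em.
  have : x s = x t.
    by apply: (mulfI nzj); rewrite !Ej est est2.
  by move/eqP; rewrite nth_uniq // => /eqP/val_inj.
have nzc s : (f s).2 != 0.
  by apply: contraNneq nzm => z; rewrite (Em s) z mul0r.
(* The rows of V are the parts of row i outside {j, k}, at j and at k. *)
pose C : 'M[F]_(4, 3) := \matrix_(s, t) ((f s).2^-1 * nth 0 [:: 1; x s; (x s)^-1] t).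
pose V : 'M[F]_(3, n) := \matrix_(t, l) (g i l *
   (nth false [:: (l != j) && (l != k); l == j; l == k] t)%:R).
suff : (4 <= 3)%N by [].
apply: (@leq_rowsub n 4 3 g (fun s => (f s).1) C V ug injf).
apply/matrixP=> s l; rewrite !mxE.
apply: (mulfI (nzc s)); rewrite -E !big_ord_recl big_ord0 !mxE /=.
have [->|nlj] := eqVneq l j.
  by rewrite (negPf njk) /=; field; rewrite nzc nzx.
by have [->|nlk] := eqVneq l k; rewrite /=; field; rewrite nzc nzx.
Qed.

(** By [supp2], zeros at j and k force a row supported on {j, k}, which vanishes at further columns
    l, m, o. The pairs (l, m) and (l, o) then force a row supported on l alone, against [row2]. *)
Lemma unique_zero g r j k : P g -> ~~ monomial g ->
  g r j = 0 -> g r k = 0 -> j = k.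
Proof.
move=> Pg mg gj gk; apply/eqP/negP=> /negP njk; have ug := uP Pg.
have [i nzi] := unitmx_col j ug.
have [|l] := @avoid_ord n [:: j; k]; first exact: leq_trans n13.
rewrite !inE !negb_or => /andP[nlj nlk].
have [|m] := @avoid_ord n [:: j; k; l]; first exact: leq_trans n13.
rewrite !inE !negb_or => /and3P[nmj nmk nml].
have [|o] := @avoid_ord n [:: j; k; l; m]; first exact: leq_trans n13.
rewrite !inE !negb_or => /and4P[noj nok nol nom].
have z := supp2 Pg mg njk gj gk nzi.
have [i2 nzi2] := unitmx_col l ug.
have [j1 [k1 [nj1k1 g1 g2]]] := row2 i2 Pg mg.
have nl1 : exists2 t, t != l & g i2 t != 0.
  by case: (eqVneq j1 l) => [e|]; [exists k1; rewrite // -e eq_sym | exists j1].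
case: nl1 => t ntl; case/eqP; have [etm|ntm] := eqVneq t m.
  apply: (supp2 Pg mg (_ : l != o) (z _ nlj nlk) (z _ noj nok)) => //.
    by rewrite eq_sym.
  by rewrite etm eq_sym.
apply: (supp2 Pg mg (_ : l != m) (z _ nlj nlk) (z _ nmj nmk)) => //.
by rewrite eq_sym.
Qed.

(** A scaled permutation that fixes row r of g has a conjugate with row r equal to e_r, which is
    monomial by [W]; so it sends rows of g to multiples of rows. *)
Let scaled_rows g r (d : 'rV_n) s : P g -> (forall l, d 0 l != 0) ->
  ~~ odd_perm s -> (forall l, g r l / d 0 l * d 0 (s l) = g r (s l)) ->
  forall i, exists i' c, forall l, g i l / d 0 l * d 0 (s l) = c * g i' (s l).
Proof.
move=> Pg nzd es Hr i; have ug := uP Pg.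
have [|i' [c Hc]] := @monomial_conj_rows F n g (scaled_perm d s) ug _ i.
  apply: (W (i := r) (j := r)); first exact: mxgroup_conj gP Pg (P_even nzd es).
  move=> l nlr; have : row r (g *m scaled_perm d s) = row r g.
    apply/rowP=> m; rewrite -[m](permKV s) !mxE -[RHS]Hr -mul_scaled_permE.
    by rewrite mxE.
  move=> er; have : row r (g *m scaled_perm d s *m invmx g) = row r 1%:M.
    by rewrite row_mul er -row_mul mulmxV.
  by move/rowP/(_ l); rewrite !mxE eq_sym (negPf nlr).
by exists i', c => l; rewrite -mul_scaled_permE Hc.
Qed.

(** If row f had no zero, even permutations scaled by row f would carry the zero of row r to every
    column. By [unique_zero] there would be as many rows with a zero as columns, and f would be
    among them. *)
Let full_row_zeros g r z f : P g -> ~~ monomial g -> g r z = 0 ->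
  exists p, g f p = 0.
Proof.
move=> Pg mg grz; case: (boolP [exists p, g f p == 0]) => [|nz].
  by case/existsP=> p /eqP; exists p.
pose d : 'rV[F]_n := row f g.
have nzd l : d 0 l != 0.
  by move: nz; rewrite negb_exists mxE => /forallP.
have H p : exists i', g i' p = 0.
  have [|//|//|s [es sz _]] := @even_perm_move n z p [::].
    exact: leq_trans n13.
  have [|i' [c Hc]] := @scaled_rows g f d s Pg nzd es _ r.
    by move=> l; rewrite !mxE divff ?mul1r //; have := nzd l; rewrite mxE.
  exists i'; have := Hc z; rewrite grz !mul0r sz => /esym/eqP.
  rewrite mulf_eq0 => /orP[/eqP c0|/eqP //]; have [l nzl] := unitmx_row r (uP Pg).
  case/eqP: nzl; apply/eqP; have /eqP := Hc l; rewrite c0 mul0r.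
  by rewrite !mulf_eq0 invr_eq0 !(negPf (nzd _)) !orbF.
have [h Hh] := fin_all_exists H.
have injh : injective h.
  by move=> p q e; apply: (unique_zero Pg mg (Hh p)); rewrite e.
have [h' h'K hK] := injF_bij injh.
by exists (h' f); rewrite -{1}(hK f).
Qed.

(** A zero at (r0, z) leads to one zero in each row and column, and each row other than r0 is
    proportional to one vector d outside column z and its own zero. Then g w g, for some monomial w,
    has a row with at least two nonzero and two zero entries, against [unique_zero]. *)
Let full_entries g i j : P g -> ~~ monomial g -> g i j != 0.
Proof.
move=> Pg mg; apply/eqP; move: i j => r0 z gr0z; have ug := uP Pg.
(* The zero of row r0 is replaced with 1 to make d invertible; the scaled permutations that fix z
   still fix row r0. *)
pose d : 'rV[F]_n := \row_l if l == z then 1 else g r0 l.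
have nzd l : d 0 l != 0.
  rewrite mxE; have [_|nlz] := eqVneq l z; first exact: oner_neq0.
  by apply: contraNneq nlz => /(unique_zero Pg mg gr0z)->.
have dz : d 0 z = 1 by rewrite mxE eqxx.
have rows s i : ~~ odd_perm s -> s z = z ->
    exists i' c, forall l, g i l / d 0 l * d 0 (s l) = c * g i' (s l).
  move=> es sz; apply: (@scaled_rows g r0 d s Pg nzd es) => l.
  have [->|nlz] := eqVneq l z; first by rewrite sz gr0z !mul0r.
  have nslz : s l != z by rewrite -sz (inj_eq perm_inj).
  rewrite [d 0 l]mxE (negPf nlz) divff ?mul1r ?mxE ?(negPf nslz) //.
  by have := nzd l; rewrite mxE (negPf nlz).
have rows_neq0 s i i' c : (forall l, g i l / d 0 l * d 0 (s l) = c * g i' (s l)) ->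
    c != 0.
  move=> Hc; apply/eqP=> c0; have [l /eqP[]] := unitmx_row i ug.
  apply/eqP; have /eqP := Hc l.
  by rewrite c0 mul0r !mulf_eq0 invr_eq0 !(negPf (nzd _)) !orbF.
have onto p : exists i, g i p = 0.
  have [->|npz] := eqVneq p z; first by exists r0.
  have [i nzi] := unitmx_col z ug.
  have [p0 gip0] := full_row_zeros i Pg mg gr0z.
  have np0z : p0 != z by apply: contraNneq nzi => <-; rewrite gip0.
  have [|||s [es sp sz]] := @even_perm_move n p0 p [:: z].
  - exact: leq_trans n13.
  - by rewrite inE.
  - by rewrite inE.
  have [i' [c Hc]] := rows s i es (sz z (mem_head _ _)).
  exists i'; have := Hc p0; rewrite gip0 !mul0r sp => /esym/eqP.
  by rewrite mulf_eq0 (negPf (rows_neq0 _ _ _ _ Hc)) => /eqP.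
have [h Hh] := fin_all_exists onto.
have injh : injective h.
  by move=> p q e; apply: (unique_zero Pg mg (Hh p)); rewrite e.
have [h' h'K hK] := injF_bij injh.
have hz : h z = r0.
  have := Hh (h' r0); rewrite hK => e.
  by rewrite -(unique_zero Pg mg e gr0z) hK.
have zeroE i p : (g i p == 0) = (p == h' i).
  apply/eqP/eqP=> [e|->]; last by rewrite -{1}(hK i).
  by apply: (unique_zero Pg mg e); rewrite -{1}(hK i).
(* An even permutation that fixes z and h' i and takes l to l' maps row i to a multiple of the row
   with the same zero, i.e., of itself; the entry at z shows that the multiple is 1. *)
have const i l l' : i != r0 -> l != z -> l' != z -> l != h' i -> l' != h' i ->
    g i l / d 0 l = g i l' / d 0 l'.
  move=> nir0 nlz nl'z nli nl'i.
  have [|||s [es sl sfix]] := @even_perm_move n l l' [:: z; h' i].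
  - exact: leq_trans n13.
  - by rewrite !inE negb_or nlz.
  - by rewrite !inE negb_or nl'z.
  have sz : s z = z by rewrite sfix // mem_head.
  have sp : s (h' i) = h' i by rewrite sfix // !inE eqxx orbT.
  have [i' [c Hc]] := rows s i es sz.
  have nzc := rows_neq0 _ _ _ _ Hc.
  have ei : i' = i.
    have /eqP := Hc (h' i); rewrite sp (eqP (_ : g i (h' i) == 0)) ?zeroE //.
    rewrite !mul0r eq_sym mulf_eq0 (negPf nzc) zeroE => /eqP e.
    by rewrite -(hK i') -e hK.
  have c1 : c = 1.
    have nz : g i z != 0.
      by rewrite zeroE; apply: contra nir0 => /eqP e; rewrite -hz e hK.
    apply: (mulIf nz); rewrite mul1r -{1}ei -{1}sz -Hc sz dz divr1 mulr1 //.
  have := Hc l; rewrite sl ei c1 mul1r => <-.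
  by rewrite mulfK.
have beta i : exists b, b != 0 /\
    (i != r0 -> forall l, l != z -> l != h' i -> g i l = b * d 0 l).
  have [|l] := @avoid_ord n [:: z; h' i]; first exact: leq_trans n13.
  rewrite !inE negb_or => /andP[nlz nli].
  exists (g i l / d 0 l); split; first by rewrite mulf_neq0 ?invr_eq0 ?zeroE.
  by move=> ni m nmz nmi; rewrite (const i l m) // divfK.
have {beta} [b Hb] := fin_all_exists beta.
have nzb i : b i != 0 by case: (Hb i).
have gE i l : i != r0 -> l != z -> l != h' i -> g i l = b i * d 0 l.
  by move=> ni nlz nlh; case: (Hb i) => _ H; apply: H.
have [|a] := @avoid_ord n [:: r0]; first exact: leq_trans n13.
rewrite inE => nar0.
have [|a'] := @avoid_ord n [:: r0; a]; first exact: leq_trans n13.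
rewrite !inE negb_or => /andP[na'r0 na'a].
have [|o] := @avoid_ord n [:: r0; a; a']; first exact: leq_trans n13.
rewrite !inE !negb_or => /and3P[nor0 noa noa'].
have [|o'] := @avoid_ord n [:: r0; a; a'; o]; first exact: leq_trans n13.
rewrite !inE !negb_or => /and4P[no'r0 no'a no'a' no'o].
(* In F, [m] counts the remaining indices. The s_i sum to 1 and equal 1 except at a and a', where
   the four avoided values keep them different from 0 and 1. *)
pose m : F := \sum_(i | (i != r0) && (i != a) && (i != a')) 1.
have [x [nx0 nx1 nx2 nx3]] := avoid4 q5 0 1 (1 - m) (- m).
pose s i : F := if i == a then x else if i == a' then 1 - m - x else 1.
have sa : s a = x by rewrite /s eqxx.
have sa' : s a' = 1 - m - x by rewrite /s (negPf na'a) eqxx.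
have s1 i : i != a -> i != a' -> s i = 1.
  by move=> nia nia'; rewrite /s (negPf nia) (negPf nia').
have nzs i : s i != 0.
  rewrite /s; case: ifP => _ //; case: ifP => _; last exact: oner_neq0.
  by rewrite subr_eq0 eq_sym.
have sum_s : \sum_(i | i != r0) s i = 1.
  rewrite (bigD1 a) //= (bigD1 a') /=; last by rewrite na'r0.
  rewrite sa sa' (eq_bigr (fun=> 1)) -/m; first by ring.
  by move=> i /andP[/andP[_ nia] nia']; rewrite s1.
pose v : 'rV[F]_n := \row_i if i == r0 then 0 else s i / b i.
(* Row r0 of g and v have a single zero each, at z and r0; the scaling factor there is free and
   corrects the determinant. *)
have Pv : exists2 w, P w & row r0 (g *m w) = v.
  pose t := tperm z r0; pose e0 i := v 0 i / g r0 (t i).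
  pose e : 'rV[F]_n := \row_i
    if i == r0 then ((-1) ^+ t * \prod_(k | k != r0) e0 k)^-1 else e0 i.
  have nzgt i : i != r0 -> g r0 (t i) != 0.
    move=> ni; rewrite zeroE -hz h'K; apply: contra ni => /eqP ei.
    by rewrite -[i](tpermK z r0) -/t ei tpermL.
  have nze0 i : i != r0 -> e0 i != 0.
    move=> ni; rewrite mulf_neq0 ?invr_eq0 ?nzgt // mxE (negPf ni).
    by rewrite mulf_neq0 ?invr_eq0.
  exists (perm_mx t *m diag_mx e).
    apply: fP; last exact: monomialM (monomial_perm _ _) (monomial_diag _).
    rewrite det_mulmx det_perm det_diag (bigD1 r0) //= [e 0 r0]mxE eqxx.
    rewrite [X in _ * (_ * X)](eq_bigr e0) => [|i /negPf ni]; last by rewrite mxE ni.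
    rewrite mulrCA mulVf // mulf_neq0 ?signr_eq0 //.
    by apply/prodf_neq0.
  apply/rowP=> i; rewrite mulmxA [LHS]mxE mul_mx_diag [LHS]mxE.
  have -> : perm_mx t = perm_mx t^-1%g :> 'M[F]_n by rewrite tpermV.
  rewrite -col_permE mxE [e 0 i]mxE.
  have [->|ni] := eqVneq i r0; last by rewrite /e0 mulrCA divff ?mulr1 ?mxE ?(negPf ni) ?nzgt.
  by rewrite tpermR gr0z mul0r mxE eqxx.
have [w Pw wv] := Pv; pose k := g *m w *m g.
have Pk : P k := MP (MP Pg Pw) Pg.
(* Row r0 of k is v g, and in column l the term of row h l is missing, since g is zero there. *)
have kE l : l != z -> k r0 l = d 0 l * (1 - s (h l)).
  move=> nlz; have -> : k r0 l = (v *m g) 0 l.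
    by rewrite -wv -row_mul [RHS]mxE.
  have nhl : h l != r0 by rewrite -hz (inj_eq injh).
  rewrite mxE (bigD1 r0) //= mxE eqxx mul0r add0r (bigD1 (h l)) //=.
  have -> : 1 - s (h l) = \sum_(i | (i != r0) && (i != h l)) s i.
    by rewrite -sum_s (bigD1 (h l)) //= addrAC subrr add0r.
  rewrite Hh mulr0 add0r mulr_sumr; apply: eq_bigr => i /andP[ni nih].
  rewrite mxE (negPf ni) gE //; first by rewrite mulrA divfK // mulrC.
  by apply: contra nih => /eqP->; rewrite hK.
have nh'z i : i != r0 -> h' i != z.
  by apply: contra => /eqP e; rewrite -hz -e hK.
have mk : ~~ monomial k.
  apply/nonmonomialP; exists r0, (h' a), (h' a').
  rewrite (inj_eq (can_inj hK)) eq_sym na'a !kE ?nh'z // !hK sa sa'.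
  split=> //; rewrite mulf_neq0 ?nzd // subr_eq0 eq_sym //.
  apply: contra nx3 => /eqP e; rewrite -subr_eq0 opprK.
  have -> : x + m = 1 - (1 - m - x) by ring.
  by rewrite e subrr.
have k0 i : i != r0 -> i != a -> i != a' -> k r0 (h' i) = 0.
  by move=> ni nia nia'; rewrite kE ?nh'z // hK s1 // subrr mulr0.
have := unique_zero Pk mk (k0 o nor0 noa noa') (k0 o' no'r0 no'a no'a').
by move/(can_inj hK)/eqP; rewrite eq_sym (negPf no'o).
Qed.

(** All entries of g and g^-1 are nonzero by [full_entries]. For a suitable x the conjugate h of
    [torus2 j k x] has a zero off the diagonal, so it is monomial; the position of its zeros then
    makes two of its rows proportional. *)
Lemma no_nonmonomial g : P g -> monomial g.
Proof.
move=> Pg; apply/negPn/negP=> mg; have ug := uP Pg.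
have mB : ~~ monomial (invmx g).
  by apply: contra mg => mB; rewrite -(invmxK g) monomialV ?unitmx_inv.
have [|j _] := @avoid_ord n [::]; first exact: leq_trans n13.
have [|k] := @avoid_ord n [:: j]; first exact: leq_trans n13.
rewrite inE eq_sym => njk; set B := invmx g.
have nzg := full_entries _ _ Pg mg; have nzB := full_entries _ _ (VP Pg) mB.
pose R l := B k l / B j l.
have nzR l : R l != 0 by rewrite mulf_neq0 ?invr_eq0.
(* Rows j and k of g^-1 are not proportional. *)
have nconst r : exists l, R l != r.
  apply/existsP; rewrite -negb_forall; apply/negP=> /forallP Rr.
  have e l : B k l = r * B j l by rewrite -(eqP (Rr l)) divfK.
  have := congr1 (fun C : 'M_n => C k k) (mulVmx ug).
  have := congr1 (fun C : 'M_n => C j k) (mulVmx ug).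
  rewrite !mxE eqxx (negPf njk) => e0.
  rewrite (eq_bigr (fun l => r * (B j l * g l k))) => [|l _].
    by rewrite -mulr_sumr e0 mulr0 => /eqP; rewrite eq_sym (negPf (oner_neq0 F)).
  by rewrite -/B e mulrA.
have [i [l [nil nRT]]] : exists i l, i != l /\ R l != g i j / g i k.
  have [|i _] := @avoid_ord n [::]; first exact: leq_trans n13.
  have [l nl] := nconst (g i j / g i k).
  have [eil|nil] := eqVneq i l; last by exists i, l.
  have [|m] := @avoid_ord n [:: i]; first exact: leq_trans n13.
  rewrite inE => nmi.
  have [em|nm] := eqVneq (R m) (g i j / g i k); last first.
    by exists i, m; rewrite eq_sym.
  have [|p] := @avoid_ord n [:: i; m]; first exact: leq_trans n13.
  rewrite !inE negb_or => /andP[npi npm].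
  have [ep|np] := eqVneq (R m) (g p j / g p k); last by exists p, m.
  by exists p, l; split; [rewrite -eil | rewrite -ep em].
(* This value makes the entry (i, l) of h vanish; it is not 1 by the choice of i and l. *)
pose x := R l * g i k / g i j.
have nzx : x != 0 by rewrite !mulf_neq0 ?invr_eq0.
have nx1 : x != 1.
  apply: contra nRT => /eqP x1.
  have -> : R l = x * (g i j / g i k) by rewrite /x; field; rewrite !nzg.
  by rewrite x1 mul1r.
pose h := g *m torus2 j k x *m B.
have Ph : P h by apply: mxgroup_conj gP Pg _; apply: P_torus2.
have hE a c : a != c -> (h a c == 0) = (R c == x * g a j / g a k).
  move=> nac; rewrite conj_torus2E ?mulmxV // (negPf nac) add0r.
  have -> : (x - 1) * (g a j * B j c) + (x^-1 - 1) * (g a k * B k c)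
     = (x - 1) / x * (g a k * B j c) * (x * g a j / g a k - R c).
    by rewrite /R; field; rewrite nzx nzg nzB.
  by rewrite !mulf_eq0 invr_eq0 subr_eq0 (negPf nx1) (negPf nzx) (negPf (nzg _ _))
       (negPf (nzB _ _)) subr_eq0 eq_sym.
have mh : monomial h.
  apply: contraT => mh; have := full_entries i l Ph mh.
  by rewrite hE // /x; case/eqP; field; rewrite !nzg.
have uh := uP Ph; have /monomialP Hm := mh.
pose T a := x * g a j / g a k.
(* Column p avoids the diagonal and the nonzero entries of rows a and c, so that T a = R p = T c. *)
have T1 a c : T a = T c.
  have [j1 H1] := Hm a; have [j2 H2] := Hm c.
  have [|p] := @avoid_ord n [:: a; c; j1; j2]; first exact: leq_trans n13.
  rewrite !inE !negb_or => /and4P[npa npc np1 np2].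
  have /eqP := H1 p np1; rewrite hE => [/eqP e1|]; last by rewrite eq_sym.
  have /eqP := H2 p np2; rewrite hE => [/eqP e2|]; last by rewrite eq_sym.
  by rewrite /T -e1 -e2.
(* Since T is constant and R is not, some column p has no zero off the diagonal; each row of h other
   than p is then supported at p. *)
have [p nRp] := nconst (T i).
have hp a : a != p -> forall c, c != p -> h a c = 0.
  move=> nap c ncp; have [q Hq] := Hm a; apply: (Hq).
  suff -> : q = p by [].
  apply/eqP; apply: contraT => nqp; have := Hq p; rewrite eq_sym => /(_ nqp)/eqP.
  by rewrite hE // -/(T a) (T1 a i) (negPf nRp).
have [|a] := @avoid_ord n [:: p]; first exact: leq_trans n13.
rewrite inE => nap.
have [|a'] := @avoid_ord n [:: p; a]; first exact: leq_trans n13.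
rewrite !inE negb_or => /andP[na'p na'a].
have [q /eqP[]] := unitmx_row p (uP (VP Ph)).
have z1 := weight1_inv (mulmxV uh) (hp a nap).
have z2 := weight1_inv (mulmxV uh) (hp a' na'p).
by have [->|nqa] := eqVneq q a; [apply: z2; rewrite eq_sym | apply: z1].
Qed.

End NoWeight1.

Lemma special_weight1 g : P g -> ~~ monomial g ->
  exists h i j, [/\ P h, ~~ monomial h & forall k, k != j -> h i k = 0].
Proof.
move=> Pg mg; case: (boolP [exists h : 'M[F]_n, exists i, exists j,
   [&& P h, ~~ monomial h & [forall k, (k != j) ==> (h i k == 0)]]]) => [|Nh].
  case/existsP=> h /existsP[i /existsP[j /and3P[Ph mh /forallP hk]]].
  by exists h, i, j; split=> // k /(implyP (hk k))/eqP.
case/negP: mg; apply: no_nonmonomial Pg => h i j Ph hk.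
apply: contraNT Nh => mh; apply/existsP; exists h.
apply/existsP; exists i; apply/existsP; exists j; rewrite Ph mh /=.
by apply/forallP=> k; apply/implyP=> /hk->.
Qed.

End Group.
End SpecialMonomial.

(** * Generation of SL_n by transvections *)

Section Generation.

Variable F : fieldType.

Lemma block_transvection n (i j : 'I_n) (c : F) :
  block_mx 1%:M 0 0 (1%:M + c *: delta_mx i j)
   = 1%:M + c *: delta_mx (rshift 1 i) (rshift 1 j) :> 'M_(1 + n).
Proof.
apply/matrixP=> k l; case: (split_ordP k) => k' ->; case: (split_ordP l) => l' ->.
- by rewrite block_mxEul !mxE !eq_lshift !eq_lrshift /= mulr0 addr0.
- by rewrite block_mxEur !mxE !eq_lrshift /= mulr0 addr0.
- by rewrite block_mxEdl !mxE eq_rlshift !eq_lrshift andbF mulr0 addr0.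
by rewrite block_mxEdr !mxE !eq_rshift.
Qed.

Lemma transvectionM n (A : 'M[F]_n) i j c k l :
  ((1%:M + c *: delta_mx i j) *m A) k l = A k l + c * (k == i)%:R * A j l.
Proof.
rewrite mulmxDl mul1mx -scalemxAl !mxE (bigD1 j) //= big1 => [|m nmj].
  by rewrite !mxE eqxx andbT addr0 mulrA.
by rewrite mxE (negPf nmj) andbF mul0r.
Qed.

Lemma transvectionK n (i j : 'I_n) (c : F) : i != j ->
  (1%:M + (- c) *: delta_mx i j) *m (1%:M + c *: delta_mx i j) = 1%:M :> 'M_n.
Proof.
move=> nij; rewrite mulmxDl mul1mx -scalemxAl mulmxDr mulmx1 -scalemxAr.
by rewrite mul_delta_mx_0 1?eq_sym // scaler0 addr0 -addrA -scalerDl subrr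
           scale0r addr0.
Qed.

Lemma det_transvection n (i j : 'I_n) (c : F) : i != j ->
  \det (1%:M + c *: delta_mx i j : 'M_n) = 1.
Proof.
(* [C] is the identity with row i replaced with row j, so its determinant vanishes. *)
move=> nij; pose C : 'M[F]_n := \matrix_k (delta_mx 0 (if k == i then j else k)).
rewrite (@determinant_multilinear _ _ _ 1%:M C i 1 c) ?det1.
- rewrite (@determinant_alternate _ _ C i j) // ?mulr0 ?addr0 ?mulr1 // => k.
  by rewrite !mxE !eqxx [j == i]eq_sym (negPf nij).
- by apply/rowP=> k; rewrite !mxE !eqxx mul1r.
- apply/matrixP=> k l; rewrite !mxE [lift _ _ == i]eq_sym (negPf (neq_lift _ _)).
  by rewrite mulr0 addr0.
apply/matrixP=> k l; rewrite !mxE [lift _ _ == i]eq_sym (negPf (neq_lift _ _)).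
by rewrite mulr0 addr0 eqxx eq_sym.
Qed.

Lemma lower_block_closed n (Q : 'M[F]_(1 + n) -> Prop) : Q 1%:M ->
  (forall A B, Q A -> Q B -> Q (A *m B)) ->
  (forall i j c, i != j -> Q (1%:M + c *: delta_mx i j)) ->
  forall c : 'cV_n, Q (block_mx 1%:M 0 c 1%:M).
Proof.
move=> Q1 QM Qt c; have -> : c = \sum_k c k 0 *: delta_mx k 0.
  by rewrite {1}[c]matrix_sum_delta; apply: eq_bigr => i _; rewrite big_ord1.
elim/big_rec: _ => [|k c' _ Qc']; first by rewrite -scalar_mx_block.
by rewrite -lower_blockM lower_block_delta; apply: QM Qc'; apply: Qt.
Qed.

(** Induction on n. Transvections turn the corner entry into 1; then the matrix is a product of a
    lower unipotent factor, the block of the Schur complement, and an upper unipotent factor. *)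
Lemma SL_generation n (Q : 'M[F]_n -> Prop) : Q 1%:M ->
  (forall A B, Q A -> Q B -> Q (A *m B)) ->
  (forall i j c, i != j -> Q (1%:M + c *: delta_mx i j)) ->
  forall A, \det A = 1 -> Q A.
Proof.
elim: n Q => [|n IHn] Q Q1 QM Qt A detA; first by rewrite (flatmx0 A) -(flatmx0 1%:M).
have reduce i j c : i != j -> Q ((1%:M + c *: delta_mx i j) *m A) -> Q A.
  move=> nij /(QM _ _ (Qt i j (- c) nij)).
  by rewrite mulmxA transvectionK // mul1mx.
have corner1 (B : 'M_(1 + n)) : \det B = 1 -> B 0 0 = 1 -> Q B.
  move=> detB B00; rewrite -[B]submxK.
  have -> : ulsubmx B = 1%:M.
    by rewrite [LHS]mx11_scalar !mxE !lshift0 B00.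
  set r := ursubmx B; set c := dlsubmx B; set D := drsubmx B.
  pose D' := D - c *m r.
  have eB : block_mx 1%:M r c D = block_mx 1%:M 0 c 1%:M *m
      block_mx 1%:M 0 0 D' *m block_mx 1%:M r 0 1%:M.
    rewrite !mulmx_block !(mulmx0, mul0mx, mulmx1, mul1mx, addr0, add0r).
    by rewrite addrC subrK.
  rewrite eB; apply: (QM); [apply: (QM)|].
  - exact: lower_block_closed.
  - apply: (IHn (fun X => Q (block_mx 1%:M 0 0 X : 'M_(1 + n)))).
    + by rewrite -scalar_mx_block.
    + move=> X Y QX QY; have := QM _ _ QX QY.
      rewrite (@mulmx_block _ 1 n 1 n 1 n).
      by rewrite !(mulmx0, mul0mx, mulmx1, addr0, add0r).
    + move=> i j d nij; rewrite block_transvection; apply: Qt.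
      by apply: contra nij => /eqP/(@rshift_inj 1 n)->.
    have : \det B = \det D'.
      rewrite -[B]submxK -/r -/c -/D (_ : ulsubmx B = 1%:M); last first.
        by rewrite [LHS]mx11_scalar !mxE !lshift0 B00.
      by rewrite eB !det_mulmx det_lblock det_lblock det_ublock !det1 !mul1r mulr1.
    by rewrite detB => <-.
  have -> : block_mx 1%:M r 0 1%:M = (block_mx 1%:M 0 r^T 1%:M)^T.
    by rewrite tr_block_mx trmxK !trmx1 trmx0.
  apply: (lower_block_closed (Q := fun X => Q X^T)).
  - by rewrite trmx1.
  - by move=> X Y QX QY; rewrite trmx_mul; apply: QM.
  move=> i j d nij; rewrite linearD linearZ /= trmx1 trmx_delta; apply: Qt.
  by rewrite eq_sym.
have detE (i j : 'I_(1 + n)) c : i != j ->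
    \det ((1%:M + c *: delta_mx i j) *m A) = 1.
  by move=> nij; rewrite det_mulmx det_transvection // detA mulr1.
have A00 (B : 'M[F]_(1 + n)) (i : 'I_(1 + n)) c : i != 0 ->
    ((1%:M + c *: delta_mx 0 i) *m B) 0 0 = B 0 0 + c * B i 0.
  by move=> ni; rewrite transvectionM eqxx mulr1.
have step (B : 'M[F]_(1 + n)) (i : 'I_(1 + n)) : i != 0 -> \det B = 1 -> B i 0 != 0 -> Q B.
  move=> ni detB nzB; have ni' : 0 != i by rewrite eq_sym.
  have := Qt 0 i (- ((1 - B 0 0) / B i 0)) ni'.
  move=> Q1'; pose T : 'M[F]_(1 + n) := 1%:M + ((1 - B 0 0) / B i 0) *: delta_mx 0 i.
  have QT : Q (T *m B).
    apply: corner1; first by rewrite det_mulmx det_transvection // detB mulr1.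
    by rewrite A00 // divfK // addrC subrK.
  by have := QM _ _ Q1' QT; rewrite mulmxA transvectionK // mul1mx.
have uA : A \in unitmx by rewrite unitmxE detA unitr1.
have [i nzi] := unitmx_col 0 uA.
have [ei|ni] := eqVneq i 0; last exact: step ni detA nzi.
rewrite {}ei in nzi;
  case: n => [|n] in IHn Q Q1 QM Qt A detA reduce corner1 detE A00 step uA i nzi *.
  apply: corner1 => //; have := detA.
  by rewrite {1}[A]mx11_scalar det_scalar1.
have n10 : 1 != 0 :> 'I_(1 + n.+1) by [].
have [A10|] := eqVneq (A 1 0) 0; last exact: step.
(* Row 0 is added to row 1, whose entry in column 0 becomes nonzero. *)
apply: (reduce 1 0 1 n10); apply: (step _ 1 n10 (detE _ _ _ n10)).
by rewrite transvectionM eqxx A10 add0r !mul1r.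
Qed.

End Generation.

(** * Transvections in overgroups within SL_n *)

Section SpecialOvergroup.

Variable F : finFieldType.
Hypothesis q5 : (5 <= #|F|)%N.
Variables (n : nat) (P : pred 'M[F]_(1 + n)).
Hypothesis n12 : (12 <= n)%N.
Hypothesis gP : mxgroup P.
Hypothesis dP : forall A, P A -> \det A = 1.
Hypothesis fP : forall A, \det A = 1 -> monomial A -> P A.

Let uP A : P A -> A \in unitmx. Proof. by case: gP => H _ _; apply: H. Qed.
Let MP A B : P A -> P B -> P (A *m B). Proof. by case: gP => _ H _; apply: H. Qed.
Let VP A : P A -> P (invmx A). Proof. by case: gP => _ _ H; apply: H. Qed.

Lemma unit_scalar : exists2 x : F, x != 0 & x != 1.
Proof. by have [x [nx0 nx1 _ _]] := avoid4 q5 0 1 0 0; exists x. Qed.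

Lemma special_diag (d : 'rV[F]_n) : \prod_i d 0 i = 1 ->
  P (block_mx 1%:M 0 0 (diag_mx d)).
Proof.
move=> d1; apply: fP; first by rewrite det_lblock det1 mul1r det_diag.
by apply: monomial_block; rewrite ?monomial1 ?monomial_diag.
Qed.

Lemma special_even (s : 'S_(1 + n)) : ~~ odd_perm s -> P (perm_mx s).
Proof.
by move=> es; apply: fP; rewrite ?monomial_perm // det_perm (negPf es).
Qed.

(** In the commutator with the block matrix of 1 and diag(d), the block X cancels because it
    commutes with diag(d), and c_i is multiplied by d_i - 1. *)
Lemma special_lower_diff (d : 'rV[F]_n) (X : 'M_n) (c : 'cV_n) :
  \prod_i d 0 i = 1 -> diag_mx d *m X = X *m diag_mx d ->
  P (block_mx 1%:M 0 c X) ->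
  P (block_mx 1%:M 0 (\col_i ((d 0 i - 1) * c i 0)) 1%:M).
Proof.
move=> d1 cX PX; have PD := special_diag d1.
have nzd i : d 0 i != 0.
  have /prodf_neq0 H : \prod_i d 0 i != 0 by rewrite d1 oner_neq0.
  exact: H.
have uX : X \in unitmx by have := uP PX; rewrite unitmx_lblock => /andP[].
have := MP (mxgroup_conj gP PD PX) (VP PX).
rewrite diag_blockV ?oner_neq0 //.
have -> : invmx (block_mx 1%:M 0 c X) = block_mx 1%:M 0 (- (invmx X *m c)) (invmx X).
  apply: invmx_uniq; rewrite mulmx_block !(mulmx0, mul0mx, mulmx1, mul1mx, addr0, add0r).
  by rewrite mulmxN mulKVmx // subrr mulmxV // -scalar_mx_block.
rewrite !mulmx_block !(mulmx0, mul0mx, mulmx1, mul1mx, addr0, add0r, invr1).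
have -> : diag_mx d *m X *m diag_mx (\row_i (d 0 i)^-1) = X.
  rewrite cX -mulmxA mulmx_diag -[RHS]mulmx1 -diag_const_mx; congr (_ *m diag_mx _).
  by apply/rowP=> i; rewrite !mxE divff.
rewrite mulmxN mulKVmx // mulmxV //; congr (is_true (P (block_mx _ _ _ _))).
by apply/colP=> i; rewrite mul_diag_mx !mxE mulrBl mul1r.
Qed.

Definition row2 (k l : 'I_n) (x : F) : 'rV[F]_n :=
  \row_m if m == k then x else if m == l then x^-1 else 1.

Lemma prod_row2 (k l : 'I_n) x : k != l -> x != 0 ->
  \prod_i row2 k l x 0 i = 1.
Proof. by move=> nkl nzx; rewrite -det_diag; apply: det_torus2. Qed.

(** A nontrivial diagonal matrix of determinant 1 changes two coordinates at least; successive
    commutators for the pairs (k, l) and (k, m) leave only the entry at k. *)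
Lemma special_lower1 (c : 'cV[F]_n) : P (block_mx 1%:M 0 c 1%:M) -> c != 0 ->
  has_transvection P.
Proof.
move=> Pc /cV0Pn[k nzk]; have [x nx0 nx1] := unit_scalar.
have [|l] := @avoid_ord n [:: k]; first exact: leq_trans n12.
rewrite inE => nlk.
have [|m] := @avoid_ord n [:: k; l]; first exact: leq_trans n12.
rewrite !inE negb_or => /andP[nmk nml].
have nkl : k != l by rewrite eq_sym.
have nkm : k != m by rewrite eq_sym.
have P1 := special_lower_diff (prod_row2 nkl nx0) (scalar_mxC _ _) Pc.
have P2 := special_lower_diff (prod_row2 nkm nx0) (scalar_mxC _ _) P1.
exists (rshift 1 k), (lshift n 0), ((x - 1) * ((x - 1) * c k 0)); split.
- by rewrite eq_rlshift.
- by rewrite !mulf_neq0 ?subr_eq0.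
rewrite -lower_block_delta; congr (is_true (P (block_mx _ _ _ _))): P2.
apply/colP=> i; rewrite !mxE andbT.
have [->|nik] := eqVneq i k; first by rewrite mulr1.
rewrite mulr0; have [->|nim] := eqVneq i m; last by rewrite subrr mul0r.
by rewrite (negPf nml) subrr mul0r mulr0.
Qed.

(** The stabilizer in P of the line <e_0>, acting on the quotient space. The corner [a] absorbs the
    determinant, so that all invertible monomial matrices occur and the result for GL_n applies. *)
Definition quotient_pred : pred 'M[F]_n :=
  fun X => [exists a, exists c, P (block_mx a%:M 0 c X)].

Lemma quotientP X : reflect (exists a c, P (block_mx a%:M 0 c X)) (quotient_pred X).
Proof.
apply: (iffP existsP) => [[a /existsP[c Pc]]|[a [c Pc]]]; exists a.
  by exists c.
by apply/existsP; exists c.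
Qed.

Lemma mxgroup_quotient : mxgroup quotient_pred.
Proof.
split=> [X /quotientP[a [c /uP]]|X Y /quotientP[a [c PX]] /quotientP[b [d PY]]|].
- by rewrite unitmx_lblock => /andP[].
- apply/quotientP; exists (a * b), (c *m b%:M + X *m d).
  have := MP PX PY; rewrite mulmx_block !(mulmx0, mul0mx, addr0, add0r).
  by rewrite scalar_mxM.
move=> X /quotientP[a [c PX]]; have := uP PX.
rewrite unitmx_lblock => /andP[nza uX]; apply/quotientP.
exists a^-1, (- (invmx X *m c *m (a^-1)%:M)).
suff <- : invmx (block_mx a%:M 0 c X)
    = block_mx (a^-1)%:M 0 (- (invmx X *m c *m (a^-1)%:M)) (invmx X) by apply: VP.
apply: invmx_uniq; rewrite mulmx_block !mulmx0 !mul0mx !addr0 !add0r.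
rewrite -scalar_mxM divff // mulmxN !mulmxA mulmxV // mul1mx subrr.
by rewrite -scalar_mx_block.
Qed.

Lemma special_block X : X \in unitmx -> monomial X ->
  P (block_mx ((\det X)^-1)%:M 0 0 X).
Proof.
move=> uX mX; apply: fP.
  by rewrite det_lblock det_scalar1 mulVf // -unitfE -unitmxE.
by apply: monomial_block => //; rewrite -diag_const_mx monomial_diag.
Qed.

Lemma full_quotient X : X \in unitmx -> monomial X -> quotient_pred X.
Proof.
by move=> uX mX; apply/quotientP; exists (\det X)^-1, 0; apply: special_block.
Qed.

Lemma special_transvection : (exists2 A, P A & ~~ monomial A) ->
  has_transvection P.
Proof.
case=> g Pg mg; have [|h [i [j [Ph mh hij]]]] := special_weight1 q5 _ gP fP Pg mg.
  exact: n12.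
have [|||s [es s0 _]] := @even_perm_move (1 + n) 0 i [::]; rewrite ?inE //.
  by rewrite ltnS; apply: leq_trans n12.
have [|||t [et tj _]] := @even_perm_move (1 + n) j 0 [::]; rewrite ?inE //.
  by rewrite ltnS; apply: leq_trans n12.
pose h1 := perm_mx s *m h *m perm_mx t.
have Ph1 : P h1 := MP (MP (special_even es) Ph) (special_even et).
have mh1 : ~~ monomial h1.
  apply: contra mh => mh1; have -> : h = perm_mx s^-1%g *m h1 *m perm_mx t^-1%g.
    by rewrite !mulmxA -perm_mxM mulVg perm_mx1 mul1mx -mulmxA -perm_mxM mulgV
               perm_mx1 mulmx1.
  by apply: monomialM (monomial_perm _ _); apply: monomialM mh1; apply: monomial_perm.
have [|a [c [h' eh1]]] := @block_of_row0 _ n h1.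
  move=> k nk0; rewrite /h1 -[t]invgK -col_permE mxE -row_permE mxE s0 hij //.
  by apply: contra nk0 => /eqP e; rewrite -tj -e permKV.
rewrite eh1 in Ph1 mh1; have := uP Ph1.
rewrite unitmx_lblock => /andP[nza uh'].
(* A monomial h' can be divided out. This leaves a lower unipotent matrix, with a nonzero column as
   h1 is not monomial. *)
have [mh'|mh'] := boolP (monomial h').
  have uV : invmx h' \in unitmx by rewrite unitmx_inv.
  have := MP Ph1 (special_block uV (monomialV uh' mh')); set b := _^-1 => PB.
  have nzb : b != 0 by rewrite invr_eq0 -unitfE -unitmxE.
  rewrite mulmx_block !(mulmx0, mul0mx, addr0, add0r) mulmxV // in PB.
  rewrite -scalar_mxM mul_mx_scalar in PB.
  have := dP PB; rewrite det_lblock det1 mulr1 det_scalar1 => ab1.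
  rewrite ab1 in PB; apply: special_lower1 PB _.
  rewrite scaler_eq0 (negPf nzb) /=; apply: contra mh1 => /eqP->.
  by apply: (@monomial_block _ 1 n) => //; rewrite -diag_const_mx monomial_diag.
have [i' [j' [x [nij nzx]]]] : has_transvection quotient_pred.
  apply: (full_overgroup q5 _ mxgroup_quotient full_quotient).
    exact: leq_trans n12.
  by exists h' => //; apply/quotientP; exists a, c.
case/quotientP=> b [d PT].
have b1 : b = 1.
  by have := dP PT; rewrite det_lblock det_transvection // mulr1 det_scalar1.
rewrite {}b1 in PT.
have [d0|/cV0Pn[k nzk]] := eqVneq d 0.
  rewrite d0 block_transvection in PT.
  by exists (rshift 1 i'), (rshift 1 j'), x; split; rewrite ?eq_rshift.
have [y ny0 ny1] := unit_scalar.
have [|l] := @avoid_ord n [:: i'; j'; k]; first exact: leq_trans n12.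
rewrite !inE !negb_or => /and3P[nli nlj nlk].
(* The diagonal matrix of e commutes with the transvection as e_i' = e_j', and the commutator with
   the lift keeps the entry at k as e_k <> 1. *)
have [e [e1 eij ek]] : exists e : 'rV[F]_n,
    [/\ \prod_m e 0 m = 1, e 0 i' = e 0 j' & e 0 k != 1].
  have [kij|] := boolP (k \in [:: i'; j']); last first.
    rewrite !inE negb_or => /andP[nki nkj]; exists (row2 k l y).
    split; last by rewrite mxE eqxx.
      by apply: prod_row2 => //; rewrite eq_sym.
    rewrite !mxE (eq_sym i' k) (eq_sym j' k) (eq_sym i' l) (eq_sym j' l).
    by rewrite (negPf nki) (negPf nkj) (negPf nli) (negPf nlj).
  exists (\row_m if m \in [:: i'; j'] then y else if m == l then (y ^+ 2)^-1 else 1).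
  split; [| by rewrite !mxE !inE !eqxx orbT | by rewrite mxE kij].
  rewrite (bigD1 i') //= (bigD1 j') 1?eq_sym //= (bigD1 l) /=; last by rewrite nli.
  rewrite big1 ?mulr1 => [|m /andP[/andP[/negPf nmi /negPf nmj] /negPf nml]].
    rewrite !mxE !inE !eqxx orbT (negPf nli) (negPf nlj).
    by rewrite mulrA -expr2 divff // expf_neq0.
  by rewrite mxE !inE nmi nmj nml.
apply: special_lower1 (special_lower_diff e1 _ PT) _.
  apply/matrixP=> p q; rewrite mul_mx_diag mul_diag_mx !mxE.
  have [<-|npq] := eqVneq p q; first by rewrite mulrC.
  rewrite add0r; case: eqP => [->|_] /=; last by rewrite !mulr0 mul0r.
  case: eqP => [->|_] /=; first by rewrite eij mulrC.
  by rewrite !mulr0 mul0r.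
by apply/cV0Pn; exists k; rewrite mxE mulf_neq0 ?subr_eq0.
Qed.

(** Torus elements rescale the transvection in P and even permutations move it to every position, so
    P contains all transvections. *)
Theorem special_overgroup : (exists2 A, P A & ~~ monomial A) ->
  forall A, \det A = 1 -> P A.
Proof.
move=> /special_transvection[i [j [c [nij nzc Pt]]]].
have scaled d : d != 0 -> P (1%:M + d *: delta_mx i j).
  move=> nzd; have nzx : d / c != 0 by rewrite mulf_neq0 ?invr_eq0.
  have [|l] := @avoid_ord (1 + n) [:: i; j]; first by rewrite ltnS; apply: leq_trans n12.
  rewrite !inE negb_or => /andP[nli nlj].
  have nil : i != l by rewrite eq_sym.
  have PD : P (torus2 i l (d / c)) by rewrite fP ?det_torus2 ?monomial_diag.
  have := mxgroup_conj gP PD Pt; congr (is_true (P _)).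
  rewrite mulmxDr mulmxDl mulmx1 mulmxV ?uP //; congr (_ + _).
  rewrite -scalemxAr -scalemxAl.
  suff -> : torus2 i l (d / c) *m delta_mx i j *m invmx (torus2 i l (d / c))
     = (d / c) *: delta_mx i j by rewrite scalerA mulrC divfK.
  apply: (canLR (mulmxK (uP PD))); apply/matrixP=> p q.
  rewrite mul_diag_mx -scalemxAl mul_mx_diag !mxE.
  have [_|npi] := eqVneq p i; last by rewrite /= !(mul0r, mulr0).
  have [->|nqj] := eqVneq q j; last by rewrite /= !(mul0r, mulr0).
  by rewrite (eq_sym j i) (negPf nij) (eq_sym j l) (negPf nlj) !mulr1.
have moved k l d : k != l -> d != 0 -> P (1%:M + d *: delta_mx k l).
  move=> nkl nzd.
  have [|||s [es sk _]] := @even_perm_move (1 + n) k i [::]; rewrite ?inE //.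
    by rewrite ltnS; apply: leq_trans n12.
  have nsli : s l != i by rewrite -sk (inj_eq perm_inj) eq_sym.
  have [|||t [et tl ti]] := @even_perm_move (1 + n) (s l) j [:: i].
  - by rewrite ltnS; apply: leq_trans n12.
  - by rewrite inE.
  - by rewrite inE eq_sym.
  have Ps : P (perm_mx (s * t)).
    by apply: special_even; rewrite odd_permM (negPf es) (negPf et).
  have := mxgroup_conj gP Ps (scaled d nzd); congr (is_true (P _)).
  rewrite mulmxDr mulmxDl mulmx1 mulmxV ?uP //; congr (_ + _).
  rewrite -scalemxAr -scalemxAl; congr (_ *: _).
  have -> : invmx (perm_mx (s * t)) = perm_mx (s * t)^-1%g :> 'M[F]_(1 + n).
    by apply: invmx_uniq; rewrite -perm_mxM mulgV perm_mx1.
  rewrite -row_permE -col_permE; apply/matrixP=> p q; rewrite !mxE.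
  have stk : (s * t)%g k = i by rewrite permM sk ti ?mem_head.
  have stl : (s * t)%g l = j by rewrite permM tl.
  by rewrite -{1}stk -{1}stl !(inj_eq perm_inj).
apply: SL_generation.
- by apply: fP; rewrite ?det1 ?monomial1.
- by move=> A B; apply: MP.
move=> k l d nkl; have [->|nzd] := eqVneq d 0; last exact: moved.
by rewrite scale0r addr0; apply: fP; rewrite ?det1 ?monomial1.
Qed.

End SpecialOvergroup.

(** * Bases and coset actions *)

Section EssentialPoints.

Local Open Scope nat_scope.
Import GroupScope.

Variables (gT : finGroupType) (T : finType).
Variables (G : {group gT}) (to : {action gT &-> T}).

Lemma is_base_sub (s t : seq T) :
  {subset s <= t} -> is_base G to s -> is_base G to t.
Proof.
rewrite /is_base => sub_st /eqP Gs1; rewrite -subG1 -Gs1 setIS // astabS //.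
by apply/subsetP=> x; rewrite !inE; apply: sub_st.
Qed.

Lemma leq_base_number (s J : seq T) : is_base G to s -> uniq J ->
  {in J, forall x, x \in s /\ ~~ is_base G to (filter (predC1 x) s)} ->
  size J <= base_number G to.
Proof.
move=> base_s uJ essJ.
pose p k := [exists t : k.-tuple T, subseq t s && is_base G to t].
have ex_p : exists k, p k.
  by exists (size s); apply/existsP; exists (in_tuple s); rewrite subseq_refl.
have [k /existsP[t /andP[sub_ts base_t]] min_k] := find_ex_minn ex_p.
have min_t : is_minimal_base G to t.
  rewrite /is_minimal_base base_t /=; apply/forallP=> -[l lt_l] /=.
  apply/forallP=> t'; apply/implyP=> sub_t't; apply/negP=> base_t'.
  have lt_lk : (l < k)%N by rewrite -(size_tuple t).
  suff : p l by move/min_k; rewrite leqNgt lt_lk.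
  by apply/existsP; exists t'; rewrite base_t' (subseq_trans sub_t't).
apply: leq_trans (base_number_max min_t); apply: uniq_leq_size uJ _ => x Jx.
apply: contraT => ntx; have [_ /negP[]] := essJ x Jx.
apply: is_base_sub base_t => y ty; rewrite mem_filter (mem_subseq sub_ts) //.
by rewrite andbT /=; apply: contraNneq ntx => <-.
Qed.

End EssentialPoints.

Section CosetAction.

Local Open Scope nat_scope.
Import GroupScope.

Variables (gT : finGroupType) (H : {group gT}).

Definition coset_type : finType := {A : {set gT} | A \in rcosets H [set: gT]}.

Lemma coset_pt_subproof g : H :* g \in rcosets H [set: gT].
Proof. by apply/rcosetsP; exists g; rewrite ?inE. Qed.

Definition coset_pt g : coset_type := exist _ (H :* g) (coset_pt_subproof g).

Lemma coset_ptP (x : coset_type) : exists g, x = coset_pt g.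
Proof.
by case: x => A /[dup] /rcosetsP[g _ eA] HA; exists g; apply: val_inj.
Qed.

Lemma coset_act_subproof (x : coset_type) g :
  val x :* g \in rcosets H [set: gT].
Proof.
by have [y ->] := coset_ptP x; rewrite /= -rcosetM coset_pt_subproof.
Qed.

Definition coset_act (x : coset_type) g : coset_type :=
  exist _ (val x :* g) (coset_act_subproof x g).

Lemma coset_act1 x : coset_act x 1 = x.
Proof. by apply: val_inj; rewrite /= mulg1. Qed.

Lemma coset_actM x : act_morph coset_act x.
Proof. by move=> g h; apply: val_inj; rewrite /= rcosetM. Qed.

Definition coset_action : {action gT &-> coset_type} :=
  TotalAction coset_act1 coset_actM.

Lemma coset_action_pt g h : coset_action (coset_pt g) h = coset_pt (g * h).
Proof. by apply: val_inj; rewrite /= rcosetM. Qed.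

Lemma coset_stab g : 'C[coset_pt g | coset_action] = H :^ g.
Proof.
apply/setP=> h; rewrite mem_conjg; apply/astab1P/idP => [/(congr1 val) /= e|].
  have : g * h \in H :* g by rewrite -e mem_rcoset mulgK rcoset_refl.
  by rewrite mem_rcoset conjgE invgK mulgA.
move=> Hh; rewrite coset_action_pt; apply: val_inj => /=; apply: rcoset_eqP.
by move: Hh; rewrite mem_rcoset conjgE invgK mulgA.
Qed.

Lemma coset_trans : [transitive [set: gT], on [set: coset_type] | coset_action].
Proof.
apply/imsetP; exists (coset_pt 1); rewrite ?inE //; apply/setP=> x.
rewrite inE; apply/esym/orbitP; have [g ->] := coset_ptP x.
by exists g; rewrite ?inE //= [LHS]coset_action_pt mul1g.
Qed.

Lemma coset_primitive : maximal H [set: gT] ->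
  [primitive [set: gT], on [set: coset_type] | coset_action].
Proof.
move=> maxH.
rewrite (trans_prim_astab (x := coset_pt 1)) ?inE ?coset_trans //.
by rewrite setTI coset_stab conjsg1 /maximal_eq maxH orbT.
Qed.

End CosetAction.

(** * The monomial subgroup of PSL_n and its maximality *)

Section MonomialSubgroup.

Import GroupScope.
Local Open Scope ring_scope.

Variables (n : nat) (F : finFieldType).
Local Notation GLT := {'GL_n.+1[F]}.
Local Notation SLg := (SL n.+1 F).
Implicit Types g h : GLT.

Lemma SL_det g : (g \in SLg) = (\det (GLval g) == 1).
Proof. by rewrite inE. Qed.

Lemma SL_lift (A : 'M[F]_n.+1) : \det A = 1 -> exists2 g, g \in SLg & GLval g = A.
Proof.
move=> dA; have uA : A \is a GRing.unit by rewrite [_ \is a _]unitmxE dA unitr1.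
exists (insubd (1%g : GLT) A); first by rewrite SL_det insubdK // dA.
by rewrite insubdK.
Qed.

Definition monomial_set : {set GLT} := [set g in SLg | monomial (GLval g)].

Lemma monomial_group_set : group_set monomial_set.
Proof.
apply/group_setP; split=> [|g h]; first by rewrite inE group1 monomial1.
rewrite ![_ \in [set _ in _ | _]]inE => /andP[Sg mg] /andP[Sh mh].
by rewrite (groupM Sg Sh); apply: monomialM.
Qed.

Definition monomial_group : {group GLT} := group monomial_group_set.

Lemma mem_monomial g : (g \in monomial_group) = (g \in SLg) && monomial (GLval g).
Proof. by rewrite [LHS]inE. Qed.

Lemma monomial_sub : monomial_group \subset SLg.
Proof. by apply/subsetP=> g; rewrite mem_monomial => /andP[]. Qed.

(** Commuting with all transvections means commuting with all [delta_mx i j] for i <> j, which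
    forces a scalar matrix. *)
Lemma center_SLP g : g \in SLg ->
  reflect (g \in 'Z(SLg)%g) (is_scalar_mx (GLval g)).
Proof.
move=> Sg; apply: (iffP idP) => [/is_scalar_mxP[a ea] | /centerP[_ cg]].
  apply/centerP; split=> // h Sh; apply: val_inj => /=.
  change (GLval g *m GLval h = GLval h *m GLval g).
  by rewrite ea scalar_mxC.
pose A := GLval g; have comm i j : i != j -> A *m delta_mx i j = delta_mx i j *m A.
  move=> nij; have [h Sh eh] := SL_lift (det_transvection 1 nij).
  have := congr1 (fun x => GLval x) (cg h Sh).
  change (A *m GLval h = GLval h *m A -> A *m delta_mx i j = delta_mx i j *m A).
  by rewrite eh scale1r mulmxDr mulmxDl mulmx1 mul1mx => /addrI.
have E k l i j : i != j -> A k i * (l == j)%:R = (k == i)%:R * A j l.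
  move=> /comm/matrixP/(_ k l); rewrite !mxE (bigD1 i) //= big1 => [|m nm].
    rewrite (bigD1 j) //= big1 => [|m nm]; last by rewrite mxE (negPf nm) andbF mul0r.
    by rewrite !mxE !eqxx andbT !addr0 /=.
  by rewrite mxE (negPf nm) mulr0.
apply/is_scalar_mxP; exists (A 0 0); apply/matrixP=> k l; rewrite mxE.
have [<-|nkl] := eqVneq k l.
  have [->|nk0] := eqVneq k 0; first by [].
  by have := E 0 k 0 k; rewrite eq_sym !eqxx mulr1 mul1r => <-.
have := E k k l k; rewrite eq_sym nkl eqxx mulr1 => -> //.
by rewrite (negPf nkl) mul0r.
Qed.

Lemma center_sub_monomial : 'Z(SLg)%g \subset monomial_group.
Proof.
apply/subsetP=> g Zg; have Sg := subsetP (center_sub _) _ Zg.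
rewrite mem_monomial Sg; have /(center_SLP Sg)/is_scalar_mxP[a ->] := Zg.
by rewrite -diag_const_mx monomial_diag.
Qed.

Lemma monomial_overgroup (M : {group GLT}) : (5 <= #|F|)%N -> (12 <= n)%N ->
  monomial_group \proper M -> M \subset SLg -> M :=: SLg.
Proof.
move=> q5 n12 /properP[sNM [g Mg nNg]] sMS.
pose P : pred 'M[F]_(1 + n) := fun A => [exists h in M, GLval h == A].
have PE h : h \in M -> P (GLval h).
  by move=> Mh; apply/existsP; exists h; rewrite Mh eqxx.
have Pex A : P A -> exists2 h, h \in M & GLval h = A.
  by case/existsP=> h /andP[Mh /eqP]; exists h.
have Pall A : \det A = 1 -> P A.
  apply: special_overgroup => //.
  - split=> [A1 /Pex[h _ <-]|A1 B1 /Pex[h Mh <-] /Pex[k Mk <-]|A1 /Pex[h Mh <-]].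
    + exact: (GL_unitmx h).
    + exact: PE (groupM Mh Mk).
    exact: PE (groupVr Mh).
  - by move=> A1 /Pex[h Mh <-]; apply/eqP; rewrite -SL_det (subsetP sMS).
  - move=> A1 dA mA; have [h Sh eh] := SL_lift dA.
    by rewrite -eh PE // (subsetP sNM) // mem_monomial Sh eh.
  exists (GLval g); first exact: PE.
  by apply: contra nNg => mg; rewrite mem_monomial (subsetP sMS).
apply/eqP; rewrite eqEsubset sMS; apply/subsetP=> h; rewrite SL_det => /eqP dh.
by have [k Mk ek] := Pex _ (Pall _ dh); rewrite -(val_inj ek : k = h).
Qed.

Definition PSL_monomial : {group PSL n.+1 F} :=
  (PSL_proj_morphism n.+1 F @* monomial_group)%G.

Lemma mem_PSL_monomial g : g \in SLg ->
  (PSL_proj g \in PSL_monomial) = monomial (GLval g).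
Proof.
move=> Sg; apply/idP/idP=> [Hg | mg].
  have : g \in PSL_proj_morphism n.+1 F @*^-1 PSL_monomial by apply/morphpreP.
  rewrite morphimGK ?monomial_sub //; last first.
    by rewrite ker_PSL_proj center_sub_monomial.
  by rewrite mem_monomial => /andP[].
by apply: mem_morphim => //; rewrite mem_monomial Sg.
Qed.

Lemma PSL_projP (u : PSL n.+1 F) : exists2 g, g \in SLg & u = PSL_proj g.
Proof.
have : u \in PSL_proj_morphism n.+1 F @* SLg by rewrite im_PSL_proj inE.
by case/morphimP=> g Sg _ ->; exists g.
Qed.

Lemma PSL_proj_eq1 g : g \in SLg -> (PSL_proj g == 1%g) = is_scalar_mx (GLval g).
Proof.
move=> Sg; rewrite (sameP eqP (kerP (PSL_proj_morphism n.+1 F) Sg)).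
by rewrite ker_PSL_proj; apply: sameP idP (center_SLP Sg).
Qed.

Lemma PSL_monomial_maximal : (5 <= #|F|)%N -> (12 <= n)%N ->
  maximal PSL_monomial [set: PSL n.+1 F].
Proof.
move=> q5 n12; apply/maxgroupP; split.
  rewrite properEneq subsetT andbT; apply/eqP=> e.
  have n0n : (0 : 'I_n.+1) != ord_max.
    by rewrite -val_eqE /= eq_sym -lt0n (leq_trans _ n12).
  have [g Sg eg] := SL_lift (det_transvection 1 n0n).
  have : PSL_proj g \in PSL_monomial by rewrite e inE.
  rewrite mem_PSL_monomial // eg; apply/negP/nonmonomialP.
  exists 0, 0, ord_max; rewrite n0n !mxE !eqxx (negPf n0n) andbF.
  by rewrite /= mulr0 addr0 add0r mulr1 oner_neq0.
move=> K ltK sHK; apply/eqP; rewrite eqEsubset sHK andbT.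
pose M := (PSL_proj_morphism n.+1 F @*^-1 K)%G.
have sMS : M \subset SLg by apply: subsetIl.
have sNM : monomial_group \subset M.
  by rewrite -sub_morphim_pre ?monomial_sub.
have KE : K :=: PSL_proj_morphism n.+1 F @* M.
  by rewrite morphpreK // im_PSL_proj subsetT.
have [eNM|ltNM] := eqVproper sNM; first by rewrite KE -eNM.
have eM := monomial_overgroup q5 n12 ltNM sMS.
by move: ltK; rewrite KE eM im_PSL_proj properxx.
Qed.

End MonomialSubgroup.

(** * Frames *)

(** The rows of [f] span the lines of a frame; an invertible [A], acting on row vectors, permutes
    these lines exactly if f A f^-1 is monomial. *)
Definition fixes_frame (F : fieldType) n (f A : 'M[F]_n) : bool :=
  monomial (f *m A *m invmx f).

Section Frames.

Import GroupScope.
Local Open Scope ring_scope.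

Variables (n : nat) (F : finFieldType).
Local Notation GLT := {'GL_n.+1[F]}.
Local Notation SLg := (SL n.+1 F).
Local Notation to := (coset_action (PSL_monomial n F)).

Lemma fixes_frame_scale (D f A : 'M[F]_n.+1) : D \in unitmx -> monomial D ->
  f \in unitmx -> fixes_frame (D *m f) A = fixes_frame f A.
Proof.
move=> uD mD uf; rewrite /fixes_frame.
have -> : invmx (D *m f) = invmx f *m invmx D.
  by apply: invmx_uniq; rewrite mulmxA mulmxK ?mulmxV.
rewrite !mulmxA; apply/idP/idP=> m.
  have := monomialM (monomialM (monomialV uD mD) m) mD.
  by rewrite -!mulmxA mulVmx // mulmx1 mulKmx.
apply: monomialM (monomialV uD mD); rewrite -!mulmxA.
by apply: monomialM mD _; rewrite mulmxA.
Qed.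

(** Rescaling a row of f makes the determinant 1 and does not change the frame, so every frame is a
    point of the coset space. *)
Lemma frame_lift (f : 'M[F]_n.+1) : f \in unitmx ->
  exists2 h : GLT, h \in SLg & forall A, fixes_frame (GLval h) A = fixes_frame f A.
Proof.
move=> uf; pose d : 'rV[F]_n.+1 := \row_k if k == 0 then (\det f)^-1 else 1.
have nzf : \det f != 0 by rewrite -unitfE -unitmxE.
have nzd i : d 0 i != 0.
  by rewrite mxE; case: ifP => _; rewrite ?invr_eq0 ?oner_neq0.
have dd : \det (diag_mx d *m f) = 1.
  rewrite det_mulmx det_diag (bigD1 0) //= mxE eqxx big1 ?mulr1 ?mulVf //.
  by move=> i ni; rewrite mxE (negPf ni).
have [h Sh eh] := SL_lift dd; exists h => // A.
by rewrite eh fixes_frame_scale ?det_diag_unit ?monomial_diag.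
Qed.

Lemma PSL_stab (g h : GLT) : g \in SLg -> h \in SLg ->
  (PSL_proj g \in 'C[coset_pt (PSL_monomial n F) (PSL_proj h) | to])
    = fixes_frame (GLval h) (GLval g).
Proof.
move=> Sg Sh; rewrite coset_stab mem_conjg.
have -> : (PSL_proj g ^ (PSL_proj h)^-1 = PSL_proj (g ^ h^-1))%g.
  pose f := PSL_proj_morphism n.+1 F.
  by rewrite -[PSL_proj (g ^ _)%g]/(f _) morphJ ?groupV // morphV.
rewrite mem_PSL_monomial ?groupJ ?groupV //.
by rewrite conjgE invgK mulgA.
Qed.

(** Nonscalar matrices of determinant 1 are nontrivial in PSL_n, so A shows that frame j cannot be
    spared. As A fixes all other frames but not this one, the points of J are also distinct. *)
Lemma leq_base_number_frames (I : finType) (f : I -> 'M[F]_n.+1) (J : {set I}) :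
  (forall i, f i \in unitmx) ->
  (forall A, \det A = 1 -> (forall i, fixes_frame (f i) A) -> is_scalar_mx A) ->
  (forall j, j \in J -> exists A, [/\ \det A = 1, ~~ is_scalar_mx A
      & forall i, i != j -> fixes_frame (f i) A]) ->
  (#|J| <= base_number [set: PSL n.+1 F] to)%N.
Proof.
move=> uf baseI essJ.
have H i : exists h : GLT, h \in SLg /\
    forall A, fixes_frame (GLval h) A = fixes_frame (f i) A.
  by have [h Sh fh] := frame_lift (uf i); exists h.
have {H} [h Hh] := fin_all_exists H.
have Sh i : h i \in SLg by case: (Hh i).
have fh i A : fixes_frame (GLval (h i)) A = fixes_frame (f i) A by case: (Hh i).
pose pt i := coset_pt (PSL_monomial n F) (PSL_proj (h i)).
have ptE g i : g \in SLg ->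
    (PSL_proj g \in 'C[pt i | to]) = fixes_frame (f i) (GLval g).
  by move=> Sg; rewrite PSL_stab.
have ess j : j \in J -> exists g, [/\ g \in SLg, PSL_proj g != 1%g,
    ~~ fixes_frame (f j) (GLval g)
    & forall i, i != j -> fixes_frame (f i) (GLval g)].
  move=> Jj; have [A [dA nsA fA]] := essJ j Jj; have [g Sg eg] := SL_lift dA.
  exists g; rewrite PSL_proj_eq1 // eg; split=> //.
  apply: contra nsA => fjA; apply: baseI => // i.
  by have [->|/fA] := eqVneq i j.
have injpt : {in J &, injective pt}.
  move=> i j Ji Jj e; apply/eqP; apply: contraT => nij.
  have [g [Sg _ nfg fg]] := ess i Ji; case/negP: nfg.
  by rewrite -(ptE g i Sg) e (ptE g j Sg) fg // eq_sym.
have -> : #|J| = size [seq pt j | j <- enum J] by rewrite size_map -cardE.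
apply: (leq_base_number (s := [seq pt i | i <- enum I])).
- rewrite /is_base -subG1; apply/subsetP=> u /setIP[_].
  have [g Sg ->] := PSL_projP u => /astabP Cu.
  rewrite !inE PSL_proj_eq1 // baseI //; first by apply/eqP; rewrite -SL_det.
  move=> i; rewrite -ptE //; apply/astab1P; apply: Cu.
  by rewrite inE map_f // mem_enum.
- by rewrite map_inj_in_uniq ?enum_uniq // => i j; rewrite !mem_enum; apply: injpt.
move=> x /mapP[j]; rewrite mem_enum => Jj ->; split.
  by rewrite map_f // mem_enum.
have [g [Sg ng1 _ fg]] := ess j Jj.
apply: contra ng1 => /eqP/setP/(_ (PSL_proj g)); rewrite [in RHS]inE => <-.
rewrite 2!inE; apply/astabP=> y; rewrite inE mem_filter => /andP[nyj].
case/mapP=> i _ ey.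
apply/astab1P; rewrite ey ptE // fg //.
by move: nyj; rewrite ey /=; apply: contraNneq => ->.
Qed.

End Frames.

Section FrameLemmas.

Variables (F : fieldType) (n : nat).
Implicit Types f A : 'M[F]_n.

Lemma fixes_frame_intertwine f A M : f \in unitmx -> f *m A = M *m f ->
  monomial M -> fixes_frame f A.
Proof. by move=> uf e mM; rewrite /fixes_frame e mulmxK. Qed.

Lemma fixes_frame1 A : fixes_frame 1%:M A = monomial A.
Proof. by rewrite /fixes_frame mul1mx invmx1 mulmx1. Qed.

Lemma fixes_diag f (d : 'rV[F]_n) : f \in unitmx ->
  (forall i j, f i j != 0 -> d 0 i = d 0 j) -> fixes_frame f (diag_mx d).
Proof.
move=> uf H; apply: (fixes_frame_intertwine (M := diag_mx d) uf).
  apply/matrixP=> i j; rewrite mul_mx_diag mul_diag_mx !mxE mulrC.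
  by have [->|/H->] := eqVneq (f i j) 0; rewrite ?mulr0.
exact: monomial_diag.
Qed.

Lemma transvection_unit (i j : 'I_n) : i != j ->
  1%:M + 1 *: delta_mx i j \in @unitmx F n.
Proof. by move=> nij; rewrite unitmxE det_transvection ?unitr1. Qed.

(** The conditions on column a and row b make A commute with [delta_mx a b]. *)
Lemma fixes_transvection A (a b : 'I_n) : a != b -> monomial A ->
  (forall i, A i a = (i == a)%:R) -> (forall j, A b j = (b == j)%:R) ->
  fixes_frame (1%:M + 1 *: delta_mx a b) A.
Proof.
move=> nab mA Aa Ab; apply: (fixes_frame_intertwine _ _ mA).
  exact: transvection_unit.
rewrite !scale1r mulmxDl mulmxDr mul1mx mulmx1; congr (_ + _).
apply/matrixP=> i j; rewrite !mxE (bigD1 b) //= big1 => [|k nk]; last first.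
  by rewrite mxE (negPf nk) andbF mul0r.
rewrite (bigD1 a) //= big1 => [|k nk]; last first.
  by rewrite mxE (negPf nk) mulr0.
by rewrite !mxE !eqxx Aa Ab andbT !addr0 (eq_sym b).
Qed.

Lemma monomial_repr A : A \in unitmx -> monomial A ->
  exists (p : 'I_n -> 'I_n) (c : 'I_n -> F),
    [/\ injective p, forall i, c i != 0
      & forall i j, A i j = if j == p i then c i else 0].
Proof.
move=> uA /monomialP mA.
have H i : exists pc : 'I_n * F, pc.2 != 0 /\
    forall j, A i j = if j == pc.1 then pc.2 else 0.
  have [j Hj] := mA i; have [k nzk] := unitmx_row i uA.
  exists (k, A i k); split=> //= l; have [->//|nlk] := eqVneq l k.
  have ekj : k = j by apply: contraNeq nzk => /Hj->.
  by rewrite Hj -?ekj.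
have {H} [f Hf] := fin_all_exists H.
exists (fun i => (f i).1), (fun i => (f i).2); split=> [i j e|i|i].
- apply/eqP; apply: contraT => nij.
  have zero a k : k != (f a).1 -> A a k = 0.
    by move=> nk; case: (Hf a) => _ ->; rewrite (negPf nk).
  (* If rows i and j of A had the same support, a row of the inverse would be supported both at i
     and at j, hence zero. *)
  have [|k /eqP[]] := @unitmx_row F n (invmx A) (f i).1; first by rewrite unitmx_inv.
  have [->|nki] := eqVneq k i; last exact: weight1_inv (mulmxV uA) (zero i) _ nki.
  by rewrite e; apply: weight1_inv (mulmxV uA) (zero j) _ nij.
- by case: (Hf i).
by case: (Hf i).
Qed.

Lemma scalar_repr A (p : 'I_n -> 'I_n) (c : 'I_n -> F) (a : F) :
  (forall i j, A i j = if j == p i then c i else 0) ->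
  (forall i, p i = i) -> (forall i, c i = a) -> is_scalar_mx A.
Proof.
move=> AE p1 c1; apply/is_scalar_mxP; exists a; apply/matrixP=> i j.
by rewrite AE p1 c1 mxE (eq_sym j); case: eqP => // _; rewrite mulr1n.
Qed.

Lemma not_scalar_diag (d : 'rV[F]_n) i j : d 0 i != d 0 j ->
  ~~ is_scalar_mx (diag_mx d).
Proof.
apply: contra => /is_scalar_mxP[a e].
have := congr1 (fun B : 'M_n => B i i) e; have := congr1 (fun B : 'M_n => B j j) e.
by rewrite !mxE !eqxx !mulr1n => -> ->.
Qed.

Lemma not_scalar_offdiag A i j : i != j -> A i j != 0 -> ~~ is_scalar_mx A.
Proof.
move=> nij; apply: contra => /is_scalar_mxP[a ->].
by rewrite mxE (negPf nij) mulr0n.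
Qed.

Section Repr.

Variables (A : 'M[F]_n) (p : 'I_n -> 'I_n) (c : 'I_n -> F).
Hypothesis injp : injective p.
Hypothesis nzc : forall i, c i != 0.
Hypothesis AE : forall i j, A i j = if j == p i then c i else 0.

Lemma repr_mulE f i k : (f *m A) i (p k) = f i k * c k.
Proof.
rewrite mxE (bigD1 k) //= AE eqxx big1 ?addr0 // => m nmk.
by rewrite AE (inj_eq injp) eq_sym (negPf nmk) mulr0.
Qed.

Lemma fixes_rows f : f \in unitmx -> fixes_frame f A ->
  forall i, exists i' x, forall k, f i k * c k = x * f i' (p k).
Proof.
move=> uf ff i; have [i' [x H]] := monomial_conj_rows uf ff i.
by exists i', x => k; rewrite -repr_mulE H.
Qed.

(** The image of e_a + e_b has two nonzero coordinates, so it lies on the only line of the frame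
    that is not a coordinate line, namely <e_a + e_b>. *)
Lemma fixes_link a b : a != b -> fixes_frame (1%:M + 1 *: delta_mx a b) A ->
  [/\ p a = a \/ p a = b, p b = a \/ p b = b & c a = c b].
Proof.
move=> nab ff; have uf := transvection_unit nab.
have [i' [x H]] := fixes_rows uf ff a.
have fE i k : (1%:M + 1 *: delta_mx a b : 'M[F]_n) i k
    = (i == k)%:R + ((i == a) && (k == b))%:R by rewrite scale1r !mxE.
have := H b; have := H a.
rewrite !fE !eqxx (negPf nab) /= addr0 add0r !mul1r => Ha Hb.
have ei : i' = a.
  apply/eqP; apply: contraT => ni; rewrite (negPf ni) !addr0 in Ha Hb.
  have ea : i' = p a.
    by apply/eqP; apply: contraT => n1; have := nzc a; rewrite Ha (negPf n1) mulr0 eqxx.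
  have eb : i' = p b.
    by apply/eqP; apply: contraT => n1; have := nzc b; rewrite Hb (negPf n1) mulr0 eqxx.
  by have := nab; rewrite -(inj_eq injp) -ea -eb eqxx.
rewrite ei eqxx /= in Ha Hb.
have val k y : y != 0 -> y = x * ((a == p k)%:R + (p k == b)%:R) ->
    (p k = a \/ p k = b) /\ y = x.
  move=> nzy ey; have [eb|nb] := eqVneq (p k) b.
    split; first by right.
    by rewrite ey eb (negPf nab) add0r eqxx mulr1.
  have [ea|na] := eqVneq a (p k).
    by split; [left | rewrite ey ea eqxx -ea (negPf nab) addr0 mulr1].
  by move: nzy; rewrite ey (negPf na) (negPf nb) addr0 mulr0 eqxx.
have [pa ca] := val a _ (nzc a) Ha; have [pb cb] := val b _ (nzc b) Hb.
by split; rewrite // ca cb.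
Qed.

End Repr.

End FrameLemmas.

Section Chain.

Variables (F : fieldType) (n : nat) (p : 'I_n.+1 -> 'I_n.+1) (c : 'I_n.+1 -> F).
Hypothesis injp : injective p.

(* The edges (i, i + 1), s <= i < t, of a path with at least two edges. *)
Lemma chain_fixed s t : (s.+1 < t <= n)%N ->
  (forall i, (s <= i < t)%N ->
    [/\ p (inord i) = inord i \/ p (inord i) = inord i.+1,
        p (inord i.+1) = inord i \/ p (inord i.+1) = inord i.+1
      & c (inord i) = c (inord i.+1)]) ->
  forall j : 'I_n.+1, (s <= j <= t)%N -> p j = j /\ c j = c (inord s).
Proof.
move=> /andP[lt_st le_tn] H.
have vi i : (i <= t)%N -> val (inord i : 'I_n.+1) = i.
  by move=> le_it; rewrite /= inordK // ltnS (leq_trans le_it).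
have inord_neq i : (i < t)%N -> inord i != inord i.+1 :> 'I_n.+1.
  by move=> lt_it; rewrite -val_eqE !vi ?(ltnW lt_it) // neq_ltn ltnSn.
(* An inner vertex is the common vertex of two edges, both of which p preserves; the ends then
   follow by injectivity. *)
have pmid i : (s < i < t)%N -> p (inord i) = inord i.
  case: i => // i /andP[lt_si lt_it].
  have [|_ H1 _] := H i; first by rewrite -ltnS lt_si ltnW.
  have [|H2 _ _] := H i.+1; first by rewrite (ltnW lt_si).
  case: H1 => // e1; case: H2 => // e2.
  have := congr1 val e1; rewrite e2 !vi // ?(ltnW lt_it) //; last exact/ltnW/ltnW.
  by move/eqP; rewrite -addn2 -[X in _ == X]addn0 eqn_add2l.
have pall i : (s <= i <= t)%N -> p (inord i) = inord i.
  case/andP=> le_si le_it; case: (ltngtP s i) le_si => // [lt_si|<-] _.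
    case: (ltngtP i t) le_it => // [lt_it|eit] _; first by apply: pmid; rewrite lt_si.
    case: i lt_si eit => // i lt_si eit.
    have lt_it : (i < t)%N by rewrite -eit.
    have [|_ [|//] e _] := H i; first by rewrite -ltnS lt_si.
    have lt_si' : (s < i)%N by rewrite -ltnS eit.
    have := pmid i; rewrite lt_si' lt_it => /(_ isT) e'.
    by have := inord_neq i lt_it; rewrite -(inj_eq injp) e e' eqxx.
  have lt_s1t : (s < t)%N by apply: ltnW.
  have [|[//|e] _ _] := H s; first by rewrite leqnn.
  have := pmid s.+1; rewrite ltnSn lt_st => /(_ isT) e'.
  by have := inord_neq s lt_s1t; rewrite -(inj_eq injp) e e' eqxx.
have call i : (s <= i <= t)%N -> c (inord i) = c (inord s).
  elim: i => [|i IHi] /andP[le_si le_it]; first by move: le_si; rewrite leqn0 => /eqP->.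
  case: (ltngtP s i.+1) le_si => // [lt_si|<-] // _.
  have [|_ _ <-] := H i; first by rewrite -ltnS lt_si.
  by rewrite IHi // -ltnS lt_si ltnW.
move=> j sjt; have ej : inord j = j by rewrite inord_val.
by rewrite -ej; split; [rewrite pall | rewrite call].
Qed.

End Chain.

(** * Minimal bases of frames *)

Section Links.

Variables (F : fieldType) (n : nat).

Definition link_mx i : 'M[F]_n.+1 := 1%:M + 1 *: delta_mx (inord i) (inord i.+1).

Lemma inord_neqS i : (i < n)%N -> inord i != inord i.+1 :> 'I_n.+1.
Proof.
move=> lt_in; rewrite -val_eqE /= !inordK ?neq_ltn ?ltnSn //.
by rewrite (leq_trans lt_in).
Qed.

Lemma link_unit i : (i < n)%N -> link_mx i \in unitmx.
Proof. by move=> lt_in; apply/transvection_unit/inord_neqS. Qed.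

Lemma fixes_link_diag i (d : 'rV[F]_n.+1) : (i < n)%N ->
  d 0 (inord i) = d 0 (inord i.+1) -> fixes_frame (link_mx i) (diag_mx d).
Proof.
move=> lt_in ed; apply: fixes_diag; first exact: link_unit.
move=> k l; rewrite /link_mx scale1r !mxE; have [->//|nkl] := eqVneq k l.
by rewrite add0r; case: andP => [[/eqP-> /eqP->]|_]; rewrite ?eqxx.
Qed.

Lemma links_chain (p : 'I_n.+1 -> 'I_n.+1) (c : 'I_n.+1 -> F) (A : 'M[F]_n.+1) s t :
  injective p -> (forall i, c i != 0) ->
  (forall i j, A i j = if j == p i then c i else 0) ->
  (s.+1 < t <= n)%N ->
  (forall i, (s <= i < t)%N -> fixes_frame (link_mx i) A) ->
  forall j : 'I_n.+1, (s <= j <= t)%N -> p j = j /\ c j = c (inord s).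
Proof.
move=> injp nzc AE st H; apply: chain_fixed => // i sit.
have lt_in : (i < n)%N.
  by case/andP: st => _; apply: leq_trans; case/andP: sit.
exact: fixes_link injp nzc AE _ _ (inord_neqS lt_in) (H i sit).
Qed.

End Links.

(** * The case of a scalar whose n-th power is not 1 *)

Section NonDivisible.

Variables (n : nat) (F : finFieldType).

Lemma prod_step (i : nat) (a b : F) : (i <= n)%N ->
  \prod_(m < n.+1) (if (m <= i)%N then a else b) = a ^+ i.+1 * b ^+ (n - i).
Proof.
move=> le_in; rewrite -(big_mkord xpredT (fun m => if (m <= i)%N then a else b)).
rewrite (big_cat_nat (n := i.+1)) //= !big_nat.
congr (_ * _).
  rewrite (eq_bigr (fun=> a)) -?big_nat ?prodr_const_nat ?subn0 // => m.
  by rewrite ltnS => /andP[_ ->].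
rewrite (eq_bigr (fun=> b)) -?big_nat ?prodr_const_nat ?subSS // => m.
by case/andP=> lt_im _; rewrite leqNgt lt_im.
Qed.

Lemma base_number_nondiv (w : F) : (2 <= n)%N -> w != 0 -> w ^+ n.+1 != 1 ->
  (n <= base_number [set: PSL n.+1 F] (coset_action (PSL_monomial n F)))%N.
Proof.
move=> n2 nzw nw1.
pose f (i : option 'I_n) := if i is Some i then link_mx F n i else 1%:M.
have cJ : #|[set~ (None : option 'I_n)]| = n by rewrite cardsC1 card_option card_ord.
rewrite -[X in (X <= _)%N]cJ; apply: (@leq_base_number_frames n F _ f).
- by case=> [i|]; rewrite ?unitmx1 ?link_unit.
- move=> A dA fA; have uA : A \in unitmx by rewrite unitmxE dA unitr1.
  have mA : monomial A by rewrite -fixes_frame1 (fA None).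
  have [p [c [injp nzc AE]]] := monomial_repr uA mA.
  have H : forall j : 'I_n.+1, p j = j /\ c j = c (inord 0).
    move=> j; apply: (links_chain (s := 0) (t := n) injp nzc AE).
    + by rewrite n2 leqnn.
    + by move=> i /andP[_ lt_in]; apply: (fA (Some (Ordinal lt_in))).
    by rewrite /= -ltnS.
  by apply: (scalar_repr (c := c) (a := c (inord 0)) AE) => i; case: (H i).
case=> [i _|]; last by rewrite !inE.
(* The determinant is 1 as a occurs i + 1 times and b occurs n - i times; a = b would mean w^(n+1) =
   1. *)
pose a := w ^- (n - i); pose b := w ^+ i.+1.
pose d : 'rV[F]_n.+1 := \row_m if (m <= i)%N then a else b.
have le_in : (i <= n)%N by rewrite ltnW.
exists (diag_mx d); split.
- rewrite det_diag (eq_bigr (fun m : 'I_n.+1 => if (m <= i)%N then a else b)).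
    rewrite prod_step // exprVn -!exprM mulnC mulVf // expf_neq0 //.
  by move=> m _; rewrite mxE.
- apply: (not_scalar_diag (i := ord0) (j := ord_max)); rewrite !mxE /=.
  rewrite leqNgt ltn_ord /=; apply: contra nw1 => /eqP e.
  have -> : n.+1 = (i.+1 + (n - i))%N by rewrite addSn subnKC.
  by rewrite exprD -/b -e mulVf // expf_neq0.
case=> [j nji|_]; last by rewrite fixes_frame1 monomial_diag.
have lt_j : (j < n.+1)%N by rewrite ltnS ltnW.
have lt_j1 : (j.+1 < n.+1)%N by rewrite ltnS.
apply: fixes_link_diag => //; rewrite !mxE !inordK //.
rewrite leq_eqVlt; have -> : (j == i :> nat) = false.
  apply: contraNF nji => /eqP e; apply/eqP; congr (Some _).
  exact: val_inj.
by [].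
Qed.

End NonDivisible.

Section CornerMatrix.

Variables (F : fieldType) (a b : nat).
Implicit Type x y : nat -> nat -> F.

(** Entries are functions of natural numbers, so that small matrices can be checked by computation
    on the indices. *)
Definition small_mx x : 'M[F]_a := \matrix_(i, j) x i j.

Definition corner_mx x : 'M[F]_(a + b) := block_mx (small_mx x) 0 0 1%:M.

Lemma corner_mxE x (i j : 'I_(a + b)) :
  corner_mx x i j = if ((i < a) && (j < a))%N then x i j else (i == j)%:R.
Proof.
case: (split_ordP i) => i' ->; case: (split_ordP j) => j' ->.
- by rewrite block_mxEul mxE /=.
- by rewrite block_mxEur mxE eq_lrshift /=.
- by rewrite block_mxEdl mxE eq_rlshift /=.
by rewrite block_mxEdr mxE eq_rshift /=.
Qed.

Lemma corner_unit x y (u : F) : u != 0 -> small_mx x *m small_mx y = u%:M ->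
  corner_mx x \in unitmx.
Proof.
move=> nzu e; rewrite unitmxE det_lblock det1 mulr1 -unitmxE.
have : small_mx x *m (u^-1 *: small_mx y) = 1%:M.
  by rewrite -scalemxAr e scale_scalar_mx mulVf.
by case/mulmx1_unit.
Qed.

Lemma fixes_corner x (R M : 'M_a) (D : 'M_b) : corner_mx x \in unitmx ->
  small_mx x *m R = M *m small_mx x -> monomial M -> monomial D ->
  fixes_frame (corner_mx x) (block_mx R 0 0 D).
Proof.
move=> ux e mM mD; apply: (fixes_frame_intertwine (M := block_mx M 0 0 D) ux).
  by rewrite !mulmx_block !(mulmx0, mul0mx, addr0, add0r, mulmx1, mul1mx) e.
exact: monomial_block.
Qed.

End CornerMatrix.

(** * The case of even q *)

Section EvenCharacteristic.

Variables (k : nat) (F : finFieldType).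
Hypothesis q5 : (5 <= #|F|)%N.
Hypothesis k2 : (2 <= k)%N.
Hypothesis F2 : 2%:R = 0 :> F.
Hypothesis expF : forall w : F, w != 0 -> w ^+ k.+3 = 1.

Lemma sqr_inj_char2 : injective (fun x : F => x ^+ 2).
Proof.
move=> x y e; apply/eqP; rewrite -subr_eq0 -[_ == 0](expf_eq0 _ 2).
have -> : (x - y) ^+ 2 = x ^+ 2 - y ^+ 2 + 2%:R * (y * (y - x)) by ring.
by rewrite e subrr F2 mul0r addr0.
Qed.

Lemma sqrt_char2 (x : F) : exists y, y ^+ 2 = x.
Proof. by have [g _ gK] := injF_bij sqr_inj_char2; exists (g x). Qed.

Lemma oppr_char2 (x : F) : - x = x.
Proof.
by apply/eqP; rewrite eq_sym -addr_eq0 -mulr2n -mulr_natr F2 mulr0.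
Qed.

(** The rows (1, 1) and (1, u) span the lines that replace <e_0> and <e_1>. *)
Definition pair_entry (u : F) (i j : nat) : F :=
  if (i == 1)%N && (j == 1)%N then u else 1.

Definition pair_mx u : 'M[F]_(2 + k.+1) := corner_mx 2 k.+1 (pair_entry u).

Lemma pair_unit u : u != 1 -> pair_mx u \in unitmx.
Proof.
(* The second factor is the adjugate and u - 1 is the determinant. *)
move=> nu1; apply: (@corner_unit F 2 k.+1 _
  (fun i j => if i != j then -1 else if i == 0%N then u else 1) (u - 1)).
  by rewrite subr_eq0.
apply/matrixP=> i j; rewrite !mxE !big_ord_recl big_ord0 !mxE /pair_entry /=.
by case: i j => [[|[|[]]] // ?] [[|[|[]]] // ?]; rewrite /= ?mulr1n ?mulr0n; ring.
Qed.

Definition swap_mx (u v : F) : 'M[F]_(2 + k.+1) :=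
  corner_mx 2 k.+1 (fun i j => if i == j then 0 else if i == 0%N then u else v).

Lemma det_swap u v : \det (swap_mx u v) = - (u * v).
Proof.
rewrite det_lblock det1 mulr1 (expand_det_row _ 0) !big_ord_recl big_ord0.
rewrite /cofactor !det_mx11 !mxE /= expr0 expr1; ring.
Qed.

(** The matrix sends e_0 + e_1 to w (e_0 + u e_1) and e_0 + u e_1 to v (e_0 + e_1), so it exchanges
    the two lines. *)
Lemma swap_fixes u v w : u != 1 -> v = u * w -> fixes_frame (pair_mx u) (swap_mx v w).
Proof.
move=> nu1 evw; apply: (fixes_corner
   (M := \matrix_(i, j) if i == j then 0 else if i == 0 then w else v)).
- exact: pair_unit.
- apply/matrixP=> i j; rewrite !mxE !big_ord_recl !big_ord0 !mxE /pair_entry evw /=.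
  by case: i j => [[|[|[]]] // ?] [[|[|[]]] // ?]; rewrite /=; ring.
- apply/monomialP=> i; exists (1 - i) => j; rewrite mxE.
  by case: i j => [[|[|[]]] // ?] [[|[|[]]] // ?].
exact: monomial1.
Qed.

Lemma swap_mxE u v (i j : 'I_k.+3) : ~~ ((i < 2) && (j < 2))%N ->
  (swap_mx u v : 'M_k.+3) i j = (i == j)%:R.
Proof.
move=> /negPf nij; have := @corner_mxE F 2 k.+1
  (fun i j => if i == j then 0 else if i == 0%N then u else v) i j.
by rewrite nij.
Qed.

Lemma pair_mxE u (i j : 'I_k.+3) : (pair_mx u : 'M_k.+3) i j
  = if ((i < 2) && (j < 2))%N then pair_entry u i j else (i == j)%:R.
Proof. exact: corner_mxE. Qed.

Lemma pair_row (u : F) (p : 'I_k.+3 -> 'I_k.+3) (c : 'I_k.+3 -> F) (A : 'M_k.+3) :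
  u != 0 -> u != 1 -> injective p -> (forall i, c i != 0) ->
  (forall i j, A i j = if j == p i then c i else 0) ->
  fixes_frame (pair_mx u) A -> (p 0%R < 2)%N -> (p 1%R < 2)%N ->
  forall i : nat, (i < 2)%N -> exists (i' : nat) y,
  [/\ (i' < 2)%N, c 0 = y * pair_entry u i' (p 0)
    & pair_entry u i 1 * c 1 = y * pair_entry u i' (p 1)].
Proof.
move=> nzu nu1 injp nzc AE fA p0 p1 i lti.
have [i' [y H]] := fixes_rows injp AE (pair_unit nu1) fA (inord i).
have vi : (inord i : 'I_k.+3) = i :> nat.
  by rewrite inordK // (leq_trans lti).
have := H 1; have := H 0; rewrite !pair_mxE vi lti p0 p1 !andbT.
rewrite {1}/pair_entry andbF mul1r /=.
have [lti'|gei'] := boolP (i' < 2)%N; first by exists i', y.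
have -> : (i' == p 0) = false.
  by apply: contraNF gei' => /eqP->.
by move=> c0; have := nzc 0; rewrite c0 mulr0 eqxx.
Qed.

Variables (u v : F).
Hypotheses (nzu : u != 0) (nzv : v != 0) (nu1 : u != 1) (nv1 : v != 1).
Hypothesis nuv : u != v.

(** The links form a path on the coordinates from 2 on. With the two pair frames, there are k + 2
    frames besides the coordinate frame, one less than the dimension. *)
Definition even_frame (i : option (bool + 'I_k)) : 'M[F]_(2 + k.+1) :=
  match i with
  | None => 1%:M
  | Some (inl s) => pair_mx (if s then u else v)
  | Some (inr j) => link_mx F k.+2 (2 + j)
  end.

Lemma even_frame_unit i : even_frame i \in unitmx.
Proof.
case: i => [[s|j]|] /=; last exact: unitmx1.
  by apply: pair_unit; case: s.
by apply: link_unit; rewrite !ltnS.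
Qed.

Lemma even_frames_base (A : 'M[F]_(2 + k.+1)) : \det A = 1 ->
  (forall i, fixes_frame (even_frame i) A) -> is_scalar_mx A.
Proof.
move=> dA fA; have uA : A \in unitmx by rewrite unitmxE dA unitr1.
have mA : monomial A by rewrite -fixes_frame1 (fA None).
have [p [c [injp nzc AE]]] := monomial_repr uA mA.
have H (j : 'I_k.+3) : (2 <= j)%N -> p j = j /\ c j = c (inord 2).
  move=> ge2; apply: (links_chain (s := 2) (t := k.+2) injp nzc AE).
  - by rewrite !ltnS k2 leqnn.
  - case=> [|[|i]] // lt_i; have lti : (i < k)%N by [].
    exact: (fA (Some (inr (Ordinal lti)))).
  by rewrite ge2 /= -ltnS.
have small (i : 'I_k.+3) : (i < 2)%N -> (p i < 2)%N.
  move=> lti; rewrite ltnNge; apply/negP=> gei; have [/injp e _] := H _ gei.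
  by rewrite e leqNgt lti in gei.
have p0 := small 0 isT; have p1 := small 1 isT.
have ru (s : F) : s = u \/ s = v -> forall i, (i < 2)%N -> exists (i' : nat) y,
    [/\ (i' < 2)%N, c 0 = y * pair_entry s i' (p 0)
      & pair_entry s i 1 * c 1 = y * pair_entry s i' (p 1)].
  have fs b := fA (Some (inl b)).
  by case=> -> i lti; [apply: pair_row injp nzc AE (fs true) p0 p1 i lti
                     | apply: pair_row injp nzc AE (fs false) p0 p1 i lti].
have neq01 : val (p 0) != val (p 1) by rewrite val_eqE (inj_eq injp).
have : val (p 0) = 0%N /\ val (p 1) = 1%N \/ val (p 0) = 1%N /\ val (p 1) = 0%N.
  move: neq01 p0 p1; rewrite /=; move: (nat_of_ord (p 0)) (nat_of_ord (p 1)).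
  by case=> [|[|?]] [|[|?]] // _ _ _; [left | right].
(* If p exchanges 0 and 1, the line <e_0 + e_1> of both pair frames forces c_0 = c_1, because u <>
   v; the other line then gives u = 1 or u^2 = 1, which is the same in characteristic 2. *)
case=> -[e0 e1]; last first.
  have val0 (s : F) : s = u \/ s = v -> c 0 = c 1 \/ c 0 = c 1 * s.
    move=> es; have [i' [y [_]]] := ru s es 0%N isT.
    rewrite /pair_entry e0 e1 /= ?andbT ?andbF ?mulr1 ?mul1r => h0 h1.
    by move: h0; rewrite -h1; case: ifP => _; rewrite ?mulr1; [right | left].
  have c01 : c 0 = c 1.
    case: (val0 u (or_introl erefl)) => // eu; case: (val0 v (or_intror erefl)) => // ev.
    by case/eqP: nuv; apply: (mulfI (nzc 1)); rewrite -eu.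
  have [i' [y [_]]] := ru u (or_introl erefl) 1%N isT.
  rewrite /pair_entry e0 e1 /= ?andbT ?andbF ?mulr1 ?mul1r => h0 h1.
  exfalso; move: h0; rewrite -h1 c01; case: ifP => _.
    rewrite mulrAC -expr2 -[LHS]mul1r => /(mulIf (nzc 1))/esym u2.
    by case/eqP: nu1; apply: sqr_inj_char2; rewrite u2 expr1n.
  rewrite mulr1 -[LHS]mul1r => /(mulIf (nzc 1))/esym u1.
  by case/eqP: nu1.
have p01 : p 0 = 0 by apply: val_inj.
have p11 : p 1 = 1 by apply: val_inj.
have c01 : c 1 = c 0.
  have val0 (s : F) : s = u \/ s = v -> c 1 = c 0 \/ c 1 = c 0 * s.
    move=> es; have [i' [y [_]]] := ru s es 0%N isT.
    rewrite /pair_entry e0 e1 /= ?andbT ?andbF ?mulr1 ?mul1r => -> ->.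
    by case: ifP => _; rewrite ?mulr1; [right | left].
  case: (val0 u (or_introl erefl)) => // eu; case: (val0 v (or_intror erefl)) => // ev.
  by case/eqP: nuv; apply: (mulfI (nzc 0)); rewrite -eu.
have pE i : p i = i.
  case: (leqP 2 i) => [/H[] //|]; case: i => [[|[|//]] lti] _.
    by have -> : Ordinal lti = 0 by apply: val_inj.
  by have -> : Ordinal lti = 1 by apply: val_inj.
(* The determinant gives c_0^2 a^(k+1) = 1 = a^(k+3), and squaring is injective. *)
have c0a : c 0 = c (inord 2).
  apply: sqr_inj_char2; set a := c (inord 2).
  have := dA; have -> : A = diag_mx (\row_i c i).
    apply/matrixP=> i j; rewrite AE pE !mxE (eq_sym j).
    by case: eqP; rewrite ?mulr1n ?mulr0n.
  rewrite det_diag 2!big_ord_recl !mxE.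
  have -> : lift ord0 ord0 = 1 :> 'I_k.+3 by apply: val_inj.
  rewrite (_ : ord0 = 0) // c01 (eq_bigr (fun=> a)) => [|i _]; last first.
    by rewrite mxE; case: (H (lift ord0 (lift ord0 i)) isT).
  rewrite prodr_const card_ord mulrA -expr2 => e.
  have nza : a ^+ k.+1 != 0 by rewrite expf_neq0 // nzc.
  apply: (mulIf nza); rewrite e -exprD.
  by rewrite expF // nzc.
apply: (scalar_repr (c := c) (a := c 0) AE pE) => i.
case: (leqP 2 i) => [/H[_ ->] //|]; case: i => [[|[|//]] lti] _.
  by congr (c _); apply: val_inj.
by rewrite -[RHS]c01; congr (c _); apply: val_inj.
Qed.

Lemma even_frames_essential (i : option (bool + 'I_k)) : i != None ->
  exists A : 'M[F]_(2 + k.+1), [/\ \det A = 1, ~~ is_scalar_mx A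
    & forall i', i' != i -> fixes_frame (even_frame i') A].
Proof.
have other (b b' : bool) : Some (inl b') != Some (inl b) :> option (bool + 'I_k) ->
  (if b' then u else v) = if b then v else u by case: b b' => [] [].
have link_neq (j j' : 'I_k) : Some (inr j') != Some (inr j) :> option (bool + 'I_k) ->
  (j' == j :> nat) = false.
  by apply: contraNF => /eqP/val_inj->; rewrite eqxx.
have lt_link (j : 'I_k) : (2 + j < k.+2)%N by rewrite !ltnS.
have vlink (j : 'I_k) : (inord (2 + j) : 'I_k.+3) = (2 + j)%N :> nat.
  by rewrite inordK // (leq_trans (lt_link j)).
have vlinkS (j : 'I_k) : (inord (2 + j).+1 : 'I_k.+3) = (2 + j).+1 :> nat.
  by rewrite inordK // ltnS.
case: i => [[s|j]|//] _.
  (* The exchange is made for the other pair frame, with parameter w; the square root y makes its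
     determinant w y^2 equal to 1. *)
  pose w := if s then v else u.
  have nzw : w != 0 by rewrite /w; case: ifP.
  have nw1 : w != 1 by rewrite /w; case: ifP.
  have [y y2] := sqrt_char2 w^-1.
  have nzy : y != 0.
    by rewrite -[_ == 0](expf_eq0 _ 2) y2 invr_eq0.
  have mS : monomial (swap_mx (w * y) y).
    apply: monomial_block; last exact: monomial1.
    apply/monomialP=> i; exists (1 - i) => j; rewrite mxE.
    by case: i j => [[|[|[]]] // ?] [[|[|[]]] // ?].
  exists (swap_mx (w * y) y); split.
  - by rewrite det_swap oppr_char2 -mulrA -expr2 y2 divff.
  - apply: (@not_scalar_offdiag _ _ _ (lshift _ 0) (lshift _ 1)) => //.
    by rewrite /swap_mx block_mxEul mxE /= mulf_neq0.
  case=> [[s'|j]|] ni; last by rewrite fixes_frame1.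
    by rewrite /= (other s) //; apply: swap_fixes.
  apply: fixes_transvection => //; first exact: inord_neqS.
  - by move=> i; apply: swap_mxE; rewrite vlink andbF.
  by move=> i; apply: swap_mxE; rewrite vlinkS.
have [b [nb0 nb1 _ _]] := avoid4 q5 0 1 0 0.
(* The diagonal matrix is constant on the two parts of the broken path and on {0, 1}, where the
   square root y corrects the determinant. *)
pose e (m : nat) : F := if (m <= j)%N then 1 else b.
have [y y2] := sqrt_char2 (\prod_(m < k.+1) e m)^-1.
have nze m : e m != 0 by rewrite /e; case: ifP; rewrite ?oner_neq0.
pose d : 'rV[F]_(2 + k.+1) := \row_i if (i < 2)%N then y else e (i - 2)%N.
exists (diag_mx d); split.
- rewrite det_diag big_split_ord /= [X in X * _](eq_bigr (fun=> y)) => [|m _].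
    rewrite [X in _ * X](eq_bigr (fun m : 'I_k.+1 => e m)) => [|m _].
      by rewrite prodr_const card_ord y2 mulVf //; apply/prodf_neq0.
    by rewrite mxE /= subn2 /=.
  by rewrite mxE /= ltn_ord.
- apply: (@not_scalar_diag _ _ _ (rshift 2 0) (rshift 2 ord_max)).
  by rewrite !mxE /= !subn2 /= /e !add0n leq0n leqNgt ltn_ord eq_sym.
case=> [[s|j']|] ni; last by rewrite fixes_frame1 monomial_diag.
  apply: fixes_diag; first exact: (even_frame_unit (Some (inl s))).
  move=> i i'; rewrite pair_mxE !mxE; case: ifP => [/andP[-> ->] //|_].
  by have [->|] := eqVneq i i'; rewrite ?eqxx.
apply: fixes_link_diag => //; rewrite !mxE vlink vlinkS /= /e !subn2 /=.
by rewrite leq_eqVlt (link_neq j).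
Qed.

Lemma base_number_even :
  (k.+2 <= base_number [set: PSL k.+3 F] (coset_action (PSL_monomial k.+2 F)))%N.
Proof.
have cJ : #|[set~ (None : option (bool + 'I_k))]| = k.+2.
  by rewrite cardsC1 card_option card_sum card_bool card_ord.
rewrite -[X in (X <= _)%N]cJ.
apply: (@leq_base_number_frames k.+2 F _ even_frame).
- exact: even_frame_unit.
- exact: even_frames_base.
by move=> i; rewrite in_setC1; apply: even_frames_essential.
Qed.

End EvenCharacteristic.

(** * The case of odd q *)

Section OddCharacteristic.

Variables (k : nat) (F : finFieldType).
Hypothesis q5 : (5 <= #|F|)%N.
Hypothesis k2 : (2 <= k)%N.
Hypothesis F2 : 2%:R != 0 :> F.
Hypothesis expF : forall w : F, w != 0 -> w ^+ k.+4.+1 = 1.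

(** For t = 0, 1, 2, 3 these are the sign vectors (1, 1, 1), (1, -1, -1), (-1, 1, -1), (-1, -1, 1);
    with a column of ones they form a Hadamard matrix. *)
Definition sgn_entry (t j : nat) : F := if (t == 0)%N || (t == j.+1) then 1 else -1.

Definition hadamard_entry (i j : nat) : F := if j == 3%N then 1 else sgn_entry i j.

(** Row i < 3 combines the two other vectors among e_0, e_1, e_2 with the signs of vector t; row 3
    is e_3. *)
Definition triangle_entry (t i j : nat) : F :=
  if (i == 3%N) || (j == 3%N) then (i == j)%:R
  else if i == j then 0 else sgn_entry t j.

Definition odd_entry (s : nat) : nat -> nat -> F :=
  if s is t.+1 then triangle_entry t else hadamard_entry.

Definition odd_corner s : 'M[F]_(4 + k.+1) := corner_mx 4 k.+1 (odd_entry s).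

Lemma sgn_neq0 t j : sgn_entry t j != 0.
Proof. by rewrite /sgn_entry; case: ifP; rewrite ?oppr_eq0 oner_neq0. Qed.

Lemma one_neqN1 : 1 != -1 :> F.
Proof. by rewrite -addr_eq0 -mulr2n. Qed.

Lemma odd_corner_unit s : (s < 4)%N -> odd_corner s \in unitmx.
Proof.
case: s => [_|t]; last rewrite ltnS => lt_t.
  apply: (@corner_unit F 4 k.+1 _ (fun i j => hadamard_entry j i) (2%:R * 2%:R)).
    by rewrite mulf_neq0.
  apply/matrixP=> i j; rewrite !mxE !big_ord_recl !big_ord0 !mxE.
  by case: i j => [[|[|[|[|[]]]]] // ?] [[|[|[|[|[]]]]] // ?];
     rewrite /odd_entry /hadamard_entry /sgn_entry /bump /= ?mulr1n ?mulr0n; ring.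
apply: (@corner_unit F 4 k.+1 _ (fun i j => if (i == 3%N) || (j == 3%N) then
     (i == j)%:R * 2%:R else sgn_entry t i * (if i == j then -1 else 1)) 2%:R F2).
apply/matrixP=> i j; rewrite !mxE !big_ord_recl !big_ord0 !mxE.
by case: t lt_t => [|[|[|]]] // _;
   case: i j => [[|[|[|[|[]]]]] // ?] [[|[|[|[|[]]]]] // ?];
   rewrite /odd_entry /triangle_entry /sgn_entry /bump /= ?mulr1n ?mulr0n; ring.
Qed.

Definition swap_nat (a b i : nat) : nat := if i == a then b else if i == b then a else i.

Definition swap_perm (a b : nat) : 'M[F]_4 := \matrix_(i, j) (swap_nat a b i == j)%:R.

Lemma swap_perm_monomial a b : (a < 4)%N -> (b < 4)%N -> monomial (swap_perm a b).
Proof.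
move=> lt_a lt_b; apply/monomialP=> i; have lt_s : (swap_nat a b i < 4)%N.
  by rewrite /swap_nat; do 2?[case: ifP].
exists (Ordinal lt_s) => j nj; rewrite mxE; case: eqP => // e.
by case/eqP: nj; apply: val_inj.
Qed.

(** With [refl_snd], this encodes the transpositions (0 1), (0 2), (1 2) for s = 1, 2, 3. *)
Definition refl_fst (s : nat) : nat := (s == 3)%N.
Definition refl_snd (s : nat) : nat := (if s == 1 then 1 else 2)%N.

(* The signed transposition that exchanges the lines 3 and s - 1 of the
   Hadamard frame, for s = 1, 2, 3. *)
Definition refl_entry (s i j : nat) : F :=
  (swap_nat (refl_fst s) (refl_snd s) i == j)%:R
    * (if (s == 1)%N && (i < 2)%N then -1 else 1).

(** The permutation which the signed transposition s induces on the rows of a frame s' other than s;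
    no signs occur. *)
Definition refl_image (s s' : nat) : 'M[F]_4 :=
  if s' is 0 then swap_perm s.-1 3 else swap_perm (refl_fst s) (refl_snd s).

Lemma refl_image_monomial s s' : (s < 4)%N -> monomial (refl_image s s').
Proof.
case: s' => [|s'] lt_s /=; last first.
  by apply: swap_perm_monomial; rewrite /refl_fst /refl_snd; case: eqP.
by rewrite swap_perm_monomial // (leq_ltn_trans (leq_pred s)).
Qed.

Lemma refl_monomial s : (s < 4)%N -> monomial (small_mx 4 (refl_entry s)).
Proof.
move=> lt_s; have /monomialP H := @refl_image_monomial s 1 lt_s.
apply/monomialP=> i; have [j Hj] := H i; exists j => l /Hj.
by rewrite !mxE /refl_entry => ->; rewrite mul0r.
Qed.

Lemma refl_intertwine s s' : (0 < s < 4)%N -> (s' < 4)%N -> s' != s ->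
  small_mx 4 (odd_entry s') *m small_mx 4 (refl_entry s)
    = refl_image s s' *m small_mx 4 (odd_entry s').
Proof.
case: s => [|[|[|[|]]]] // _; case: s' => [|[|[|[|]]]] // _ _;
  apply/matrixP=> i j; rewrite !mxE !big_ord_recl !big_ord0 !mxE;
  case: i j => [[|[|[|[|[]]]]] // ?] [[|[|[|[|[]]]]] // ?];
  rewrite /odd_entry /triangle_entry /hadamard_entry /sgn_entry /refl_entry
    /swap_nat /refl_fst /refl_snd /bump /=; ring.
Qed.

Lemma refl_sqr s : (0 < s < 4)%N ->
  small_mx 4 (refl_entry s) *m small_mx 4 (refl_entry s) = 1%:M.
Proof.
by case: s => [|[|[|[|]]]] // _;
  apply/matrixP=> i j; rewrite !mxE !big_ord_recl !big_ord0 !mxE;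
  case: i j => [[|[|[|[|[]]]]] // ?] [[|[|[|[|[]]]]] // ?];
  rewrite /refl_entry /swap_nat /refl_fst /refl_snd /bump /=; ring.
Qed.

Definition odd_frame (i : option ('I_4 + 'I_k)) : 'M[F]_(4 + k.+1) :=
  match i with
  | None => 1%:M
  | Some (inl s) => odd_corner s
  | Some (inr j) => link_mx F k.+4 (3 + j)
  end.

Lemma odd_frame_unit i : odd_frame i \in unitmx.
Proof.
case: i => [[s|j]|] /=; last exact: unitmx1.
  exact: odd_corner_unit.
by apply: link_unit; rewrite !ltnS ltnW.
Qed.

Lemma odd_cornerE s (i j : 'I_(k.+4.+1)) : (odd_corner s : 'M_(k.+4.+1)) i j
  = if ((i < 4) && (j < 4))%N then odd_entry s i j else (i == j)%:R.
Proof. exact: corner_mxE. Qed.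

Section Base.

Variables (p : 'I_(k.+4.+1) -> 'I_(k.+4.+1)) (c : 'I_(k.+4.+1) -> F).
Variable A : 'M[F]_(k.+4.+1).
Hypothesis injp : injective p.
Hypothesis nzc : forall i, c i != 0.
Hypothesis AE : forall i j, A i j = if j == p i then c i else 0.
Hypothesis p3 : p (inord 3) = inord 3.

Let vi (i : nat) : (i < 4)%N -> (inord i : 'I_(k.+4.+1)) = i :> nat.
Proof. by move=> lti; rewrite inordK // (leq_trans lti). Qed.

(** The line of (1, 1, 1, 1) is mapped to the line of some row i'. The scalar is c_3, as p fixes 3
    and column 3 of the Hadamard matrix consists of ones. *)
Let hadamard_first : fixes_frame (odd_corner 0) A ->
  exists i' : 'I_(k.+4.+1), (i' < 4)%N /\ forall r : 'I_(k.+4.+1), (r < 4)%N ->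
    c r = c (inord 3) * (odd_corner 0 : 'M_(k.+4.+1)) i' (p r).
Proof.
move=> fA; have [i' [y H]] := fixes_rows injp AE (odd_corner_unit (isT : 0 < 4)%N) fA ord0.
have := H (inord 3); rewrite p3 !odd_cornerE vi //= /hadamard_entry /=.
rewrite mul1r andbT; have [lti' ey|gei'] := ltnP i' 4; last first.
  have -> : (i' == inord 3) = false.
    by apply: contraTF gei' => /eqP->; rewrite vi.
  by move=> c0; have := nzc (inord 3); rewrite c0 mulr0 eqxx.
rewrite mulr1 in ey; exists i'; split=> // r lt_r; rewrite ey -H odd_cornerE lt_r /=.
by rewrite /hadamard_entry /sgn_entry /= if_same mul1r.
Qed.

Lemma hadamard_small : fixes_frame (odd_corner 0) A ->
  forall r : 'I_(k.+4.+1), (r < 3)%N -> (p r < 3)%N.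
Proof.
case/hadamard_first=> i' [lt_i' H] r lt_r.
have lt_p : (p r < 4)%N.
  have := nzc r; rewrite (H r (leqW lt_r)) odd_cornerE lt_i' /=.
  case: ifP => // ge4; rewrite mulf_eq0 negb_or => /andP[_].
  by have [e|_] := eqVneq i' (p r); [rewrite -e lt_i' in ge4 | rewrite eqxx].
rewrite ltn_neqAle -ltnS lt_p andbT; apply: contraTneq lt_r => e.
have /injp-> : p r = p (inord 3) by apply: val_inj; rewrite p3 /= vi.
by rewrite vi.
Qed.

Hypothesis small : forall i : 'I_(k.+4.+1), (i < 3)%N -> (p i < 3)%N.

Lemma hadamard_row : fixes_frame (odd_corner 0) A ->
  exists i' : nat, (i' < 4)%N /\
    forall r : 'I_(k.+4.+1), (r < 3)%N -> c r = c (inord 3) * sgn_entry i' (p r).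
Proof.
case/hadamard_first=> i' [lt_i' H]; exists i'; split=> // r lt_r.
have lt_p := small lt_r; rewrite (H r (leqW lt_r)) odd_cornerE lt_i' (leqW lt_p).
by rewrite /= /hadamard_entry (ltn_eqF lt_p).
Qed.

Lemma triangle_row t i : (t < 3)%N -> fixes_frame (odd_corner t.+1) A -> (i < 3)%N ->
  exists (i' : nat) y, forall r : 'I_(k.+4.+1), (r < 3)%N -> (r != i :> nat) ->
    (p r != i' :> nat) /\ sgn_entry t r * c r = y * sgn_entry t (p r).
Proof.
move=> lt_t fA lt_i.
have [i' [y H]] := fixes_rows injp AE (odd_corner_unit (lt_t : t.+1 < 4)%N) fA (inord i).
exists i', y => r lt_r nri; have lt_p := small lt_r.
have := H r; rewrite !odd_cornerE vi ?(leqW lt_i) // !(leqW lt_r) !(leqW lt_p) !andbT /=.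
rewrite /triangle_entry !(ltn_eqF lt_i) !(ltn_eqF lt_r) !(ltn_eqF lt_p) !orbF /=.
rewrite (eq_sym i) (negPf nri).
have nz : sgn_entry t r * c r != 0 by rewrite mulf_neq0 ?sgn_neq0.
have nval : (i' == p r) = (i' == p r :> nat) by [].
rewrite nval eq_sym.
have [e|ne] := eqVneq (p r : nat) i'.
  have lt_i' := lt_p; rewrite e in lt_i'.
  by rewrite (leqW lt_i') (gtn_eqF lt_i') mulr0 => e0; rewrite e0 eqxx in nz.
case: ifP => [_|]; last by move=> _ e0; rewrite e0 mulr0 eqxx in nz.
case: ifP => _; last by [].
by rewrite mulr0 => e0; rewrite e0 eqxx in nz.
Qed.

Let sgn_inj t j t' j' : sgn_entry t j = sgn_entry t' j' ->
  (t == 0%N) || (t == j.+1) = ((t' == 0%N) || (t' == j'.+1)).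
Proof.
rewrite /sgn_entry; do 2![case: ifP] => // _ _ /eqP; last rewrite eq_sym.
  by rewrite (negPf one_neqN1).
by rewrite (negPf one_neqN1).
Qed.

(** Triangle 0, with all signs positive, makes c constant on {0, 1, 2}. The other sign vectors are
    not constant, so the Hadamard frame gives c = c_3. In triangles 1 and 2 the pairs of equal signs
    show that p fixes 0 and 1. *)
Lemma corner_fixed : (forall s, (s < 4)%N -> fixes_frame (odd_corner s) A) ->
  forall r : 'I_(k.+4.+1), (r < 3)%N -> p r = r /\ c r = c (inord 3).
Proof.
move=> fA; have [i' [lt_i' Hh]] := hadamard_row (fA 0%N isT).
pose o r : 'I_(k.+4.+1) := inord r.
have vo r : (r < 3)%N -> o r = r :> nat by move=> lt_r; rewrite vi // leqW.
have po r : (r < 3)%N -> (p (o r) < 3)%N by move=> lt_r; rewrite small // vo.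
have nz := nzc (inord 3).
have row t i : (t < 3)%N -> (i < 3)%N -> exists y, forall r, (r < 3)%N -> r != i ->
    sgn_entry t r * c (o r) = y * sgn_entry t (p (o r)).
  move=> lt_t lt_i; have [i1 [y H]] := triangle_row lt_t (fA t.+1 lt_t) lt_i.
  by exists y => r lt_r nri; have [||_] := H (o r); rewrite ?vo.
have tri t i r r' : (t < 3)%N -> (i < 3)%N -> (r < 3)%N -> (r' < 3)%N ->
    r != i -> r' != i -> sgn_entry t r * c (o r) = sgn_entry t r' * c (o r') ->
    sgn_entry t (p (o r)) = sgn_entry t (p (o r')).
  move=> lt_t lt_i lt_r lt_r' nri nr'i; have [y H] := row t i lt_t lt_i.
  rewrite !H //; apply: mulfI; apply/eqP=> y0; have /eqP := H r lt_r nri.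
  by rewrite y0 mul0r mulf_eq0 (negPf (sgn_neq0 _ _)) (negPf (nzc _)).
have c12 : c (o 1%N) = c (o 2%N).
  have [y H] := row 0%N 0%N isT isT.
  by have := H 2%N isT isT; have := H 1%N isT isT; rewrite !mul1r => -> ->.
have c02 : c (o 0%N) = c (o 2%N).
  have [y H] := row 0%N 1%N isT isT.
  by have := H 2%N isT isT; have := H 0%N isT isT; rewrite !mul1r => -> ->.
have ch r : (r < 3)%N -> c (o r) = c (inord 3) * sgn_entry i' (p (o r)).
  by move=> lt_r; rewrite Hh // vo.
have s01 : sgn_entry i' (p (o 0%N)) = sgn_entry i' (p (o 1%N)).
  by apply: (mulfI nz); rewrite -!ch // c02 c12.
have s02 : sgn_entry i' (p (o 0%N)) = sgn_entry i' (p (o 2%N)).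
  by apply: (mulfI nz); rewrite -!ch // c02.
have t1 := tri 1%N 0%N 1%N 2%N isT isT isT isT isT isT.
have t2 := tri 2%N 1%N 0%N 2%N isT isT isT isT isT isT.
rewrite {1 2}/sgn_entry /= c12 in t1; rewrite {1 2}/sgn_entry /= c02 in t2.
have {t1} t1 := t1 erefl; have {t2} t2 := t2 erefl.
have dist r r' : (r < 3)%N -> (r' < 3)%N -> r != r' -> p (o r) != p (o r') :> nat.
  move=> lt_r lt_r'; apply: contraNneq => /val_inj/injp e.
  by have := vo r lt_r; rewrite e vo // => ->.
have all_val : [/\ p (o 0%N) = 0%N :> nat, p (o 1%N) = 1%N :> nat,
                   p (o 2%N) = 2%N :> nat & i' = 0%N].
  move: (po 0%N isT) (po 1%N isT) (po 2%N isT) (dist 0%N 1%N isT isT isT)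
    (dist 0%N 2%N isT isT isT) (dist 1%N 2%N isT isT isT).
  move: (sgn_inj s01) (sgn_inj s02) (sgn_inj t1) (sgn_inj t2) lt_i'.
  move: (nat_of_ord (p (o 0%N))) (nat_of_ord (p (o 1%N))) (nat_of_ord (p (o 2%N))).
  by clear; case=> [|[|[|?]]] [|[|[|?]]] [|[|[|?]]] //;
     case: i' => [|[|[|[|?]]]].
case: all_val => v0 v1 v2 i'0 r lt_r; have er : r = o r.
  by rewrite /o inord_val.
have pv m : (m < 3)%N -> p (o m) = m :> nat by case: m => [|[|[|]]].
split; first by apply: val_inj; rewrite /= {1}er pv.
by rewrite {1}er ch // i'0 /sgn_entry mulr1.
Qed.

End Base.

Lemma odd_frames_base (A : 'M[F]_(4 + k.+1)) : \det A = 1 ->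
  (forall i, fixes_frame (odd_frame i) A) -> is_scalar_mx A.
Proof.
move=> dA fA; have uA : A \in unitmx by rewrite unitmxE dA unitr1.
have mA : monomial A by rewrite -fixes_frame1 (fA None).
have [p [c [injp nzc AE]]] := monomial_repr uA mA.
have H (j : 'I_(k.+4.+1)) : (3 <= j <= k.+3)%N -> p j = j /\ c j = c (inord 3).
  apply: (links_chain (n := k.+4) (s := 3) (t := k.+3) injp nzc AE).
    by rewrite !ltnS k2 leqnSn.
  case=> [|[|[|i]]] // lt_i; have lti : (i < k)%N by [].
  exact: (fA (Some (inr (Ordinal lti)))).
have [|p3 _] := H (inord 3); first by rewrite inordK.
have fc s : (s < 4)%N -> fixes_frame (odd_corner s) A.
  by move=> lt_s; apply: (fA (Some (inl (Ordinal lt_s)))).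
have small := hadamard_small injp nzc AE p3 (fc 0%N isT).
have fixed (j : 'I_(k.+4.+1)) : (j < k.+4)%N -> p j = j /\ c j = c (inord 3).
  move=> lt_j; have [lt_j3|ge_j3] := ltnP j 3.
    exact: (corner_fixed injp nzc AE p3 small).
  by apply: H; rewrite ge_j3.
have le_max (j : 'I_(k.+4.+1)) : (j <= k.+4)%N by rewrite -ltnS ltn_ord.
have pE j : p j = j.
  have [/fixed[] //|ge_j] := ltnP j k.+4.
  have [lt_pj|ge_pj] := ltnP (p j) k.+4.
    by have [/injp e _] := fixed _ lt_pj.
  apply/val_inj/eqP; rewrite eqn_leq.
  by rewrite (leq_trans (le_max _) ge_j) (leq_trans (le_max _) ge_pj).
set a := c (inord 3) in fixed.
(* The determinant gives a^(k+4) c_max = 1 = a^(k+5). *)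
have cmax : c ord_max = a.
  have nza : a ^+ k.+4 != 0 by rewrite expf_neq0 // nzc.
  have := dA; have -> : A = diag_mx (\row_i c i).
    apply/matrixP=> i j; rewrite AE pE !mxE (eq_sym j).
    by case: eqP; rewrite ?mulr1n ?mulr0n.
  rewrite det_diag big_ord_recr /= (eq_bigr (fun=> a)) => [|i _]; last first.
    by rewrite mxE; case: (fixed (widen_ord (leqnSn _) i)) => /=.
  rewrite prodr_const card_ord mxE => e.
  by apply: (mulfI nza); rewrite -exprSr expF ?nzc // -e.
apply: (scalar_repr (c := c) (a := a) AE pE) => i.
have [/fixed[] //|ge_i] := ltnP i k.+4.
rewrite -cmax; congr (c _); apply/val_inj/eqP.
by rewrite eqn_leq ge_i le_max.
Qed.

Lemma odd_frames_essential (i : option ('I_4 + 'I_k)) : i != None ->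
  exists A : 'M[F]_(4 + k.+1), [/\ \det A = 1, ~~ is_scalar_mx A
    & forall i', i' != i -> fixes_frame (odd_frame i') A].
Proof.
have link_neq (j j' : 'I_k) : Some (inr j') != Some (inr j) :> option ('I_4 + 'I_k) ->
  (j' == j :> nat) = false.
  by apply: contraNF => /eqP/val_inj->; rewrite eqxx.
have corner_neq (s s' : 'I_4) : Some (inl s') != Some (inl s) :> option ('I_4 + 'I_k) ->
  s' != s :> nat.
  by apply: contraNneq => /val_inj->; rewrite eqxx.
have lt_link (j : 'I_k) : (3 + j < k.+4)%N by rewrite !ltnS ltnW.
have lt_linkS (j : 'I_k) : ((3 + j).+1 < k.+4)%N by rewrite !ltnS.
have vlink (j : 'I_k) : (inord (3 + j) : 'I_(k.+4.+1)) = (3 + j)%N :> nat.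
  by rewrite inordK // (leq_trans (lt_link j)).
have vlinkS (j : 'I_k) : (inord (3 + j).+1 : 'I_(k.+4.+1)) = (3 + j).+1 :> nat.
  by rewrite inordK // ltnS.
have [b [nb0 nb1 _ _]] := avoid4 q5 0 1 0 0.
(* The last coordinate, which belongs to no link and no corner, takes the inverse of the product, so
   that the determinant is 1. *)
pose diag (e : nat -> F) : 'rV[F]_(k.+4.+1) := \row_i
  if (i < k.+4)%N then e i else (\prod_(m < k.+4) e m)^-1.
have det_diag1 e : (forall m, e m != 0) -> \det (diag_mx (diag e)) = 1.
  move=> nze; rewrite det_diag big_ord_recr /= mxE ltnn.
  rewrite (eq_bigr (fun m : 'I_k.+4 => e m)) => [|m _]; last by rewrite mxE /= ltn_ord.
  by rewrite divff //; apply/prodf_neq0.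
have diagE e (m : 'I_(k.+4.+1)) : (m < k.+4)%N -> diag e 0 m = e m.
  by move=> lt_m; rewrite mxE lt_m.
case: i => [[s|j]|//] _; last first.
  pose e m : F := if (m <= 3 + j)%N then 1 else b.
  exists (diag_mx (diag e)); split.
  - by apply: det_diag1 => m; rewrite /e; case: ifP; rewrite ?oner_neq0.
  - apply: (@not_scalar_diag _ _ _ ord0 (inord k.+3)).
    rewrite !diagE ?inordK //= /e /=.
    by rewrite !ltnS leqNgt ltn_ord eq_sym.
  case=> [[s|j']|] ni; last by rewrite fixes_frame1 monomial_diag.
    apply: fixes_diag; first exact: odd_corner_unit.
    move=> i i'; rewrite odd_cornerE; case: ifP => [/andP[lt_i lt_i'] _|_].
      have lt4 (m : nat) : (m < 4)%N -> (m < k.+4)%N by move/leq_trans; apply.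
      rewrite !diagE ?lt4 // /e !(leq_trans _ (leq_addr _ _)) //.
    by have [->|] := eqVneq i i'; rewrite ?eqxx.
  apply: (@fixes_link_diag F k.+4) => //; rewrite !diagE ?vlink ?vlinkS ?lt_linkS //.
  by rewrite /e -addnS !leq_add2l leq_eqVlt (link_neq j).
have [s0|ns0] := eqVneq (nat_of_ord s) 0%N.
  (* The lines of a triangle lie in the span of e_0, e_1, e_2, apart from <e_3>, so they are fixed
     by a diagonal matrix which is constant on {0, 1, 2}. *)
  pose e m : F := if (m < 3)%N then b else 1.
  exists (diag_mx (diag e)); split.
  - by apply: det_diag1 => m; rewrite /e; case: ifP; rewrite ?oner_neq0.
  - apply: (@not_scalar_diag _ _ _ ord0 (inord 3)).
    by rewrite !diagE ?inordK //= /e.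
  case=> [[s'|j']|] ni; last by rewrite fixes_frame1 monomial_diag.
    have := corner_neq _ _ ni; rewrite s0 => ns'.
    apply: fixes_diag; first exact: odd_corner_unit.
    move=> i i'; rewrite odd_cornerE; case: ifP => [/andP[lt_i lt_i']|_]; last first.
      by have [->|] := eqVneq i i'; rewrite ?eqxx.
    have lt4 (m : nat) : (m < 4)%N -> (m < k.+4)%N by move/leq_trans; apply.
    have lt3 (m : nat) : (m < 4)%N -> m != 3%N -> (m < 3)%N.
      by rewrite ltnS (ltn_neqAle m) => -> ->.
    rewrite !diagE ?lt4 //; case: (nat_of_ord s') ns' => // t _ /=.
    rewrite /triangle_entry; case: ifP => [_|/norP[n3 n3']].
      by have [/val_inj->|] := eqVneq (i : nat) i'; rewrite ?eqxx.
    by move=> _; rewrite /e !lt3.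
  by apply: (@fixes_link_diag F k.+4) => //; rewrite !diagE ?vlink ?vlinkS ?lt_linkS.
(* For a triangle s, the signed transposition s preserves the Hadamard frame and the other
   triangles; the last diagonal entry corrects its determinant. *)
have lt_s : (0 < s < 4)%N by rewrite lt0n ns0 /=.
have [uR _] := mulmx1_unit (refl_sqr lt_s).
set R := small_mx 4 (refl_entry s) in uR.
pose e : 'rV[F]_k.+1 := \row_m if m == ord_max then (\det R)^-1 else 1.
pose A : 'M[F]_(4 + k.+1) := block_mx R 0 0 (diag_mx e).
have mR : monomial R by apply: refl_monomial; case/andP: lt_s.
have mA : monomial A by apply: monomial_block; rewrite ?monomial_diag.
have nzR : \det R != 0 by rewrite -unitfE -unitmxE.
have AE (i m : 'I_(4 + k.+1)) : (m < k.+4)%N \/ (i < k.+4)%N ->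
    A i m = if ((i < 4) && (m < 4))%N then refl_entry s i m else (i == m)%:R.
  case: (split_ordP i) => i' ->; case: (split_ordP m) => m' -> max_im.
  - by rewrite block_mxEul mxE /=.
  - by rewrite block_mxEur mxE eq_lrshift /=.
  - by rewrite block_mxEdl mxE eq_rlshift /=.
  rewrite block_mxEdr !mxE eq_rshift /=.
  have [eim|_] := eqVneq i' m'; last by rewrite mulr0n.
  rewrite mulr1n; case: eqP => // emax.
  by case: max_im; rewrite -?eim emax /= addSn ltnn.
have s123 : s = 1%N :> nat \/ s = 2%N :> nat \/ s = 3%N :> nat.
  by case: (nat_of_ord s) lt_s => [|[|[|[|]]]] // _; auto.
exists A; split.
- rewrite det_lblock det_diag (bigD1 ord_max) //= mxE eqxx big1 ?mulr1 ?divff //.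
  by move=> m nm; rewrite mxE (negPf nm).
- have /andP[lt_fd lt_d4] : (refl_fst s < refl_snd s < 4)%N.
    by rewrite /refl_fst /refl_snd; case: s123 => [|[]] ->.
  have lt_f4 := ltn_trans lt_fd lt_d4.
  have lt4 (m : nat) : (m < 4)%N -> (m < 4 + k.+1)%N by move/leq_trans; apply.
  apply: (@not_scalar_offdiag _ _ _ (Ordinal (lt4 _ lt_f4)) (Ordinal (lt4 _ lt_d4))).
    by rewrite -val_eqE /= neq_ltn lt_fd.
  rewrite AE; last by left; apply: leq_trans lt_d4 _.
  rewrite /= lt_f4 lt_d4 /refl_entry /swap_nat !eqxx mul1r.
  by case: ifP; rewrite ?oppr_eq0 oner_neq0.
case=> [[s'|j]|] ni; last by rewrite fixes_frame1.
  apply: (fixes_corner (M := refl_image s s')).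
  - exact: odd_corner_unit.
  - by apply: refl_intertwine => //; apply: corner_neq ni.
  - by apply: refl_image_monomial; case/andP: lt_s.
  exact: monomial_diag.
(* The first link meets the corner in the coordinate 3, which the signed transposition fixes. *)
have r3 m : (m < 4)%N -> refl_entry s m 3%N = (m == 3%N)%:R.
  rewrite /refl_entry /refl_fst /refl_snd /swap_nat.
  by case: s123 => [|[]] ->; case: m => [|[|[|[|]]]] // _; rewrite /= ?mulr1 ?mul0r.
have three (m : 'I_(k.+4.+1)) : (3 <= m)%N -> (m < 4)%N -> m = 3%N :> nat.
  by move=> ge lt; apply/eqP; rewrite eqn_leq ge -ltnS lt.
apply: fixes_transvection => //; first exact: (@inord_neqS k.+4).
- move=> i; rewrite AE; last by left; rewrite vlink.
  case: ifP => // /andP[lt_i lt_m].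
  have e3 : (inord (3 + j) : 'I_(k.+4.+1)) = 3%N :> nat.
    by apply: three => //; rewrite vlink leq_addr.
  have -> : (i == inord (3 + j)) = (i == 3%N :> nat) by rewrite -val_eqE /= e3.
  by rewrite [X in refl_entry _ _ X]e3 r3.
move=> i; rewrite AE; last by right; rewrite vlinkS.
by rewrite vlinkS.
Qed.

Lemma base_number_odd :
  (k.+4 <= base_number [set: PSL k.+4.+1 F] (coset_action (PSL_monomial k.+4 F)))%N.
Proof.
have cJ : #|[set~ (None : option ('I_4 + 'I_k))]| = k.+4.
  by rewrite cardsC1 card_option card_sum !card_ord.
rewrite -[X in (X <= _)%N]cJ.
apply: (@leq_base_number_frames k.+4 F _ odd_frame).
- exact: odd_frame_unit.
- exact: odd_frames_base.
by move=> i; rewrite in_setC1; apply: odd_frames_essential.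
Qed.

End OddCharacteristic.

(** * The action is not standard *)

Section Orders.

Import GroupScope.
Local Open Scope nat_scope.

(** The sum telescopes, as p floor(m / p^(K+1)) <= floor(m / p^K). *)
Lemma sum_divn_pow p m K : 0 < p ->
  p.-1 * (\sum_(1 <= k < K.+1) m %/ p ^ k) + m %/ p ^ K <= m.
Proof.
move=> p0; elim: K => [|K IHK].
  by rewrite big_geq // muln0 expn0 divn1.
rewrite big_nat_recr //= mulnDr; apply: leq_trans IHK; rewrite -addnA leq_add2l.
rewrite -{2}[m %/ _]mul1n -mulnDl addn1 prednK // expnSr divnMA mulnC.
exact: leq_trunc_div.
Qed.

(* Legendre's formula, with p <= 2 ^ (p - 1). *)
Lemma partn_fact_le p m : prime p -> p ^ logn p m`! <= 2 ^ m.
Proof.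
move=> pr_p; have p0 := prime_gt0 pr_p; have p1 := prime_gt1 pr_p.
have le_p : p <= 2 ^ p.-1 by rewrite -{1}(prednK p0) ltn_expl.
apply: (@leq_trans (2 ^ (p.-1 * logn p m`!))).
  by rewrite expnM; case: (logn p m`!) => [|v]; rewrite ?expn0 ?leq_exp2r.
rewrite leq_exp2l // logn_fact //; apply: leq_trans (sum_divn_pow m m p0).
exact: leq_addr.
Qed.

Lemma leq_fact_exp j : 16 ^ j <= (16 + j)`!.
Proof.
elim: j => [|j IHj]; first by rewrite fact_gt0.
rewrite addnS factS expnS leq_mul //.
Qed.

(** With m = 16 + j, use 16^j <= m! and 3 (16 + j) + 1 < 4 j. The bound 152 = 2 (78 - 2) is the one
    that [PSL_not_Alt] obtains for m. *)
Lemma fact_gt_exp8 m : 152 <= m -> 2 * 8 ^ m < m`!.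
Proof.
move=> le_m; pose j := m - 16.
have le_16m : 16 <= m by apply: leq_trans le_m.
have -> : m = 16 + j by rewrite subnKC.
have le_j : 136 <= j by rewrite leq_subRL.
apply: leq_trans (leq_fact_exp j).
have -> : 2 * 8 ^ (16 + j) = 2 ^ (3 * (16 + j)).+1 by rewrite expnS expnM.
have -> : 16 ^ j = 2 ^ (4 * j) by rewrite expnM.
rewrite ltn_exp2l // mulnDr (mulSn 3) -addSn ltn_add2r.
exact: leq_trans le_j.
Qed.

End Orders.

(** * Comparison with the orders of the alternating groups *)

Section NotAlternating.

Import GroupScope.
Local Open Scope nat_scope.

Variables (n : nat) (F : finFieldType).
Hypotheses (n12 : 12 <= n) (q5 : 5 <= #|F|).
Local Notation SLg := (SL n.+1 F).

Lemma card_PSL : #|[set: PSL n.+1 F]| * #|'Z(SLg)| = #|SLg|.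
Proof.
rewrite -im_PSL_proj card_morphim setIid ker_PSL_proj mulnC Lagrange //.
exact: center_sub.
Qed.

Lemma card_center_SL : #|'Z(SLg)| <= #|F|.
Proof.
rewrite -[X in _ <= X]cardsT.
pose f (g : {'GL_n.+1[F]}) : F := GLval g 0%R 0%R.
have injf : {in 'Z(SLg) &, injective f}.
  move=> g h Zg Zh /= e; apply: val_inj => /=.
  have scal x : x \in 'Z(SLg) -> GLval x = ((f x)%:M)%R.
    move=> Zx; have Sx := subsetP (center_sub _) _ Zx.
    have /(center_SLP Sx)/is_scalar_mxP[a ea] := Zx.
    by rewrite /f ea mxE eqxx mulr1n.
  by rewrite [LHS](scal g Zg) e -(scal h Zh).
by rewrite -(card_in_imset injf) subset_leq_card ?subsetT.
Qed.

Lemma index_SL : #|'GL_n.+1[F] : SLg| <= #|F|.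
Proof.
rewrite -[X in _ <= X]cardsT.
pose f (A : {set {'GL_n.+1[F]}}) : F := (\det (GLval (repr A)))%R.
have injf : {in rcosets SLg 'GL_n.+1[F] &, injective f}.
  move=> A B /rcosetsP[g _ ->] /rcosetsP[h _ ->] e.
  rewrite -(rcoset_repr SLg g) -(rcoset_repr SLg h); apply: rcoset_eqP.
  rewrite mem_rcoset SL_det; set x := repr _ in e *; set y := repr _ in e *.
  rewrite [GLval _](_ : _ = GLval x *m invmx (GLval y))%R //.
  by rewrite det_mulmx det_inv [(\det _)%R]e divff // -unitfE -unitmxE (GL_unitmx y).
by rewrite /indexg -(card_in_imset injf) subset_leq_card ?subsetT.
Qed.

Lemma card_GL_factor :
  #|'GL_n.+1[F]| = #|[set: PSL n.+1 F]| * #|'Z(SLg)| * #|'GL_n.+1[F] : SLg|.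
Proof. by rewrite card_PSL Lagrange ?subsetT. Qed.

(** With C = n (n + 1) / 2, the p-parts give q^(C - 2) <= 2^m, where two factors q account for the
    center and for the index of SL in GL. The whole order is then at most q^((n + 1)^2) <= q^(3 (C -
    2)) <= 8^m, which is less than m!/2. *)
Lemma PSL_not_Alt m : #|[set: PSL n.+1 F]| != #|'Alt_('I_m)|.
Proof.
apply/negP=> /eqP eA; have [p pr_p pF] := finPcharP F.
have := card_pprimeChar pF; set e := logn _ _ => qE.
have p1 := prime_gt1 pr_p; have p0 := prime_gt0 pr_p.
have le5q := q5; set q := #|F| in le5q qE.
have q0 : 0 < q by apply: leq_trans le5q.
pose C := 'C(n.+1, 2).
have A_dvd : #|'Alt_('I_m)| %| m`!.
  rewrite -[X in X`!]card_ord -card_Sym cardSg //; exact: Alt_subset.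
have le_part a : 0 < a -> p ^ logn p a <= a by move=> a0; rewrite -p_part dvdn_leq ?dvdn_part.
have C2 : C * 2 = n.+1 * n by have := bin_ffact n.+1 2; rewrite ffactSS ffactn1.
  have dQ : q ^ C %| #|'GL_n.+1[F]| by rewrite card_GL // dvdn_mulr.
  clearbody C.
  have leQ : q ^ C <= 2 ^ m * (q * q).
  have : logn p (q ^ C) <= logn p #|'GL_n.+1[F]| by rewrite dvdn_leq_log ?cardG_gt0.
  rewrite card_GL_factor !lognM ?muln_gt0 ?cardG_gt0 ?indexg_gt0 //.
  rewrite -(leq_exp2l (logn p (q ^ C)) _ p1) !expnD.
  have -> : p ^ logn p (q ^ C) = q ^ C by rewrite qE -expnM pfactorK.
  move/leq_trans; apply; rewrite -mulnA leq_mul ?leq_mul //.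
  - rewrite eA; apply: leq_trans (partn_fact_le m pr_p).
    by rewrite leq_exp2l // dvdn_leq_log ?fact_gt0.
  - exact: leq_trans (le_part _ (cardG_gt0 _)) card_center_SL.
  exact: leq_trans (le_part _ (indexg_gt0 _ _)) index_SL.
have C78 : 78 <= C.
  by rewrite -(leq_pmul2r (isT : 0 < 2)) C2 (@leq_mul 13 12).
have leC : q ^ (C - 2) <= 2 ^ m.
  have q2 : 0 < q * q by rewrite muln_gt0 q0.
  rewrite -(leq_pmul2r q2) (leq_trans _ leQ) // mulnn -expnD subnK //.
  by apply: leq_trans C78.
have le_m : 152 <= m.
  rewrite -(leq_exp2l 152 m (isT : 1 < 2)); apply: leq_trans leC.
  apply: (@leq_trans (4 ^ (C - 2))); last first.
    by rewrite leq_exp2r ?(ltnW le5q) // subn_gt0 (leq_trans _ C78).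
  rewrite -[4]/(2 ^ 2) -expnM leq_exp2l //.
  by rewrite (@leq_mul 2 76) // leq_subRL // (leq_trans _ C78).
have le_GL : #|'GL_n.+1[F]| <= q ^ (n.+1 * n.+1).
  by rewrite cardsT /q -card_mx (leq_card (@GLval n.+1 F)) //; apply: val_inj.
have le_f : m`! <= 2 * 8 ^ m.
  rewrite -[X in X`!]card_ord -card_Alt ?card_ord ?(leq_trans _ le_m) // leq_mul //.
  rewrite -eA; apply: (@leq_trans (q ^ (n.+1 * n.+1))).
    apply: leq_trans le_GL; rewrite card_GL_factor -mulnA leq_pmulr //.
    by rewrite muln_gt0 cardG_gt0 indexg_gt0.
  have -> : 8 ^ m = (2 ^ m) ^ 3 by rewrite -expnM mulnC expnM.
  apply: (@leq_trans ((q ^ (C - 2)) ^ 3)); last by rewrite leq_exp2r.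
  rewrite -expnM leq_exp2l ?(leq_trans _ le5q) //.
  have : 12 * n <= n * n by rewrite leq_mul2r n12 orbT.
  lia.
by move: (fact_gt_exp8 le_m); rewrite ltnNge le_f.
Qed.

End NotAlternating.

(** * Irreducibility and the absence of invariant forms *)

Section NotSubspace.

Import GroupScope.
Local Open Scope ring_scope.

Variables (n : nat) (F : finFieldType).
Hypotheses (n4 : (4 <= n)%N) (q5 : (5 <= #|F|)%N).
Local Notation GLT := {'GL_n.+1[F]}.
Local Notation SLg := (SL n.+1 F).
Local Notation pi := (PSL_proj_morphism n.+1 F).

(** Differences v t - v with t in the torus lead from a nonzero vector of W to a coordinate vector,
    which even permutations move to all the others. *)
Lemma monomial_row_full m (W : 'M[F]_(m, n.+1)) :
  {in monomial_group n F, forall h : GLT, (W *m GLval h <= W)%MS} -> W != 0 -> row_full W.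
Proof.
move=> sW /rowV0Pn[w sw nzw].
have actW (v : 'rV_n.+1) (A : 'M_n.+1) :
    \det A = 1 -> monomial A -> (v <= W -> v *m A <= W)%MS.
  move=> dA mA sv; have [h Sh eh] := SL_lift dA.
  by apply: submx_trans (submxMr _ sv) _; rewrite -eh sW // mem_monomial Sh eh.
have /rV0Pn[j nzj] := nzw.
have [|k] := @avoid_ord n.+1 [:: j]; first by rewrite ltnS (leq_trans _ n4).
rewrite inE => nkj.
have [|l] := @avoid_ord n.+1 [:: j; k]; first by rewrite ltnS (leq_trans _ n4).
rewrite !inE negb_or => /andP[nlj nlk].
have [x [nx0 nx1 _ _]] := avoid4 q5 0 1 0 0.
(* This is v t - v for t = [torus2 j a x]; taken with a = k and then a = l, it leaves only the
   coordinate j. *)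
pose d (v : 'rV_n.+1) a : 'rV_n.+1 :=
  (x - 1) * v 0 j *: delta_mx 0 j + (x^-1 - 1) * v 0 a *: delta_mx 0 a.
have torusW (v : 'rV_n.+1) a : a != j -> (v <= W)%MS ->
    (d v a <= W)%MS.
  move=> naj sv.
  have -> : d v a = v *m torus2 j a x - v; last first.
    by apply: addmx_sub; rewrite ?eqmx_opp // actW ?det_torus2 ?monomial_diag // eq_sym.
  apply/rowP=> b; rewrite mul_mx_diag !mxE /=.
  have [->|nbj] := eqVneq b j.
    by rewrite eq_sym (negPf naj) mulr0 addr0 mulr1 mulrBl mul1r mulrC.
  have [->|nba] := eqVneq b a; rewrite mulr0 add0r.
    by rewrite mulr1 mulrBl mul1r mulrC.
  by rewrite mulr1 mulr0 subrr.
have ej : ((delta_mx 0 j : 'rV_n.+1) <= W)%MS.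
  have := torusW _ l nlj (torusW _ k nkj sw).
  have -> : d (d w k) l = ((x - 1) * ((x - 1) * w 0 j)) *: delta_mx 0 j.
    rewrite {1}/d !mxE !eqxx (eq_sym j) (negPf nkj) (negPf nlj) (negPf nlk) /=.
    by rewrite !mulr0 !addr0 !mulr1 mulr0 scale0r addr0.
  move/(scalemx_sub ((x - 1) * ((x - 1) * w 0 j))^-1).
  by rewrite scalerA mulVf ?scale1r // !mulf_neq0 ?subr_eq0.
rewrite -sub1mx; apply/row_subP=> i; rewrite row1.
have [|//|//|t [et tj _]] := @even_perm_move n.+1 j i [::].
  by rewrite ltnS (leq_trans _ n4).
have <- : (delta_mx 0 j : 'rV[F]_n.+1) *m perm_mx t = delta_mx 0 i.
  by rewrite -rowE; apply/rowP=> b; rewrite !mxE tj eq_sym.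
by rewrite actW ?monomial_perm // det_perm (negPf et).
Qed.

Lemma conj_monomial_irreducible g (M : {group PSL n.+1 F}) : g \in SLg ->
  PSL_monomial n F :^ PSL_proj g \subset M -> ~ acts_reducibly pi M.
Proof.
move=> Sg sHM; apply; apply/mx_irrP; split=> // U /mxmoduleP modU nzU.
have ug : GLval g \in unitmx := GL_unitmx g.
have: row_full (U *m invmx (GLval g)).
  apply: monomial_row_full => [h Nh|]; last first.
    by apply: contraNneq nzU => z; rewrite -[U](mulmxKV ug) z mul0mx.
  have Sh := subsetP (monomial_sub n F) h Nh.
  have /modU : (h ^ g)%g \in pi @*^-1 M.
    apply/morphpreP; split; first by rewrite groupJ.
    by rewrite morphJ // (subsetP sHM) // memJ_conjg mem_morphim.
  rewrite [subg_repr _ _ _](_ : _ = invmx (GLval g) *m GLval h *m GLval g); last first.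
    by rewrite -[LHS]/(GLval (h ^ g)%g) conjgE mulgA.
  by move/(submxMr (invmx (GLval g))); rewrite !mulmxA mulmxK.
by rewrite /row_full mxrankMfree // row_free_unit unitmx_inv.
Qed.

Lemma isometries_group_set (J : 'M[F]_n.+1) : group_set (@Defs.isometries n.+1 F J).
Proof.
apply/group_setP; split=> [|g h]; first by rewrite inE GL_1E trmx1 mul1mx mulmx1.
rewrite !inE => /eqP gJ /eqP hJ.
by rewrite GL_ME trmx_mul !mulmxA -(mulmxA (GLval g)) -(mulmxA (GLval g)) hJ gJ.
Qed.

(** For the transvection h = 1 + E_i0, the entries (i, l) of h J h^T and J differ by J_0l, which is
    chosen nonzero. *)
Lemma SL_not_isometries (J : 'M[F]_n.+1) : J \in unitmx ->
  ~ SLg \subset @Defs.isometries n.+1 F J.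
Proof.
move=> uJ sSJ; have [l /negP[]] := unitmx_row ord0 uJ.
have [|i] := @avoid_ord n.+1 [:: ord0; l]; first by rewrite ltnS (leq_trans _ n4).
rewrite !inE negb_or => /andP[ni0 nil].
have [h Sh eh] := SL_lift (det_transvection (1 : F) ni0).
have := subsetP sSJ h Sh; rewrite inE => /eqP/matrixP/(_ i l).
have -> : GLval h *m J = J + delta_mx i ord0 *m J.
  by rewrite eh scale1r mulmxDl mul1mx.
rewrite eh scale1r linearD /= trmx1 trmx_delta mulmxDr mulmx1 !mxE.
rewrite [X in _ + X]big1 => [|k _]; last first.
  by rewrite [X in _ * X]mxE (eq_sym l) (negPf nil) andbF mulr0.
rewrite addr0 (bigD1 ord0) //= big1 => [|k nk]; last by rewrite mxE (negPf nk) andbF mul0r.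
by rewrite mxE !eqxx mul1r addr0 => /eqP; rewrite -subr_eq0 addrAC subrr add0r.
Qed.

Lemma PSL_monomial_not_subspace (maxH : maximal (PSL_monomial n F) [set: PSL n.+1 F]) :
  ~ subspace_action pi [set: PSL n.+1 F] (coset_action (PSL_monomial n F)).
Proof.
case=> _ [x]; have [u ->] := coset_ptP x; have [g Sg ->] := PSL_projP u.
have im : pi @* SLg = [set: PSL n.+1 F] := im_PSL_proj n.+1 F.
(* The point stabilizer is itself maximal, so it can serve as M. *)
move/(_ (PSL_monomial n F :^ PSL_proj g)%G); rewrite im.
rewrite setTI setIT coset_stab subxx => /(_ _ isT)[].
- by rewrite -(conjTg (PSL_proj g)) maximalJ.
- exact: conj_monomial_irreducible (subxx _).
case=> _ [J [A [[uJ _ _] eX _]]].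
have [] := SL_not_isometries uJ.
by have := der_sub 1 (Group (isometries_group_set J)); rewrite /= -eX.
Qed.

End NotSubspace.

Section MonomialAction.

Local Open Scope nat_scope.
Import GroupScope.

Variables (m : nat) (F : finFieldType).
Hypotheses (m12 : 12 <= m) (q5 : 5 <= #|F|).
Local Notation T := (coset_type (PSL_monomial m F)).
Local Notation to := (coset_action (PSL_monomial m F)).

Lemma PSL_monomial_nonstandard : ~ PSL_standard to.
Proof.
case=> _ [[d [f [injf eA _]]]|].
  have /eqP[] := PSL_not_Alt m12 q5 d.
  by rewrite -eA card_injm ?subxx.
apply: PSL_monomial_not_subspace; rewrite ?(leq_trans _ m12) //.
exact: PSL_monomial_maximal.
Qed.

Lemma PSL_monomial_base_number : m <= base_number [set: PSL m.+1 F] to.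
Proof.
have [/existsP[w /andP[nzw nw1]]|] :=
    boolP [exists w : F, (w != 0%R) && (w ^+ m.+1 != 1)%R].
  by apply: base_number_nondiv nzw nw1; apply: leq_trans m12.
rewrite negb_exists => /forallP expF0.
have expF (w : F) : w != 0%R -> (w ^+ m.+1 = 1)%R.
  by move=> nzw; have := expF0 w; rewrite nzw /= negbK => /eqP.
have [F2|nF2] := eqVneq (2%:R : F)%R 0%R; last first.
  have em : m = (m - 4).+4 by lia.
  have m2 : 2 <= m - 4 by lia.
  by move: expF; rewrite em; apply: base_number_odd.
have em : m = (m - 2).+2 by lia.
have m2 : 2 <= m - 2 by lia.
have [u [nzu nu1 _ _]] := avoid4 q5 0%R 1%R 0%R 0%R.
have [v [nzv nv1 nvu _]] := avoid4 q5 0%R 1%R u 0%R.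
move: expF; rewrite em => expF.
by apply: (base_number_even q5 m2 F2 expF nzu nzv nu1 nv1); rewrite eq_sym.
Qed.

End MonomialAction.

Close Scope ring_scope.

Theorem lemma6p1 (n q : nat) (F : finFieldType) (hn : 13 <= n) (hq : 5 <= q)
    (hF : #|F| = q) :
  exists (T : finType) (to : {action PSL n F &-> T}),
    [/\ [primitive [set: PSL n F], on [set: T] | to],
        ~ PSL_standard to
      & n - 1 <= base_number [set: PSL n F] to].
Proof.
rewrite -hF in hq; case: n hn => [//|m m12].
exists (coset_type (PSL_monomial m F)), (coset_action (PSL_monomial m F)); split.
- exact/coset_primitive/PSL_monomial_maximal.
- exact: PSL_monomial_nonstandard.
by rewrite subn1; apply: PSL_monomial_base_number.
Qed.
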